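(* Let $U$ be an open domain in $\mathbb R^n$ and let $U\subseteq\bigcup_i D_i$ be a finite closed cover such that each $D_i$ is a convex polytope. Suppose $M\ni 0$ is an analytic submanifold in $U$ and $V(x)$ is a $C^1$ vector field on $U$ such that (i) $V(x)$ is analytic on each $D_i\cap U$, (ii) $DV(x)(T_xM)\subseteq T_xM$ for all $x\in M$, (iii) $V(0)=0$, and (iv) $DV(0)|_{T_0M}$ is diagonalizable and has only negative eigenvalues. Suppose $x(t)$ is a flow on $M$ such that (i') $x'(t)=V(x(t))$ on $[0,\infty)$, and (ii') $\lim_{t\to\infty}x(t)=0$. Then there exist finitely many increasing numbers $0=t_0<t_1<\dots<t_{N-1}<t_N=\infty$ such that for every $i\in\{1,\dots,N\}$ one has $x([t_{i-1},t_i))\subseteq D_j$ for some $j$.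
   Context: A half space in $\mathbb R^n$ is a set $\{x\in\mathbb R^n:a_1x_1+\dots+a_nx_n\ge b\}$ with $(a_1,\dots,a_n)\in\mathbb R^n$ nonzero and $b\in\mathbb R$. A convex polytope is a subset $D\subseteq\mathbb R^n$ with nonempty interior that is the intersection of finitely many half spaces (it need not be bounded). A vector field on $U\subseteq\mathbb R^n$ is a function $U\to\mathbb R^n$. A function $f$ on an arbitrary subset $W\subseteq\mathbb R^n$ is called analytic if there exist an open superset $\tilde W$ of $W$ and a (real-)analytic function $\tilde f$ on $\tilde W$ with $\tilde f\equiv f$ on $W$. Given $M\subseteq\mathbb R^n$, a flow on $M$ is a continuous function from $[T,\infty)$ to $M$ for some $T\in\mathbb R$. $DV(x)$ is the derivative of $V$ at $x$, and $T_xM\subseteq\mathbb R^n$ is the tangent space of $M$ at $x$. *)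

(* Defs.v *)
From HB Require Import structures.
From mathcomp Require Import all_boot all_order all_algebra.
From mathcomp Require Import all_classical all_reals all_analysis.
From mathcomp Require showcase.summability.
Set Implicit Arguments.
Unset Strict Implicit.
Unset Printing Implicit Defensive.
Import Order.TTheory GRing.Theory Num.Theory.
Import numFieldNormedType.Exports.
Local Open Scope classical_set_scope.
Local Open Scope ring_scope.

Definition half_space (R : realType) (n : nat) (H : set 'rV[R]_n) : Prop :=
  exists (a : 'rV[R]_n) (b : R),
    a != 0 /\ H = [set x | b <= \sum_(i < n) a 0 i * x 0 i].

(* k = 0 is allowed: the whole space is a polytope. *)
Definition convex_polytope (R : realType) (n : nat) (D : set 'rV[R]_n) : Prop :=
  D° !=set0 /\
  exists (k : nat) (H : 'I_k -> set 'rV[R]_n),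
    (forall i, half_space (H i)) /\ D = \bigcap_(i in [set: 'I_k]) H i.

(* Convergence along the filter of finite sets of multi-indices is
   unconditional, hence (in finite dimension) absolute convergence. *)
Definition analytic_at (R : realType) (n m : nat)
    (f : 'rV[R]_n -> 'rV[R]_m) (p : 'rV[R]_n) : Prop :=
  exists (r : R) (c : {ffun 'I_n -> nat} -> 'rV[R]_m),
    0 < r /\
    forall x : 'rV[R]_n, ball p r x ->
      summability.partial_sum
        (fun a : {ffun 'I_n -> nat} =>
           (\prod_(i < n) (x 0 i - p 0 i) ^+ a i) *: c a)
        @ summability.totally --> f x.

Definition analytic_on (R : realType) (n m : nat)
    (f : 'rV[R]_n -> 'rV[R]_m) (W : set 'rV[R]_n) : Prop :=
  exists (W' : set 'rV[R]_n) (f' : 'rV[R]_n -> 'rV[R]_m),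
    [/\ open W', W `<=` W', forall p, W' p -> analytic_at f' p
      & forall p, W p -> f' p = f p].

Definition C1_on (R : realType) (n m : nat)
    (f : 'rV[R]_n -> 'rV[R]_m) (U : set 'rV[R]_n) : Prop :=
  (forall x, U x -> differentiable f x) /\
  {within U, continuous (jacobian f)}.

(* Embedded, without boundary, not required to be closed in U.  Around each
   point, phi is a bianalytic chart A -> B with inverse psi that straightens M
   to the first d coordinates. *)
Definition analytic_submanifold (R : realType) (n : nat)
    (U M : set 'rV[R]_n) : Prop :=
  M `<=` U /\
  exists2 d : nat, (d <= n)%N &
  forall p, M p ->
  exists (A B : set 'rV[R]_n) (phi psi : 'rV[R]_n -> 'rV[R]_n),
    [/\ open A, A p & open B] /\
    [/\ analytic_on phi A, analytic_on psi B,
        phi @` A `<=` B & psi @` B `<=` A] /\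
    [/\ forall x, A x -> psi (phi x) = x,
        forall y, B y -> phi (psi y) = y
      & phi @` (M `&` A) =
        B `&` [set y | forall i : 'I_n, (d <= i)%N -> y 0 i = 0]].

(* Velocities of C^1 curves in M through x. *)
Definition tangent_space (R : realType) (n : nat)
    (M : set 'rV[R]_n) (x : 'rV[R]_n) : set 'rV[R]_n :=
  [set v | exists g : R -> 'rV[R]_n,
    [/\ g 0 = x,
        \forall s \near (0 : R), M (g s),
        \forall s \near (0 : R), derivable g s 1,
        \forall s \near (0 : R), {for s, continuous (derive1 g)}
      & derive1 g 0 = v]].

(* The restriction of the row-vector map v |-> v *m J to the subspace S is
   represented by restrictmx B J, for any B whose row space is S; this is
   meaningful when J stabilizes S. *)
Definition diagonalizable_neg_on (R : realType) (n : nat)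
    (J : 'M[R]_n) (S : set 'rV[R]_n) : Prop :=
  exists B : 'M[R]_n,
    [/\ S = [set v | (v <= B)%MS],
        stablemx B J,
        diagonalizable (restrictmx B J)
      & forall a : R, eigenvalue (restrictmx B J) a -> a < 0].

Definition flow_on (R : realType) (n : nat)
    (M : set 'rV[R]_n) (T : R) (x : R -> 'rV[R]_n) : Prop :=
  {within `[T, +oo[, continuous x} /\ forall s, T <= s -> M (x s).

(* Derivative of x as a function on the interval I: two-sided at interior
   points, one-sided at an endpoint. *)
Definition has_derivative_within (R : realType) (n : nat)
    (I : set R) (x : R -> 'rV[R]_n) (t : R) (v : 'rV[R]_n) : Prop :=
  (s - t)^-1 *: (x s - x t) @[s --> within I (t^')] --> v.

(* Main.v *)
Require Import Defs.
From HB Require Import structures.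
From mathcomp Require Import all_boot all_order all_algebra finmap.
From mathcomp Require Import all_classical all_reals all_analysis.
From mathcomp Require Import ring lra zify.
Set Implicit Arguments.
Unset Strict Implicit.
Unset Printing Implicit Defensive.
Import Order.TTheory GRing.Theory Num.Theory.
Import numFieldNormedType.Exports.
Local Open Scope classical_set_scope.
Local Open Scope ring_scope.

(** Write [s = - ln `|t - t0|] near a finite time [t0], from one side, and [s = t] near infinity.
Everything rests on a local claim: as [s] goes to infinity the orbit [y s] stays in one of the
polyhedra. The claim makes every point of the compact interval of times from 0 to infinity the end
of subintervals that need one polyhedron only, and a supremum argument turns this into a finite
subdivision ([chain_finite], [chain_infinite]).

The local claim follows if each of the finitely many affine functions that define the polyhedra has
along [y] an eventually constant sign, positive, negative or zero ([one_piece]). Call a half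
space bad if its affine function has not; its boundary then contains the limit point [p] of [y].
Let [h_1], ..., [h_m] be the affine functions of the bad half spaces. Two facts play against each
other.

- The field is almost analytic along the orbit. Since [V] is [C^1] across the pieces, its
  difference with the analytic extension of one well chosen piece is not only [O(|h|)] but
  [O(|h|^2)] along [y] ([field_near_piece]): go from [y s] in a direction transversal to the bad
  hyperplanes until the chosen piece is reached, at a distance [O(|h|)], where both the difference
  and its derivative vanish.

- An orbit of an analytic field with an error of that order cannot oscillate
  ([definite_or_zero]). Suppose that the orbit is given by functions [X_i] that decay exponentially
  and satisfy [X_i' = - lam_i X_i + N_i(X) + e_i], with [N_i] an analytic germ of higher order and
  [e_i = O(|h(X)|^2)]. If the [h_k(X)] decay at a rate [mu], then [e_i] decays at the rate [2 mu],
  and by linear equations solved one after the other every analytic germ evaluated on [X] either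
  has a definite sign or decays at all rates below [2 mu] ([negl_or_signed_ev]). So if no [h_k] gets a
  definite sign, all of them decay faster than any exponential ([h_sexp]). The germs with this
  property form an ideal, which the derivation along the equation preserves. The ring of convergent
  power series is noetherian ([cvps_noetherian]), so the ideal is generated by finitely many germs;
  the sum [G] of their squares along [X] satisfies [|G'| <= C G], and a superexponentially small
  solution of this inequality is zero. Hence the [h_k(X)] vanish, and they are not bad after all
  ([h_eq0]).

Near a finite time the system for the deviation [y - p] and for [tau = exp (- s)] has the required
form ([piece_finite_time]). Near infinity the required form comes from coordinates on [M] that
diagonalize the derivative of [V] on the tangent space, where all its eigenvalues are negative
([adapted_chart], [piece_infinity]). *)

(** * Unconditional sums *)

Existing Instance summability.totally_filter.
Notation totally := summability.totally.

Section sums.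
Variable R : realType.
Implicit Types (K : choiceType).

Definition psum K (f : K -> R) (F : {fset K}) : R := \sum_(i <- F) f i.

(** The bound is kept explicit because all the estimates below are norm estimates. *)
Definition absum K (f : K -> R) (C : R) : Prop :=
  forall F : {fset K}, \sum_(i <- F) `|f i| <= C.

Definition tsum K (f : K -> R) : R := lim (psum f @ totally).

Lemma totallyW K (F : {fset K}) (P : {fset K} -> Prop) :
  (forall G : {fset K}, (F `<=` G)%fset -> P G) -> \forall G \near totally, P G.
Proof. by move=> h; exists F => // G /=; exact: h. Qed.

Lemma psum_le K (F : {fset K}) (f g : {fset K} -> R) (a b : R) :
  f @ totally --> a -> g @ totally --> b ->
  (forall G : {fset K}, (F `<=` G)%fset -> f G <= g G) -> a <= b.
Proof.
move=> fa gb h.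
rewrite leNgt; apply/negP => ba; have e0 : 0 < (a - b) / 3 by lra.
move/cvgrPdist_le/(_ _ e0): fa => [F1 _ /(_ (F `|` (F1 `|` _))%fset) h1].
move/cvgrPdist_le/(_ _ e0): gb => [F2 _ /(_ (F `|` (_ `|` F2))%fset) h2].
have /= := h1 F2 ltac:(by rewrite /= fsubsetU // fsubsetU ?fsubset_refl ?orbT).
have /= := h2 F1 ltac:(by rewrite /= fsubsetU // fsubsetU ?fsubset_refl ?orbT).
have := h (F `|` (F1 `|` F2))%fset (fsubsetUl _ _).
rewrite !ler_norml => ? /andP[? ?] /andP[? ?]; lra.
Qed.

Lemma psum_cst K (F : {fset K}) (f : {fset K} -> R) (a : R) :
  (forall G : {fset K}, (F `<=` G)%fset -> f G = a) -> f @ totally --> a.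
Proof.
move=> h; apply/cvgrPdist_le => e e0; apply: (totallyW (F := F)) => G /h ->.
by rewrite subrr normr0 ltW.
Qed.

Lemma psum_sub K (f : K -> R) (F G : {fset K}) : (forall i, 0 <= f i) ->
  (F `<=` G)%fset -> psum f F <= psum f G.
Proof.
move=> f0 FG; rewrite /psum (big_fsetID _ (mem F) G) /=.
have -> : [fset x in G | x \in F]%fset = F.
  by apply/fsetP => x; rewrite !inE /= andbC; case: (boolP (x \in F)) => //= /(fsubsetP FG).
by rewrite lerDl; apply: sumr_ge0.
Qed.

Lemma cvg_psum_ge0 K (f : K -> R) C : (forall i, 0 <= f i) ->
  (forall F, psum f F <= C) -> cvg (psum f @ totally).
Proof.
move=> f0 fC; set S := [set psum f F | F in [set: {fset K}]].
have hS : has_sup S.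
  by split; [exists (psum f fset0), fset0|exists C => _ [F _ <-]].
apply/cvg_ex; exists (sup S); apply/cvgrPdist_le => e e0.
have [_ [F _ <-] hF] := sup_adherent e0 hS.
apply: (totallyW (F := F)) => G FG.
have h1 : psum f G <= sup S by apply: ub_le_sup; [case: hS|exists G].
have h2 := psum_sub f0 FG.
by rewrite ger0_norm ?subr_ge0//; lra.
Qed.

Lemma absum_ge0 K (f : K -> R) C : absum f C -> 0 <= C.
Proof. by move=> /(_ fset0); rewrite big_seq_fset0. Qed.

Lemma absum_cvg K (f : K -> R) C : absum f C -> psum f @ totally --> tsum f.
Proof.
move=> fC; suff : cvg (psum f @ totally) by [].
have -> : psum f = (psum (fun i => `|f i| + f i) \- psum (fun i => `|f i|)).
  by apply/funext => F; rewrite /psum /= -sumrB; apply: eq_bigr => i _; ring.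
apply: is_cvgB; last by apply: (cvg_psum_ge0 (C := C)).
apply: (cvg_psum_ge0 (C := C + C)) => [i|F].
  by rewrite -lerBlDl sub0r lerNl -normrN ler_norm.
rewrite /psum big_split /=; apply: lerD => //; apply: le_trans (fC F).
by apply: ler_sum => i _; apply: ler_norm.
Qed.

Lemma tsumP K (f : K -> R) l : psum f @ totally --> l -> tsum f = l.
Proof. by move=> h; apply/cvg_lim. Qed.

Lemma absum_le K (f g : K -> R) C : (forall i, `|f i| <= `|g i|) ->
  absum g C -> absum f C.
Proof. by move=> fg gC F; apply: le_trans (gC F); apply: ler_sum. Qed.

Lemma absum_leC K (f : K -> R) C C' : C <= C' -> absum f C -> absum f C'.
Proof. by move=> h fC F; apply: le_trans h. Qed.

Lemma absum_norm K (f : K -> R) C : absum f C -> absum (fun i => `|f i|) C.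
Proof. by apply: absum_le => i; rewrite normr_id. Qed.

Lemma absumD K (f g : K -> R) C D : absum f C -> absum g D ->
  absum (fun i => f i + g i) (C + D).
Proof.
move=> fC gD F; apply: le_trans (lerD (fC F) (gD F)).
by rewrite -big_split /=; apply: ler_sum => i _; apply: ler_normD.
Qed.

Lemma absumZ K (f : K -> R) C a : absum f C -> absum (fun i => a * f i) (`|a| * C).
Proof.
move=> fC F; under eq_bigr do rewrite normrM; rewrite -mulr_sumr.
by rewrite ler_wpM2l.
Qed.

Lemma absum0 K : absum (fun _ : K => 0) 0.
Proof. by move=> F; rewrite big1 // => i _; rewrite normr0. Qed.

Lemma absum_tsum K (f : K -> R) C : absum f C -> `|tsum f| <= C.
Proof.
move=> fC; have /cvg_norm h := absum_cvg fC.
apply: (@psum_le _ fset0 _ (fun=> C) _ _ h); first exact: cvg_cst.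
move=> G _; apply: le_trans (fC G); apply: ler_norm_sum.
Qed.

Lemma tsum_absum_ge0 K (f : K -> R) C : (forall i, 0 <= f i) -> absum f C ->
  absum f (tsum f).
Proof.
move=> f0 fC F.
under eq_bigr => i _ do rewrite ger0_norm //.
apply: (@psum_le _ F (fun=> psum f F) _ _ _ _ (absum_cvg fC)) => [|G FG].
  exact: cvg_cst.
exact: psum_sub.
Qed.

Lemma absum_single K (k : K) (f : K -> R) : (forall i, i != k -> f i = 0) ->
  absum f `|f k|.
Proof.
move=> h F; case: (boolP (k \in F)) => kF.
  rewrite (big_fsetD1 k) //= big1_fset ?addr0 // => i; rewrite !inE => /andP[ik _] _.
  by rewrite h // normr0.
rewrite big1_fset // => i iF _; rewrite h ?normr0 //.
by apply: contraNneq kF => <-.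
Qed.

Lemma tsum_single K (k : K) (f : K -> R) : (forall i, i != k -> f i = 0) ->
  tsum f = f k.
Proof.
move=> h; apply: tsumP; apply: (psum_cst (F := [fset k]%fset)) => G; rewrite fsub1set => kG.
rewrite /psum (big_fsetD1 k) //= big1_fset ?addr0 // => i; rewrite !inE => /andP[ik _] _.
by rewrite h.
Qed.

Lemma tsum0 K : tsum (fun _ : K => 0) = 0.
Proof.
apply: tsumP; by apply: (psum_cst (F := fset0)) => G _; rewrite /psum big1.
Qed.

Lemma tsumD K (f g : K -> R) C D : absum f C -> absum g D ->
  tsum (fun i => f i + g i) = tsum f + tsum g.
Proof.
move=> fC gD; apply: tsumP.
have -> : psum (fun i => f i + g i) = psum f \+ psum g.
  by apply/funext => F; rewrite /psum big_split.
by apply: cvgD; apply: absum_cvg; eassumption.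
Qed.

Lemma tsumZ K (f : K -> R) C a : absum f C -> tsum (fun i => a * f i) = a * tsum f.
Proof.
move=> fC; apply: tsumP.
have -> : psum (fun i => a * f i) = (fun F => a * psum f F).
  by apply/funext => F; rewrite /psum mulr_sumr.
by apply: cvgMr; apply: absum_cvg; eassumption.
Qed.

Lemma absum_sum K T (r : seq T) (f : T -> K -> R) (C : T -> R) :
  (forall t, absum (f t) (C t)) ->
  absum (fun i => \sum_(t <- r) f t i) (\sum_(t <- r) C t).
Proof.
move=> fC F; apply: (@le_trans _ _ (\sum_(i <- F) \sum_(t <- r) `|f t i|)).
  by apply: ler_sum => i _; apply: ler_norm_sum.
by rewrite exchange_big /=; apply: ler_sum => t _; exact: fC.
Qed.

Lemma tsum_sum K T (r : seq T) (f : T -> K -> R) (C : T -> R) :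
  (forall t, absum (f t) (C t)) ->
  tsum (fun i => \sum_(t <- r) f t i) = \sum_(t <- r) tsum (f t).
Proof.
move=> fC; apply: tsumP.
have -> : psum (fun i => \sum_(t <- r) f t i) = (fun F => \sum_(t <- r) psum (f t) F).
  by apply/funext => F; rewrite /psum exchange_big.
elim: r => [|t r IH].
  under eq_fun do rewrite big_nil; rewrite big_nil; exact: cvg_cst.
under eq_fun do rewrite big_cons; rewrite big_cons.
by apply: cvgD => //; apply: absum_cvg; exact: fC.
Qed.

Lemma tsum_fset K (F : {fset K}) (f : K -> R) :
  tsum (fun i => if i \in F then f i else 0) = \sum_(i <- F) f i.
Proof.
apply: tsumP; apply: (psum_cst (F := F)) => G FG.
rewrite /psum (big_fsetID _ (mem F) G) /=.
have -> : [fset x in G | x \in F]%fset = F.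
  by apply/fsetP => x; rewrite !inE /= andbC; case: (boolP (x \in F)) => //= /(fsubsetP FG).
rewrite [X in _ + X]big1_fset ?addr0; last by move=> i; rewrite !inE => /andP[_ /negbTE ->].
by rewrite big_seq [RHS]big_seq; apply: eq_bigr => i ->.
Qed.

Lemma absum_restrict K (P : pred K) (f : K -> R) C : absum f C ->
  absum (fun i => if P i then f i else 0) C.
Proof. by apply: absum_le => i; case: ifP => // _; rewrite normr0. Qed.

(** This is what reduces the exchange of two infinite sums to that of a finite and an infinite
    one. *)
Lemma absum_tail K (f : K -> R) C e : absum f C -> 0 < e ->
  exists F : {fset K}, absum (fun i => if i \in F then 0 else f i) e.
Proof.
move=> fC e0.
have /cvgrPdist_le /(_ _ e0) [F _ hF] := absum_cvg (absum_norm fC).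
exists F => G.
have h := hF (F `|` G)%fset (fsubsetUl _ _).
have h2 : psum (fun i => `|f i|) (F `|` G)%fset <= tsum (fun i => `|f i|).
  have := tsum_absum_ge0 (fun i => normr_ge0 (f i)) (absum_norm fC).
  move=> /(_ (F `|` G)%fset); apply: le_trans.
  by apply: ler_sum => i _; rewrite normr_id.
have /cvgrPdist_le hc := absum_cvg (absum_norm fC).
have -> : \sum_(i <- G) `|if i \in F then 0 else f i| =
   psum (fun i => `|f i|) (F `|` G)%fset - psum (fun i => `|f i|) F.
  rewrite /psum (big_fsetID _ (mem F) (F `|` G)%fset) /=.
  have -> : [fset x in (F `|` G) | x \in F]%fset = F.
    by apply/fsetP => x; rewrite !inE /= andbC; case: (x \in F).
  rewrite addrAC subrr add0r (big_fsetID _ (mem F) G) /= big1_fset ?add0r.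
    have -> : [fset x in F `|` G | x \notin F]%fset = [fset x in G | x \notin F]%fset.
      by apply/fsetP => x; rewrite !inE /=; case: (x \in F); case: (x \in G).
    rewrite big_seq [RHS]big_seq; apply: eq_bigr => i.
    by rewrite !inE /= => /andP[_ /negbTE ->].
  by move=> i; rewrite !inE /= => /andP[_ ->] _; rewrite normr0.
have := hF F (fsubset_refl _); rewrite /= ler_norml => /andP[_]; lra.
Qed.

Section fubini.
Variables (K1 K2 : choiceType).
Implicit Types (f : K1 -> K2 -> R) (b : K1 -> R).

Lemma fubini_abs1 f b C j : (forall i, absum (f i) (b i)) -> absum b C ->
  absum (fun i => f i j) C.
Proof.
move=> fb; apply: absum_le => i; apply: le_trans (ler_norm _).
by have := fb i [fset j]%fset; rewrite big_seq_fset1.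
Qed.

Lemma fubini_absl f b C : (forall i, absum (f i) (b i)) -> absum b C ->
  absum (fun i => tsum (f i)) C.
Proof.
move=> fb; apply: absum_le => i; apply: le_trans (ler_norm _).
exact: absum_tsum.
Qed.

Lemma fubini_absr f b C : (forall i, absum (f i) (b i)) -> absum b C ->
  absum (fun j => tsum (fun i => f i j)) C.
Proof.
move=> fb bC G.
have a j : absum (fun i => `|f i j|) C by apply: absum_norm; exact: fubini_abs1 fb bC.
apply: (@le_trans _ _ (\sum_(j <- G) tsum (fun i => `|f i j|))).
  apply: ler_sum => j _; apply: absum_tsum => F.
  have := tsum_absum_ge0 (fun i => normr_ge0 (f i j)) (a j) F.
  by under eq_bigr do rewrite normr_id.
rewrite -(tsum_sum _ (fun j => a j)); apply: le_trans (ler_norm _) _.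
apply: absum_tsum; move: bC; apply: absum_le => i.
rewrite ger0_norm; last exact: sumr_ge0.
by apply: le_trans (ler_norm _); exact: fb.
Qed.

(** Over finitely many rows the two sums commute because finite sums commute with [tsum]; the
    other rows contribute at most [e / 2] on each side. *)
Theorem fubini f b C : (forall i, absum (f i) (b i)) -> absum b C ->
  tsum (fun i => tsum (f i)) = tsum (fun j => tsum (fun i => f i j)).
Proof.
move=> fb bC; apply/eqP; rewrite -subr_eq0 -normr_le0.
apply/ler_addgt0Pl => e e0; rewrite addr0.
have [F hF] := absum_tail bC (divr_gt0 e0 (ltr0n _ 2)).
pose f1 i j := if i \in F then f i j else 0.
pose f2 i j := if i \in F then 0 else f i j.
pose b2 i := if i \in F then 0 else b i.
have fb1 i : absum (f1 i) (b i).
  by move: (fb i); apply: absum_le => j; rewrite /f1; case: ifP; rewrite ?normr0.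
have fb2 i : absum (f2 i) (b2 i).
  by rewrite /f2 /b2; case: ifP => _ //; exact: absum0.
have E i j : f i j = f1 i j + f2 i j.
  by rewrite /f1 /f2; case: ifP; rewrite ?addr0 ?add0r.
have -> : (fun i => tsum (f i)) = (fun i => tsum (f1 i) + tsum (f2 i)).
  apply/funext => i; rewrite -(tsumD (fb1 i) (fb2 i)); congr tsum.
  by apply/funext => j; exact: E.
have -> : (fun j => tsum (fun i => f i j)) =
    (fun j => tsum (fun i => f1 i j) + tsum (fun i => f2 i j)).
  apply/funext => j; rewrite -(tsumD (fubini_abs1 j fb1 bC) (fubini_abs1 j fb2 hF)).
  by congr tsum; apply/funext => i; exact: E.
rewrite (tsumD (fubini_absl fb1 bC) (fubini_absl fb2 hF)).
rewrite (tsumD (fubini_absr fb1 bC) (fubini_absr fb2 hF)).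
have -> : tsum (fun i => tsum (f1 i)) = tsum (fun j => tsum (fun i => f1 i j)).
  have -> : (fun i => tsum (f1 i)) = (fun i => if i \in F then tsum (f i) else 0).
    apply/funext => i; rewrite /f1; case: ifP => // _; exact: tsum0.
  rewrite tsum_fset -(tsum_sum _ fb); congr tsum.
  by apply/funext => j; rewrite /f1 tsum_fset.
have := absum_tsum (fubini_absl fb2 hF); have := absum_tsum (fubini_absr fb2 hF).
rewrite !ler_norml => /andP[? ?] /andP[? ?]; apply/andP; split; lra.
Qed.

End fubini.

Section reindex.
Variables (K K' : choiceType) (u : K -> K') (f : K' -> R) (C : R).
Hypotheses (ui : injective u) (us : forall j, f j != 0 -> exists i, u i = j).

Let g i j : R := if j == u i then f j else 0.

Let gb i : absum (g i) `|f (u i)|.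
Proof.
have -> : `|f (u i)| = `|g i (u i)| by rewrite /g eqxx.
by apply: absum_single => j; rewrite /g => /negbTE ->.
Qed.

Let gs j : tsum (fun i => g i j) = f j.
Proof.
have [fj|/us [i0 ij]] := eqVneq (f j) 0.
  by rewrite fj -[RHS](@tsum0 K); congr tsum; apply/funext => i; rewrite /g fj if_same.
rewrite (@tsum_single _ i0) /g -ij ?eqxx // => i ii0.
by rewrite ifF //; apply/eqP => /ui /esym/eqP; rewrite (negbTE ii0).
Qed.

Lemma absum_reindex : absum (f \o u) C -> absum f C.
Proof.
move=> /absum_norm fC; have := fubini_absr gb fC.
by congr absum; apply/funext => j; rewrite gs.
Qed.

(** Fubini for the family supported by the graph of [u]. *)
Lemma tsum_reindex : absum (f \o u) C -> tsum f = tsum (f \o u).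
Proof.
move=> /absum_norm fC; have := fubini gb fC.
under [in X in _ = X -> _]eq_fun do rewrite gs.
move=> <-; congr tsum; apply/funext => i.
by rewrite (@tsum_single _ (u i)) /g ?eqxx // => j /negbTE ->.
Qed.

End reindex.

Lemma absum_inj K K' (u : K -> K') (f : K' -> R) C : injective u ->
  absum f C -> absum (f \o u) C.
Proof.
move=> ui fC F; apply: le_trans (fC (u @` F)%fset).
by rewrite big_imfset //= => x y _ _; exact: ui.
Qed.

(** Convergence along the finite sets bounds the sum over any finite set disjoint from a fixed
    one; applying the bound to the sets of positive and of negative terms bounds the sums of
    absolute values. *)
Lemma cvg_absum K (f : K -> R) (l : R) : psum f @ totally --> l -> exists C, absum f C.
Proof.
move=> /cvgrPdist_le /(_ _ ltr01) [F _ hF].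
have bnd (G : {fset K}) : [disjoint G & F]%fset -> `|\sum_(i <- G) f i| <= 2.
  move=> GF.
  have h1 := hF (F `|` G)%fset (fsubsetUl _ _).
  have h2 := hF F (fsubset_refl _).
  have E : psum f (F `|` G)%fset = psum f F + \sum_(i <- G) f i.
    rewrite /psum (big_fsetID _ (mem F) (F `|` G)%fset) /=; congr (_ + _).
      congr (\sum_(i <- enum_fset _) _); apply/fsetP => x.
      by rewrite !inE /= andbC; case: (x \in F).
    congr (\sum_(i <- enum_fset _) _); apply/fsetP => x; rewrite !inE /=.
    case: (boolP (x \in F)) => xF; rewrite ?andbF ?andbT //=.
    by apply/esym/negP => xG; move/fdisjointP: GF => /(_ x xG); rewrite xF.
  move: h1 h2; rewrite /= E !ler_norml => /andP[? ?] /andP[? ?].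
  apply/andP; split; lra.
exists (\sum_(i <- F) `|f i| + 4) => G.
rewrite (big_fsetID _ (mem F) G) /=; apply: lerD.
  have := @psum_sub _ (fun j => `|f j|) [fset x in G | x \in F]%fset F.
  by apply=> //; apply/fsubsetP => j; rewrite !inE /= => /andP[].
set H := [fset x in G | x \notin F]%fset.
rewrite (big_fsetID _ (fun i => 0 <= f i) H) /=.
set H1 := [fset x in H | _]%fset; set H2 := [fset x in H | _]%fset.
have d1 : [disjoint H1 & F]%fset.
  by apply/fdisjointP => x; rewrite !inE /= => /andP[/andP[]].
have d2 : [disjoint H2 & F]%fset.
  by apply/fdisjointP => x; rewrite !inE /= => /andP[/andP[]].
have -> : \sum_(i <- H1) `|f i| = \sum_(i <- H1) f i.
  rewrite big_seq_cond [RHS]big_seq_cond; apply: eq_bigr => i.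
  by rewrite !inE /= andbT => /andP[_]; exact: ger0_norm.
have -> : \sum_(i <- H2) `|f i| = - \sum_(i <- H2) f i.
  rewrite -sumrN big_seq_cond [RHS]big_seq_cond; apply: eq_bigr => i.
  by rewrite !inE /= andbT -ltNge => /andP[_]; exact: ltr0_norm.
have := bnd _ d1; have := bnd _ d2.
rewrite !ler_norml => /andP[? ?] /andP[? ?]; lra.
Qed.

End sums.

(** * Absolutely convergent power series *)

Section multi_index.
Variable I : finType.
Definition mindex := {ffun I -> nat}.
Implicit Types a b g : mindex.

(** [m0] and [m1 i] are the exponents of the monomials 1 and x_i; [madd], [msub], [mle] and
    [mdeg] stand for the product, exact quotient, divisibility and degree of monomials. *)
Definition m0 : mindex := [ffun=> 0%N].
Definition m1 i : mindex := [ffun j => nat_of_bool (j == i)].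
Definition madd a b : mindex := [ffun i => (a i + b i)%N].
Definition msub a b : mindex := [ffun i => (a i - b i)%N].
Definition mle a b := [forall i, (a i <= b i)%N].
Definition mdeg a := (\sum_i a i)%N.

Lemma mleP a b : reflect (forall i, (a i <= b i)%N) (mle a b).
Proof. exact: forallP. Qed.

Lemma maddC a b : madd a b = madd b a.
Proof. by apply/ffunP => i; rewrite !ffunE addnC. Qed.

Lemma maddA a b g : madd a (madd b g) = madd (madd a b) g.
Proof. by apply/ffunP => i; rewrite !ffunE addnA. Qed.

Lemma madd0 a : madd m0 a = a.
Proof. by apply/ffunP => i; rewrite !ffunE. Qed.

Lemma maddK a b : msub (madd a b) a = b.
Proof. by apply/ffunP => i; rewrite !ffunE addKn. Qed.

Lemma msubK a b : mle a b -> madd a (msub b a) = b.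
Proof. by move=> /mleP h; apply/ffunP => i; rewrite !ffunE subnKC. Qed.

Lemma mle_addr a b : mle a (madd a b).
Proof. by apply/mleP => i; rewrite ffunE leq_addr. Qed.

Lemma madd_inj a : injective (madd a).
Proof. by move=> b g /(congr1 (msub^~ a)); rewrite !maddK. Qed.

Lemma mdegD a b : mdeg (madd a b) = (mdeg a + mdeg b)%N.
Proof. by rewrite /mdeg -big_split; apply: eq_bigr => i _; rewrite ffunE. Qed.

Lemma mdeg1 i : mdeg (m1 i) = 1%N.
Proof.
rewrite /mdeg (bigD1 i) //= ffunE eqxx big1 // => j ji.
by rewrite ffunE (negbTE ji).
Qed.

Lemma mdeg0 : mdeg m0 = 0%N.
Proof. by rewrite /mdeg big1 // => j _; rewrite ffunE. Qed.

Lemma mdeg_le a i : (a i <= mdeg a)%N.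
Proof. by rewrite /mdeg (bigD1 i) //= leq_addr. Qed.

Lemma m1_le i a : mle (m1 i) a = (0 < a i)%N.
Proof.
apply/mleP/idP => [/(_ i)|ai j]; rewrite ffunE ?eqxx //.
by case: eqP => // ->.
Qed.

Lemma mindex_ind (P : mindex -> Prop) : P m0 -> (forall i b, P b -> P (madd (m1 i) b)) ->
  forall a, P a.
Proof.
move=> P0 PS a; move: {2}(mdeg a) (erefl (mdeg a)) => n.
elim: n a => [|n IH] a an.
  suff -> : a = m0 by [].
  apply/ffunP => i; rewrite ffunE; have := mdeg_le a i; rewrite an; lia.
have [i ai] : exists i, (0 < a i)%N.
  apply/existsP; apply: contra_eqT an => /existsPn h.
  by rewrite /mdeg big1 // => i _; have := h i; lia.
rewrite -m1_le in ai; rewrite -(msubK ai); apply: PS; apply: IH.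
by have := mdegD (m1 i) (msub a (m1 i)); rewrite msubK // an mdeg1; lia.
Qed.

End multi_index.

Section power_series.
Variable R : realType.

Section basic.
Variable I : finType.
Local Notation mindex := (mindex I).
Implicit Types (a b g : mindex) (c d : mindex -> R) (x y rho : I -> R) (C D : R).

Definition mon x a : R := \prod_i x i ^+ a i.
Definition inball rho x := forall i, `|x i| <= rho i.
(** The weighted l^1 norm of the series with coefficients [c] is at most [C]. The norm is
    submultiplicative ([nb_mul]), and a series of finite norm converges absolutely on the closed
    polydisc of polyradius [rho]. *)
Definition nb rho c C := absum (fun a => c a * mon rho a) C.
Definition ev c x : R := tsum (fun a => c a * mon x a).

Lemma monD x a b : mon x (madd a b) = mon x a * mon x b.
Proof. by rewrite /mon -big_split; apply: eq_bigr => i _; rewrite ffunE exprD. Qed.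

Lemma mon0 x : mon x (m0 I) = 1.
Proof. by rewrite /mon big1 // => i _; rewrite ffunE. Qed.

Lemma mon1 x i : mon x (m1 i) = x i.
Proof.
rewrite /mon (bigD1 i) //= ffunE eqxx big1 ?mulr1 // => j ji.
by rewrite ffunE (negbTE ji).
Qed.

Lemma mon_ge0 x a : (forall i, 0 <= x i) -> 0 <= mon x a.
Proof. by move=> h; apply: prodr_ge0 => i _; apply: exprn_ge0. Qed.

Lemma mon_gt0 x a : (forall i, 0 < x i) -> 0 < mon x a.
Proof. by move=> h; apply: prodr_gt0 => i _; apply: exprn_gt0. Qed.

Lemma mon_norm x a : `|mon x a| = mon (fun i => `|x i|) a.
Proof. by rewrite /mon normr_prod; apply: eq_bigr => i _; rewrite normrX. Qed.

Lemma inball_ge0 rho x i : inball rho x -> 0 <= rho i.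
Proof. by move=> /(_ i); apply: le_trans. Qed.

Lemma mon_le rho x a : inball rho x -> `|mon x a| <= mon rho a.
Proof.
move=> h; rewrite mon_norm; apply: ler_prod => i _.
by rewrite exprn_ge0 //= lerXn2r // nnegrE (inball_ge0 _ h).
Qed.

Lemma monZ t x a : mon (fun i => t * x i) a = t ^+ mdeg a * mon x a.
Proof.
rewrite /mon /mdeg; under eq_bigr do rewrite exprMn.
rewrite big_split /=; congr (_ * _).
by rewrite -(big_morph _ (exprD t) (expr0 t)).
Qed.

Lemma nb_ball rho rho' c C : inball rho rho' -> nb rho c C -> nb rho' c C.
Proof.
move=> h; apply: absum_le => a; rewrite !normrM ler_wpM2l //.
by apply: le_trans (mon_le a h) (ler_norm _).
Qed.

Lemma ev_abs rho c C x : nb rho c C -> inball rho x ->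
  absum (fun a => c a * mon x a) C.
Proof. by move=> hc hx; exact: nb_ball hc. Qed.

Lemma ev_le rho c C x : nb rho c C -> inball rho x -> `|ev c x| <= C.
Proof. by move=> hc hx; apply: absum_tsum; exact: ev_abs hc hx. Qed.

Lemma nbD rho c d C D : nb rho c C -> nb rho d D ->
  nb rho (fun a => c a + d a) (C + D).
Proof.
move=> hc hd; have := absumD hc hd; congr absum.
by apply/funext => a; rewrite mulrDl.
Qed.

Lemma nbZ rho c C k : nb rho c C -> nb rho (fun a => k * c a) (`|k| * C).
Proof. by move=> /(absumZ k); congr absum; apply/funext => a; rewrite mulrA. Qed.

Lemma nb_sum rho T (r : seq T) (c : T -> mindex -> R) (C : T -> R) :
  (forall t, nb rho (c t) (C t)) ->
  nb rho (fun a => \sum_(t <- r) c t a) (\sum_(t <- r) C t).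
Proof.
move=> /(absum_sum r); congr absum.
by apply/funext => a; rewrite mulr_suml.
Qed.

Lemma evD rho c d C D x : nb rho c C -> nb rho d D -> inball rho x ->
  ev (fun a => c a + d a) x = ev c x + ev d x.
Proof.
move=> hc hd hx; rewrite /ev -(tsumD (ev_abs hc hx) (ev_abs hd hx)).
by congr tsum; apply/funext => a; rewrite mulrDl.
Qed.

Lemma evZ rho c C x k : nb rho c C -> inball rho x ->
  ev (fun a => k * c a) x = k * ev c x.
Proof.
move=> hc hx; rewrite /ev -(tsumZ k (ev_abs hc hx)).
by congr tsum; apply/funext => a; rewrite mulrA.
Qed.

Definition cdelta b : mindex -> R := fun a => (a == b)%:R.

Lemma nb_delta rho b : nb rho (cdelta b) `|mon rho b|.
Proof.
have -> : `|mon rho b| = `|cdelta b b * mon rho b| by rewrite /cdelta eqxx mul1r.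
by apply: absum_single => a /negbTE ab; rewrite /cdelta ab mul0r.
Qed.

Lemma ev_delta b x : ev (cdelta b) x = mon x b.
Proof.
rewrite /ev (@tsum_single _ _ b) /cdelta ?eqxx ?mul1r // => a /negbTE ->.
by rewrite mul0r.
Qed.

Lemma ev0 c : ev c (fun=> 0) = c (m0 I).
Proof.
rewrite /ev (@tsum_single _ _ (m0 I)) ?mon0 ?mulr1 // => a a0.
suff -> : mon (fun=> 0 : R) a = 0 by rewrite mulr0.
have [i ai] : exists i, (0 < a i)%N.
  apply/existsP; apply: contra_neqT a0 => /existsPn h.
  by apply/ffunP => i; rewrite ffunE; have := h i; lia.
by rewrite /mon (bigD1 i) //= expr0n -[a i == _]negbK -lt0n ai mul0r.
Qed.

(** Shrinking the polydisc by the factor [t] gains a factor [t] for each order of vanishing. *)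
Lemma nb_scale rho c C t k : 0 <= t <= 1 -> nb rho c C ->
  (forall a, (mdeg a < k)%N -> c a = 0) -> nb (fun i => t * rho i) c (t ^+ k * C).
Proof.
move=> /andP[t0 t1] hc c0 F.
apply: (@le_trans _ _ (\sum_(a <- F) t ^+ k * `|c a * mon rho a|)); last first.
  by rewrite -mulr_sumr ler_wpM2l // exprn_ge0.
apply: ler_sum => a _; rewrite monZ.
have [/c0 ->|ka] := ltnP (mdeg a) k; first by rewrite !mul0r normr0 mulr0.
rewrite mulrCA normrM ler_wpM2r // ger0_norm ?exprn_ge0 //.
exact: ler_wiXn2l.
Qed.

(** The Cauchy product of power series. *)
Definition cmul c d g : R := tsum (fun b => if mle b g then c b * d (msub g b) else 0).

Section product.
Variables (rho : I -> R) (c d : mindex -> R) (C D : R).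
Hypotheses (rho0 : forall i, 0 < rho i) (hc : nb rho c C) (hd : nb rho d D).

Let f x b g : R := if mle b g then (c b * mon x b) * (d (msub g b) * mon x (msub g b)) else 0.

Let f_abs x b : inball rho x -> absum (f x b) (`|c b * mon rho b| * D).
Proof.
move=> hx; apply: (@absum_reindex _ _ _ (madd b) _ _ (@madd_inj _ b)).
  move=> g; rewrite /f; case: ifP => [/msubK h _|_]; last by rewrite eqxx.
  by exists (msub g b).
move=> F; apply: le_trans (absumZ (c b * mon rho b) hd F).
apply: ler_sum => a _; rewrite /f /= mle_addr maddK !normrM.
apply: ler_pM => //; rewrite ?mulr_ge0 // ler_wpM2l //.
  exact: le_trans (mon_le _ hx) (ler_norm _).
exact: le_trans (mon_le _ hx) (ler_norm _).
Qed.

Let bnd_abs : absum (fun b => `|c b * mon rho b| * D) (C * D).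
Proof.
move=> F; under eq_bigr do rewrite mulrC.
have := absumZ D (absum_norm hc) F.
by rewrite [X in _ <= X]mulrC (@ger0_norm _ D) ?(absum_ge0 hd).
Qed.

Let fE x b g : f x b g = (if mle b g then c b * d (msub g b) else 0) * mon x g.
Proof.
rewrite /f; case: ifP => [/msubK h|]; last by rewrite mul0r.
have -> : mon x g = mon x b * mon x (msub g b) by rewrite -monD h.
by ring.
Qed.

Lemma cmul_abs g : absum (fun b => if mle b g then c b * d (msub g b) else 0)
  ((mon rho g)^-1 * (C * D)).
Proof.
have hr : inball rho rho by move=> i; rewrite ger0_norm // ltW.
have p := mon_gt0 g rho0.
have := absumZ (mon rho g)^-1 (fubini_abs1 g (fun b => f_abs b hr) bnd_abs).
rewrite ger0_norm ?invr_ge0 ?ltW //; congr absum; apply/funext => b.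
by rewrite fE mulrCA mulVf ?mulr1 // gt_eqF.
Qed.

Let cmulE x g : cmul c d g * mon x g = tsum (fun b => f x b g).
Proof.
rewrite mulrC -(tsumZ _ (@cmul_abs g)); congr tsum.
by apply/funext => b; rewrite fE mulrC.
Qed.

(** For a fixed [b] the terms indexed by the multiples of [b] sum to a translate of the second
    series, so that Fubini applies to the double family. *)
Lemma nb_mul : nb rho (cmul c d) (C * D).
Proof.
have hr : inball rho rho by move=> i; rewrite ger0_norm // ltW.
have := fubini_absr (fun b => f_abs b hr) bnd_abs.
by congr absum; apply/funext => g; rewrite cmulE.
Qed.

Lemma ev_mul x : inball rho x -> ev (cmul c d) x = ev c x * ev d x.
Proof.
move=> hx; rewrite /ev; under eq_fun do rewrite cmulE.
rewrite -(fubini (fun b => f_abs b hx) bnd_abs).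
rewrite mulrC -(tsumZ _ (ev_abs hc hx)); congr tsum; apply/funext => b.
rewrite (@tsum_reindex _ _ _ (madd b) _ (`|c b * mon rho b| * D) (@madd_inj _ b)).
- rewrite mulrC -(tsumZ _ (ev_abs hd hx)); congr tsum; apply/funext => a.
  by rewrite /f /= mle_addr maddK.
- move=> g; rewrite /f; case: ifP => [/msubK h _|_]; last by rewrite eqxx.
  by exists (msub g b).
by apply: absum_inj; [exact: madd_inj|exact: f_abs].
Qed.

End product.

(** Coefficients of the partial derivative in the variable [i]; [dmon i] is the derivative of
    monomials. *)
Definition cder i c a : R := (a i).+1%:R * c (madd (m1 i) a).
Definition dmon i x a : R := (a i)%:R * mon x (msub a (m1 i)).

Lemma ltn_exp2 n : (n < 2 ^ n)%N.
Proof. exact: ltn_expl. Qed.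

(** Halving the polyradius produces a factor [2 ^- mdeg a] that absorbs the factor [a i + 1] of
    the derivative. *)
Lemma nb_der rho i c C : (forall i, 0 < rho i) -> nb rho c C ->
  nb (fun j => 2^-1 * rho j) (cder i c) ((rho i)^-1 * C).
Proof.
move=> r0 hc F.
have := absumZ (rho i)^-1 (absum_inj (@madd_inj _ (m1 i)) hc) F.
rewrite ger0_norm; last by rewrite invr_ge0 ltW.
apply: le_trans.
apply: ler_sum => a _; rewrite /= /cder monZ monD mon1.
rewrite (mulrCA (c _)) mulKf ?gt_eqF // mulrACA normrM -[leRHS]mul1r.
rewrite ler_wpM2r // ger0_norm; last by rewrite mulr_ge0 // exprn_ge0 // invr_ge0.
rewrite exprVn ler_pdivrMr ?exprn_gt0 // mul1r -natrX ler_nat.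
apply: leq_trans (ltn_exp2 (a i)) _; rewrite leq_exp2l //; exact: mdeg_le.
Qed.

Lemma dmonD j x i b :
  dmon j x (madd (m1 i) b) = x i * dmon j x b + (j == i)%:R * mon x b.
Proof.
rewrite /dmon; have [->|ji] := eqVneq j i.
  rewrite maddK !ffunE eqxx mul1r add1n.
  have [b0|b0] := posnP (b i); first by rewrite b0 mul0r mulr0 add0r mul1r.
  rewrite -m1_le in b0.
  have -> : mon x b = x i * mon x (msub b (m1 i)) by rewrite -mon1 -monD msubK.
  by rewrite -natr1; ring.
rewrite !ffunE (negbTE ji) add0n mul0r addr0.
have [b0|b0] := posnP (b j); first by rewrite b0 !mul0r mulr0.
rewrite -m1_le in b0.
have -> : madd (m1 i) b = madd (m1 j) (madd (m1 i) (msub b (m1 j))).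
  by rewrite maddA [madd (m1 j) _]maddC -maddA msubK.
by rewrite maddK monD mon1; ring.
Qed.

Lemma ev_der rho i c C x : (forall i, 0 < rho i) -> nb rho c C ->
  inball (fun j => 2^-1 * rho j) x ->
  ev (cder i c) x = tsum (fun a => c a * dmon i x a)
  /\ exists E, absum (fun a => c a * dmon i x a) E.
Proof.
move=> r0 hc hx.
have E1 : (fun a => cder i c a * mon x a) = (fun a => c a * dmon i x a) \o madd (m1 i).
  apply/funext => a /=; rewrite /cder /dmon maddK ffunE ffunE eqxx add1n; ring.
have us a : c a * dmon i x a != 0 -> exists b, madd (m1 i) b = a.
  move=> h; have : (0 < a i)%N.
    rewrite lt0n; apply: contra h => /eqP h; by rewrite /dmon h mul0r mulr0.
  by rewrite -m1_le => /msubK h'; exists (msub a (m1 i)).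
have h := ev_abs (nb_der i r0 hc) hx; rewrite E1 in h.
split; first by rewrite /ev E1 -(tsum_reindex (@madd_inj _ (m1 i)) us h).
by exists ((rho i)^-1 * C); apply: absum_reindex us h; exact: madd_inj.
Qed.

Section taylor.
Variables (r x y : I -> R) (e Q : R).
Hypotheses (hx : inball r x) (hy : inball r y) (he : forall i, `|y i - x i| <= e).
Hypotheses (r0 : forall i, 0 < r i) (hQ : forall i, (r i)^-1 <= Q) (e0 : 0 <= e) (Q0 : 0 <= Q).

Let eQ i b : e * mon r b <= e * Q * mon r (madd (m1 i) b).
Proof.
rewrite monD mon1 -!mulrA ler_wpM2l // mulrA ler_peMl ?mon_ge0 //.
  by move=> j; exact: ltW.
by rewrite -ler_pdivrMr // mul1r.
Qed.

Lemma mon_lip a : `|mon y a - mon x a| <= (mdeg a)%:R * (e * Q * mon r a).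
Proof.
elim/mindex_ind: a => [|i b IH]; first by rewrite !mon0 subrr normr0 mdeg0 mul0r.
rewrite mdegD mdeg1 add1n -natr1 mulrDl mul1r !(monD _ (m1 i)) !mon1.
have -> : y i * mon y b - x i * mon x b = y i * (mon y b - mon x b) + (y i - x i) * mon x b.
  by ring.
apply: le_trans (ler_normD _ _) _; rewrite !normrM; apply: lerD.
  rewrite [X in _ <= X](_ : _ = r i * ((mdeg b)%:R * (e * Q * mon r b))); last by ring.
  exact: ler_pM.
apply: (@le_trans _ _ (e * mon r b)); last by have := eQ i b; rewrite monD mon1.
by apply: ler_pM => //; exact: mon_le.
Qed.

(** The loss is only polynomial in the degree, so that it can be summed against a geometric
    gain. *)
Lemma mon_taylor a : `|mon y a - mon x a - \sum_i dmon i x a * (y i - x i)|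
  <= (mdeg a)%:R ^+ 2 * ((e * Q) ^+ 2 * mon r a).
Proof.
elim/mindex_ind: a => [|i b IH].
  rewrite !mon0 subrr mdeg0 expr0n mul0r big1 ?subr0 ?normr0 // => j _.
  by rewrite /dmon ffunE !mul0r.
have -> : \sum_j dmon j x (madd (m1 i) b) * (y j - x j) =
   x i * (\sum_j dmon j x b * (y j - x j)) + mon x b * (y i - x i).
  under eq_bigr do rewrite dmonD mulrDl.
  rewrite big_split /= mulr_sumr; congr (_ + _).
    by apply: eq_bigr => j _; rewrite mulrA.
  rewrite (bigD1 i) //= eqxx mul1r big1 ?addr0 // => j /negbTE ->.
  by rewrite !mul0r.
rewrite mdegD mdeg1 add1n -natr1 !(monD _ (m1 i)) !mon1.
set S := \sum_j _ in IH *; set n := (mdeg b)%:R.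
have -> : y i * mon y b - x i * mon x b - (x i * S + mon x b * (y i - x i)) =
  x i * (mon y b - mon x b - S) + (y i - x i) * (mon y b - mon x b) by ring.
have P0 : 0 <= (e * Q) ^+ 2 * (r i * mon r b).
  by rewrite mulr_ge0 ?sqr_ge0 // mulr_ge0 ?mon_ge0 ?ltW // => j; exact: ltW.
have n0 : 0 <= n by rewrite /n.
apply: (@le_trans _ _ (n ^+ 2 * ((e * Q) ^+ 2 * (r i * mon r b)) +
   n * ((e * Q) ^+ 2 * (r i * mon r b)))); last first.
  rewrite -mulrDl ler_wpM2r //; nra.
apply: le_trans (ler_normD _ _) _; rewrite !normrM; apply: lerD.
  rewrite [X in _ <= X](_ : _ = r i * (n ^+ 2 * ((e * Q) ^+ 2 * mon r b))); last by ring.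
  exact: ler_pM.
apply: (@le_trans _ _ (e * (n * (e * Q * mon r b)))).
  apply: ler_pM => //; exact: mon_lip.
rewrite [X in X <= _](_ : _ = (n * e * Q) * (e * mon r b)); last by ring.
rewrite [X in _ <= X](_ : _ = (n * e * Q) * (e * Q * (r i * mon r b))); last by ring.
by rewrite ler_wpM2l ?mulr_ge0 //; have := eQ i b; rewrite monD mon1.
Qed.

End taylor.

End basic.
End power_series.

(** * Analytic germs *)

Section analytic.
Variable R : realType.

Lemma natr_sqr_le4 n : (n%:R ^+ 2 : R) <= 4 ^+ n.
Proof.
rewrite -!natrX ler_nat (_ : 4 = 2 ^ 2)%N // -expnM mulnC expnM leq_exp2r //.
exact/ltnW/ltn_expl.
Qed.

Section taylor.
Variable I : finType.
Implicit Types (x y rho : I -> R) (c d : mindex I -> R).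

(** Dividing the polyradius by 4 produces a factor [4 ^- mdeg a], which beats the square of the
    degree in [mon_taylor]. *)
Lemma ev_taylor rho c C : (forall i, 0 < rho i) -> nb rho c C ->
  exists2 M, 0 <= M & forall x y (e : R), 0 <= e ->
   inball (fun i => 4^-1 * rho i) x -> inball (fun i => 4^-1 * rho i) y ->
   (forall i, `|y i - x i| <= e) ->
   `|ev c y - ev c x - \sum_i ev (cder i c) x * (y i - x i)| <= M * e ^+ 2
   /\ `|ev c y - ev c x| <= M * e.
Proof.
move=> r0 hc; set r := fun i => 4^-1 * rho i.
have r0' i : 0 < r i by rewrite mulr_gt0.
have sub4 : inball rho r by move=> i; rewrite /r gtr0_norm //; have := r0 i; lra.
pose Q := \sum_i (r i)^-1.
have hQ i : (r i)^-1 <= Q.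
  by rewrite /Q (bigD1 i) //= lerDl sumr_ge0 // => j _; rewrite invr_ge0 ltW.
have Q0 : 0 <= Q by apply: sumr_ge0 => i _; rewrite invr_ge0 ltW.
have C0 : 0 <= C := absum_ge0 hc.
exists (C * Q ^+ 2 + C * Q); first by rewrite addr_ge0 // mulr_ge0 // sqr_ge0.
move=> x y e e0 hx hy he.
have sub x' : inball r x' -> inball rho x'.
  by move=> h i; apply: le_trans (h i) _; have := sub4 i; rewrite gtr0_norm.
have sub2 : inball (fun i => 2^-1 * rho i) x.
  by move=> i; apply: le_trans (hx i) _; rewrite /r; have := r0 i; lra.
have ay := ev_abs hc (sub _ hy); have ax := ev_abs hc (sub _ hx).
have axn := absumZ (-1) ax.
have rhoE a : mon rho a = 4 ^+ mdeg a * mon r a.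
  rewrite -monZ; congr mon; apply/funext => i; rewrite /r mulrA mulfV ?mul1r //.
have rg a : 0 <= mon r a by apply: mon_ge0 => i; exact: ltW.
have Cabs k : 0 <= k -> absum (fun a => k * `|c a * mon rho a|) (k * C).
  by move=> k0 F; have := absumZ k (absum_norm hc) F; rewrite (@ger0_norm _ k).
have E1 : ev c y - ev c x = tsum (fun a => c a * mon y a + -1 * (c a * mon x a)).
  by rewrite (tsumD ay axn) (tsumZ _ ax) mulN1r.
split; last first.
  rewrite E1; apply: (@le_trans _ _ (e * Q * C)); last first.
    have := mulr_ge0 (mulr_ge0 C0 (sqr_ge0 Q)) e0; nra.
  apply: absum_tsum.
  apply: absum_le (Cabs _ (mulr_ge0 e0 Q0)) => a.
  rewrite mulN1r -mulrBr normrM [leRHS]ger0_norm; last by rewrite mulr_ge0 // mulr_ge0.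
  rewrite normrM rhoE mulrCA ler_wpM2l //.
  apply: le_trans (mon_lip hx hy he r0' hQ e0 a) _.
  rewrite ger0_norm; last by rewrite mulr_ge0 // exprn_ge0.
  rewrite [leRHS]mulrCA ler_wpM2r ?mulr_ge0 //.
  by rewrite -natrX ler_nat; exact/ltnW/ltn_expl.
have hd i := ev_der i r0 hc sub2.
have /boolp.choice [E hE] : forall i, exists E, absum (fun a => c a * dmon i x a) E.
  by move=> i; case: (hd i).
have hdn := fun i => absumZ (- (y i - x i)) (hE i).
have E2 : - (\sum_i ev (cder i c) x * (y i - x i)) =
    tsum (fun a => \sum_i - (y i - x i) * (c a * dmon i x a)).
  rewrite (tsum_sum _ hdn) -sumrN; apply: eq_bigr => i _.
  by rewrite (tsumZ _ (hE i)) (hd i).1 mulNr mulrC.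
rewrite E1 E2 -(tsumD (absumD ay axn) (absum_sum _ hdn)).
apply: (@le_trans _ _ ((e * Q) ^+ 2 * C)); last first.
  have := mulr_ge0 (mulr_ge0 C0 Q0) (sqr_ge0 e); rewrite exprMn; nra.
apply: absum_tsum; apply: absum_le (Cabs _ (sqr_ge0 (e * Q))) => a.
have -> : c a * mon y a + -1 * (c a * mon x a) + \sum_i - (y i - x i) * (c a * dmon i x a)
   = c a * (mon y a - mon x a - \sum_i dmon i x a * (y i - x i)).
  have -> : \sum_i - (y i - x i) * (c a * dmon i x a) =
      - (c a * (\sum_i dmon i x a * (y i - x i))).
    by rewrite mulr_sumr -sumrN; apply: eq_bigr => i _; ring.
  by ring.
rewrite normrM [leRHS]ger0_norm; last by rewrite mulr_ge0 // sqr_ge0.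
rewrite normrM rhoE mulrCA ler_wpM2l //.
apply: le_trans (mon_taylor hx hy he r0' hQ e0 Q0 a) _.
rewrite ger0_norm; last by rewrite mulr_ge0 // exprn_ge0.
rewrite [leRHS]mulrCA ler_wpM2r ?mulr_ge0 ?sqr_ge0 //.
exact: natr_sqr_le4.
Qed.

End taylor.

Section An.
Variable I : finType.
Implicit Types (x y rho : I -> R) (c d : mindex I -> R) (f g : (I -> R) -> R).

Definition An rho C f : Prop :=
  exists2 c, nb rho c C & forall x, inball rho x -> f x = ev c x.

Lemma An_ev rho c C : nb rho c C -> An rho C (ev c).
Proof. by exists c. Qed.

Lemma An_ext rho C f g : (forall x, inball rho x -> f x = g x) -> An rho C f -> An rho C g.
Proof. by move=> fg [c hc h]; exists c => // x hx; rewrite -fg // h. Qed.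

Lemma An_cst rho k : An rho `|k| (fun=> k).
Proof.
exists (fun a => k * cdelta R (m0 I) a).
  by have := nbZ k (nb_delta rho (m0 I)); rewrite mon0 normr1 mulr1.
move=> x hx; rewrite (evZ k (nb_delta rho _) hx).
by rewrite ev_delta mon0 mulr1.
Qed.

Lemma An_var rho i : An rho `|rho i| (fun x => x i).
Proof.
exists (cdelta R (m1 i)); first by have := nb_delta rho (m1 i); rewrite mon1.
by move=> x hx; rewrite ev_delta mon1.
Qed.

Lemma An_D rho C D f g : An rho C f -> An rho D g -> An rho (C + D) (fun x => f x + g x).
Proof.
move=> [c hc h] [d hd h']; exists (fun a => c a + d a); first exact: nbD.
by move=> x hx; rewrite (evD hc hd) // h // h'.
Qed.

Lemma An_Z rho C f k : An rho C f -> An rho (`|k| * C) (fun x => k * f x).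
Proof.
move=> [c hc h]; exists (fun a => k * c a); first exact: nbZ.
by move=> x hx; rewrite (evZ k hc) // h.
Qed.

Lemma An_M rho C D f g : (forall i, 0 < rho i) ->
  An rho C f -> An rho D g -> An rho (C * D) (fun x => f x * g x).
Proof.
move=> r0 [c hc h] [d hd h']; exists (cmul c d); first exact: nb_mul.
by move=> x hx; rewrite (ev_mul r0 hc hd) // h // h'.
Qed.

Lemma An_X rho C f n : (forall i, 0 < rho i) ->
  An rho C f -> An rho (C ^+ n) (fun x => f x ^+ n).
Proof.
move=> r0 fC; elim: n => [|n IH].
  by rewrite expr0 -(normr1 R); exact: An_cst.
rewrite exprS; have := An_M r0 fC IH.
by apply: An_ext => x _; rewrite exprS.
Qed.

Lemma An_prod rho T (s : seq T) (C : T -> R) (f : T -> (I -> R) -> R) :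
  (forall i, 0 < rho i) ->
  (forall t, An rho (C t) (f t)) ->
  An rho (\prod_(t <- s) C t) (fun x => \prod_(t <- s) f t x).
Proof.
move=> r0 fC; elim: s => [|t s IH].
  rewrite big_nil; have := An_cst rho (1 : R); rewrite normr1.
  by apply: An_ext => x _; rewrite big_nil.
rewrite big_cons; have := An_M r0 (fC t) IH.
by apply: An_ext => x _; rewrite big_cons.
Qed.

Lemma An_ball rho rho' C f : inball rho rho' -> An rho C f -> An rho' C f.
Proof.
move=> h [c hc hf]; exists c; first exact: nb_ball hc.
move=> x hx; apply: hf => i; apply: le_trans (hx i) _.
by apply: le_trans (h i); exact: ler_norm.
Qed.

End An.

Section composition.
Variables (A B : finType).

(** Expand the image of each monomial as a series and exchange the two sums. By
    submultiplicativity the image of [c_a x^a] has norm at most [|c_a| r^a]. *)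
Lemma An_comp (rho : B -> R) (psi : (B -> R) -> A -> R) (r : A -> R) c C :
  (forall i, 0 < rho i) -> (forall a, An rho (r a) (fun x => psi x a)) ->
  nb r c C -> An rho C (fun x => ev c (psi x)).
Proof.
move=> r0 hpsi hc.
have rr : inball rho rho by move=> i; rewrite gtr0_norm.
have : forall al : mindex A, exists G, nb rho G `|c al * mon r al| /\
    forall x, inball rho x -> c al * mon (psi x) al = ev G x.
  move=> al.
  have [G hG hG'] : An rho (`|c al| * mon r al) (fun x => c al * mon (psi x) al).
    apply: An_Z; apply: (@An_prod _ _ _ _ _ (fun a x => psi x a ^+ al a)) => // a.
    exact: An_X.
  exists G; split=> //; apply: absum_leC hG.
  by rewrite normrM ler_wpM2l // ler_norm.
move=> /boolp.choice [G hG].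
have b x : inball rho x -> forall al, absum (fun g => G al g * mon x g) `|c al * mon r al|.
  by move=> hx al; apply: ev_abs hx; case: (hG al).
have hc' := absum_norm hc.
have E x g : inball rho x ->
    tsum (fun al => G al g) * mon x g = tsum (fun al => G al g * mon x g).
  move=> hx.
  have [D hD] : exists D, absum (fun al => G al g) D.
    exists ((mon rho g)^-1 * C) => F.
    have := absumZ (mon rho g)^-1 (fubini_abs1 g (b _ rr) hc') F.
    have p := mon_gt0 g r0.
    rewrite ger0_norm; last by rewrite invr_ge0 ltW.
    apply: le_trans; apply: ler_sum => al _.
    by rewrite mulrCA mulVf ?mulr1 // gt_eqF.
  rewrite mulrC -(tsumZ _ hD); congr tsum; apply/funext => al; exact: mulrC.
exists (fun g => tsum (fun al => G al g)).
  have := fubini_absr (b _ rr) hc'; congr absum.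
  by apply/funext => g; rewrite E.
move=> x hx; rewrite {2}/ev.
have -> : (fun g => tsum (G^~ g) * mon x g) = (fun g => tsum (fun al => G al g * mon x g)).
  by apply/funext => g; exact: E.
rewrite -(fubini (b _ hx) hc'); congr tsum; apply/funext => al.
by case: (hG al) => _ ->.
Qed.

End composition.

Section germs.

(** Real-analytic germs at the origin of R^I. *)
Definition germ (I : finType) (f : (I -> R) -> R) : Prop :=
  exists (r C : R), 0 < r /\ An (fun=> r) C f.

Lemma inballW (I : finType) (r r' : R) (x : I -> R) : r <= r' ->
  inball (fun=> r) x -> inball (fun=> r') x.
Proof. by move=> rr h i; apply: le_trans rr. Qed.

Lemma An_shrink (I : finType) (r r' C : R) (f : (I -> R) -> R) : 0 <= r' -> r' <= r ->
  An (fun=> r) C f -> An (fun=> r') C f.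
Proof. by move=> r0 rr; apply: An_ball => i; rewrite ger0_norm. Qed.

Section ops.
Variable I : finType.
Implicit Types f g : (I -> R) -> R.

Lemma germ_cst k : germ (fun _ : I -> R => k).
Proof. by exists 1, `|k|; split => //; exact: An_cst. Qed.

Lemma germ_var i : germ (fun x : I -> R => x i).
Proof. by exists 1, `|1|; split => //; exact: An_var. Qed.

Lemma germ2 f g : germ f -> germ g ->
  exists r C D, [/\ 0 < r, An (fun=> r) C f & An (fun=> r) D g].
Proof.
move=> [r [C [r0 hf]]] [r' [D [r0' hg]]]; exists (Num.min r r'), C, D.
have m0 : 0 < Num.min r r' by rewrite lt_min r0.
by split => //; [apply: An_shrink hf|apply: An_shrink hg];
  rewrite ?(ltW m0) // ge_min lexx ?orbT.
Qed.

Lemma germD f g : germ f -> germ g -> germ (fun x => f x + g x).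
Proof.
move=> /germ2 h /h [r [C [D [r0 hf hg]]]].
by exists r, (C + D); split => //; exact: An_D.
Qed.

Lemma germM f g : germ f -> germ g -> germ (fun x => f x * g x).
Proof.
move=> /germ2 h /h [r [C [D [r0 hf hg]]]].
by exists r, (C * D); split => //; exact: An_M.
Qed.

Lemma germZ k f : germ f -> germ (fun x => k * f x).
Proof. by move=> hf; apply: germM => //; exact: germ_cst. Qed.

Lemma germ_sum T (s : seq T) (f : T -> (I -> R) -> R) : (forall t, germ (f t)) ->
  germ (fun x => \sum_(t <- s) f t x).
Proof.
move=> hf; elim: s => [|t s IH].
  by under eq_fun do rewrite big_nil; exact: germ_cst.
by under eq_fun do rewrite big_cons; exact: germD.
Qed.

Lemma germ_all (T : finType) (f : T -> (I -> R) -> R) : (forall t, germ (f t)) ->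
  exists r C, [/\ 0 < r & forall t, An (fun=> r) C (f t)].
Proof.
move=> hf.
suff [r [C [r0 h]]] : exists r C, 0 < r /\
    forall t, t \in enum T -> An (fun=> r) C (f t).
  by exists r, C; split=> // t; apply: h; rewrite mem_enum.
elim: (enum T) => [|t s [r [C [r0 IH]]]]; first by exists 1, 0.
have [r' [C' [r0' ht]]] := hf t.
have m0 : 0 < Num.min r r' by rewrite lt_min r0.
have wk D D' g : D <= D' -> An (fun=> Num.min r r') D g -> An (fun=> Num.min r r') D' g.
  by move=> DD [c hc hg]; exists c => //; exact: absum_leC hc.
exists (Num.min r r'), (Num.max C C'); split => // t'.
rewrite in_cons => /predU1P[->|/IH h].
  by apply: (wk C'); [rewrite le_max lexx orbT|apply: An_shrink ht; rewrite ?(ltW m0) // ge_min lexx orbT].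
by apply: (wk C); [rewrite le_max lexx|apply: An_shrink h; rewrite ?(ltW m0) // ge_min lexx].
Qed.

Lemma germ_ext f g r : 0 < r -> (forall x, inball (fun=> r) x -> f x = g x) ->
  germ f -> germ g.
Proof.
move=> r0 fg [r' [C [r0' hf]]]; exists (Num.min r r'), C.
have m0 : 0 < Num.min r r' by rewrite lt_min r0.
split => //; apply: (@An_ext _ _ _ f).
  by move=> x; move/(@inballW _ _ r) => h; apply/fg/h; rewrite ge_min lexx.
by apply: An_shrink hf; rewrite ?(ltW m0) // ge_min lexx orbT.
Qed.

End ops.

(** The components of [psi] vanish at the origin, so by [nb_scale] their norms on a small
    polydisc are below the radius of convergence of [f]. *)
Lemma germ_comp (A B : finType) (psi : (B -> R) -> A -> R) (f : (A -> R) -> R) :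
  germ f -> (forall a, germ (fun x => psi x a)) -> (forall a, psi (fun=> 0) a = 0) ->
  germ (fun x => f (psi x)).
Proof.
move=> [r [C [r0 [c hc hf]]]] /germ_all [r' [C' [r0' hp]]] p0.
pose t := Num.min 1 (r / (`|C'| + 1)).
have d0 : 0 < `|C'| + 1 by rewrite ltr_wpDl.
have t0 : 0 < t by rewrite lt_min ltr01 divr_gt0.
have t1 : t <= 1 by rewrite ge_min lexx.
have tC : t * C' <= r.
  apply: (@le_trans _ _ (t * (`|C'| + 1))).
    by rewrite ler_wpM2l ?(ltW t0) // ler_wpDr // ler_norm.
  by rewrite -ler_pdivlMr // ge_min lexx orbT.
have hp' a : An (fun=> t * r') r (fun x => psi x a).
  have [d hd E] := hp a; exists d.
    have := @nb_scale _ _ _ _ _ t 1 _ hd; rewrite expr1 => h.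
    apply: absum_leC tC _; apply: h; first by rewrite ltW.
    move=> al; rewrite ltnS leqn0 => /eqP al0.
    have -> : al = m0 B.
      by apply/ffunP => i; rewrite ffunE; have := mdeg_le al i; rewrite al0; lia.
    by rewrite -ev0 -E ?p0 // => i; rewrite normr0 ltW.
  move=> x hx; apply: E; apply: inballW hx.
  by rewrite ler_piMl // ltW.
exists (t * r'), C; split; first by rewrite mulr_gt0.
have := An_comp (fun=> mulr_gt0 t0 r0') hp' hc.
apply: An_ext => x hx; rewrite hf // => a.
by have [d hd ->] := hp' a; [apply: ev_le hd hx|].
Qed.

(** The quadratic remainder will give the chain rule along curves, and the second bound the
    continuity of [f]. *)
Lemma germ_taylor (I : finType) (f : (I -> R) -> R) : germ f ->
  exists (g : I -> (I -> R) -> R) (r M : R), [/\ 0 < r, 0 <= M, forall i, germ (g i) &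
  forall x y (e : R), 0 <= e ->
   inball (fun=> r) x -> inball (fun=> r) y -> (forall i, `|y i - x i| <= e) ->
   `|f y - f x - \sum_i g i x * (y i - x i)| <= M * e ^+ 2
   /\ `|f y - f x| <= M * e].
Proof.
move=> [r [C [r0 [c hc hf]]]].
have [M M0 hM] := ev_taylor (fun _ : I => r0) hc.
exists (fun i => ev (cder i c)), (4^-1 * r), M; split => //.
- by rewrite mulr_gt0.
- move=> i; exists (2^-1 * r), (r^-1 * C); split; first by rewrite mulr_gt0.
  by apply: An_ev; exact: (nb_der i (fun _ : I => r0) hc).
have sub z : inball (fun _ : I => 4^-1 * r) z -> inball (fun=> r) z.
  by apply: inballW; lra.
move=> x y e e0 hx hy he; rewrite !hf; [exact: hM|exact: sub|exact: sub].
Qed.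

End germs.

(** Convergence at the corner of a polydisc bounds the norm of the series there, hence gives
    absolute convergence on the whole polydisc. *)
Lemma analytic_at_germ n m (f : 'rV[R]_n -> 'rV[R]_m) (p : 'rV[R]_n) j :
  analytic_at f p -> germ (fun z : 'I_n -> R => f (p + \row_i z i) 0 j).
Proof.
move=> [r [c [r0 h]]].
have key z : inball (fun _ : 'I_n => r / 2) z ->
    psum (fun a => c a 0 j * mon z a) @ totally --> f (p + \row_i z i) 0 j.
  move=> hz.
  have bz : ball p r (p + \row_i z i).
    rewrite /ball /=; split => // i k; rewrite /ball /= !mxE ord1.
    rewrite opprD addrA subrr add0r normrN; apply: le_lt_trans (hz k) _; lra.
  have h1 := h _ bz.
  have h2 := continuous_cvg _ (@coord_continuous R 1 m 0 j (f (p + \row_i z i))) h1.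
  suff -> : psum (fun a => c a 0 j * mon z a) = (fun N : 'rV[R]_m => N 0 j) \o
    summability.partial_sum (fun a : {ffun 'I_n -> nat} =>
      (\prod_(i < n) ((p + \row_i z i) 0 i - p 0 i) ^+ a i) *: c a) by exact: h2.
  apply/funext => F /=.
  rewrite /summability.partial_sum summxE /psum big_seq_fsetE /=.
  apply: eq_bigr => a _; rewrite !mxE mulrC; congr (_ * _).
  by apply: eq_bigr => i _; rewrite !mxE addrAC subrr add0r.
have r20 : 0 < r / 2 by rewrite divr_gt0.
have rr : inball (fun _ : 'I_n => r / 2) (fun=> r / 2) by move=> i; rewrite gtr0_norm.
have [C hC] := cvg_absum (key _ rr).
exists (r / 2), C; split => //; exists (fun a => c a 0 j) => // z hz.
by apply/esym/tsumP; exact: key.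
Qed.

End analytic.

(** * Dickson's lemma and an order of the monomials *)

Section dickson.

Lemma nat_seq_argmin (v : nat -> nat) m : exists2 k, (m <= k)%N &
  forall l, (m <= l)%N -> (v k <= v l)%N.
Proof.
have ex : exists n, `[< exists2 k, (m <= k)%N & v k = n >] by exists (v m); apply/asboolP; exists m.
case: (ex_minnP ex) => n /asboolP[k mk <-] h; exists k => // l ml.
by apply: h; apply/asboolP; exists l.
Qed.

Lemma nat_seq_mono (v : nat -> nat) : exists phi : nat -> nat,
  {homo phi : i j / (i < j)%N} /\ {homo (v \o phi) : i j / (i <= j)%N}.
Proof.
have /boolp.choice [mu hmu] : forall m, exists k, (m <= k)%N /\
    forall l, (m <= l)%N -> (v k <= v l)%N.
  by move=> m; have [k mk h] := nat_seq_argmin v m; exists k.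
pose phi n := iter n (fun k => mu k.+1) (mu 0%N).
exists phi; split.
  by apply: (homo_ltn ltn_trans) => i /=; case: (hmu (phi i).+1).
apply: (homo_leq leqnn leq_trans) => i.
have [m hm le_m] : (exists2 m, phi i = mu m & (m <= phi i)%N).
  by case: i => [|i] /=; [exists 0%N|exists (phi i).+1 => //; case: (hmu (phi i).+1)].
change (v (phi i) <= v (mu (phi i).+1))%N.
rewrite {1}hm; apply: (hmu m).2.
by apply: leq_trans le_m _; apply: leq_trans (leqnSn _) _; case: (hmu (phi i).+1).
Qed.

Variable I : finType.

(** Pass to a nondecreasing subsequence for one variable after the other. *)
Lemma mindex_seq_mono (u : nat -> mindex I) : exists phi : nat -> nat,
  {homo phi : i j / (i < j)%N} /\ forall m n, (m <= n)%N -> mle (u (phi m)) (u (phi n)).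
Proof.
suff [phi [h1 h2]] : exists phi : nat -> nat, {homo phi : i j / (i < j)%N} /\
    forall i, i \in enum I -> forall m n, (m <= n)%N -> (u (phi m) i <= u (phi n) i)%N.
  by exists phi; split=> // m n mn; apply/mleP => i; apply: h2; rewrite ?mem_enum.
elim: (enum I) => [|i s [phi [h1 h2]]]; first by exists id; split.
have [psi [p1 p2]] := nat_seq_mono (fun n => u (phi n) i).
exists (phi \o psi); split; first by move=> m n /p1 /h1.
move=> j; rewrite in_cons => /predU1P[->|/h2 h] m n mn; first exact: p2 mn.
apply: h; move: mn; rewrite leq_eqVlt => /predU1P[->//|/p1]; exact: ltnW.
Qed.

(** Otherwise one could choose elements of [S] one after the other, none of them above an
    earlier one, against [mindex_seq_mono]. *)
Theorem dickson (S : mindex I -> Prop) : exists2 s : seq (mindex I),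
  (forall a, a \in s -> S a) & forall a, S a -> exists2 b, b \in s & mle b a.
Proof.
apply: contrapT => hno.
have /boolp.choice [pick hpick] : forall s : seq (mindex I), exists a,
    (forall b, b \in s -> S b) -> S a /\ forall b, b \in s -> ~~ mle b a.
  move=> s; have [hs|] := pselect (forall b, b \in s -> S b); last first.
    by move=> h; exists (m0 I).
  apply: contrapT => h; apply: hno; exists s => // a Sa.
  apply: contrapT => h'; apply: h; exists a => _; split => // b bs.
  by apply/negP => ba; apply: h'; exists b.
pose L n := iter n (fun s => pick s :: s) [::].
have LS n : forall b, b \in L n -> S b.
  elim: n => [//|n IH] b; rewrite /= in_cons => /predU1P[->|]; last exact: IH.
  by case: (hpick (L n) IH).
have Lmono m n : (m < n)%N -> pick (L m) \in L n.
  elim: n => // n IH; rewrite ltnS leq_eqVlt => /predU1P[->|/IH h] /=;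
  by rewrite in_cons ?eqxx // h orbT.
have [phi [p1 p2]] := mindex_seq_mono (fun n => pick (L n)).
have [_ /(_ _ (Lmono _ _ (p1 0%N 1%N isT)))] := hpick (L (phi 1%N)) (@LS _).
by rewrite p2.
Qed.

End dickson.

Lemma prime_above_ex n : exists p, (n < p)%N && prime p.
Proof. by have [p np pp] := prime_above n; exists p; rewrite np. Qed.

Fixpoint varprime n : nat := if n is k.+1 then xchoose (prime_above_ex (varprime k)) else 2.

Lemma varprime_prime n : prime (varprime n).
Proof. by case: n => [|n] //=; case/andP: (xchooseP (prime_above_ex (varprime n))). Qed.

Lemma varprime_inj : injective varprime.
Proof.
have lt : {homo varprime : m n / (m < n)%N}.
  by apply: (homo_ltn ltn_trans) => n /=; case/andP: (xchooseP (prime_above_ex (varprime n))).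
by move=> m n e; case: (ltngtP m n) => // /lt; rewrite e ltnn.
Qed.

Section key.
Variables (R : realType) (I : finType).
Implicit Types (a b g : mindex I) (c d f : mindex I -> R).

(** The order of the monomials is read off a multiplicative integer: with distinct primes [p_i]
    attached to the variables, the key of [a] is the product of the [p_i ^ a_i]. Keys are
    distinct, so this is a total order of type omega compatible with products, and with the
    polyradius [krad s] the monomial [a] takes the value [mkey a ^- s] ([mon_krad]): as [s]
    grows, a series is dominated by its term of least key. *)
Definition mkey a : nat := (\prod_i varprime (enum_rank i) ^ a i)%N.

Lemma mkey_gt0 a : (0 < mkey a)%N.
Proof. by apply: prodn_gt0 => i; rewrite expn_gt0 prime_gt0 // varprime_prime. Qed.

Lemma mkeyD a b : mkey (madd a b) = (mkey a * mkey b)%N.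
Proof. by rewrite /mkey -big_split; apply: eq_bigr => i _; rewrite ffunE expnD. Qed.

Lemma mkey_logn a i : logn (varprime (enum_rank i)) (mkey a) = a i.
Proof.
have E (s : seq I) : logn (varprime (enum_rank i)) (\prod_(j <- s) varprime (enum_rank j) ^ a j)%N
    = (\sum_(j <- s) (i == j) * a j)%N.
  elim: s => [|j s IH]; first by rewrite !big_nil logn1.
  have pos k : (0 < varprime k)%N by rewrite prime_gt0 // varprime_prime.
  rewrite !big_cons lognM ?IH ?expn_gt0 ?pos //; last by apply: prodn_gt0 => k; rewrite expn_gt0 pos.
  rewrite lognX logn_prime ?varprime_prime // mulnC (inj_eq varprime_inj).
  by rewrite (inj_eq val_inj) (inj_eq enum_rank_inj).
rewrite E (bigD1 i) //= eqxx mul1n big1 ?addn0 // => j ji.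
by rewrite eq_sym (negbTE ji).
Qed.

Lemma mkey_inj : injective mkey.
Proof. by move=> a b e; apply/ffunP => i; rewrite -!mkey_logn e. Qed.

Definition krad (s : nat) (i : I) : R := (varprime (enum_rank i))%:R ^- s.

Lemma krad_gt0 s i : 0 < krad s i.
Proof. by rewrite /krad invr_gt0 exprn_gt0 // ltr0n prime_gt0 // varprime_prime. Qed.

Lemma mon_krad s a : mon (krad s) a = (mkey a)%:R ^- s.
Proof.
rewrite /mon /krad /mkey natr_prod -prodrXl -prodfV; apply: eq_bigr => i _.
by rewrite natrX exprVn -!exprM mulnC.
Qed.

Definition cvps c : Prop := exists r C, 0 < r /\ nb (fun=> r) c C.

Lemma cvps_krad c : cvps c -> exists s0 C, forall s, (s0 <= s)%N -> nb (krad s) c C.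
Proof.
move=> [r [C [r0 hc]]].
pose s0 := Num.bound r^-1.
exists s0, C => s hs; apply: nb_ball hc => i.
rewrite gtr0_norm ?krad_gt0 // /krad invf_ple ?posrE //; last first.
  by rewrite exprn_gt0 // ltr0n prime_gt0 // varprime_prime.
apply: (@le_trans _ _ (s%:R)).
  have := archi_boundP (ltW (etrans (invr_gt0 r) r0)); rewrite -/s0 => /ltW h.
  by apply: le_trans h _; rewrite ler_nat.
rewrite -natrX ler_nat; apply: ltnW; apply: ltn_expl; exact: prime_gt1 (varprime_prime _).
Qed.

Lemma krad_cvps c s C : nb (krad s) c C -> cvps c.
Proof.
move=> hc; pose r := \big[Num.min/1]_(i : I) krad s i.
have r0 : 0 < r by rewrite /r; elim/big_ind: _ => // [x y|i _]; [rewrite lt_min => -> ->|exact: krad_gt0].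
exists r, C; split => //; apply: nb_ball hc => i.
by rewrite gtr0_norm // /r (bigD1 i) //= ge_min lexx.
Qed.

Definition mlead c a : Prop := c a != 0 /\ forall b, (mkey b < mkey a)%N -> c b = 0.

Lemma mlead_ex c : (exists a, c a != 0) -> exists a, mlead c a.
Proof.
move=> [a ca].
have ex : exists n, `[< exists2 a, c a != 0 & mkey a = n >].
  by exists (mkey a); apply/asboolP; exists a.
case: (ex_minnP ex) => n /asboolP[b cb <-] h; exists b; split => // b' lt.
apply/eqP/negP => /negP cb'; have := h (mkey b'); rewrite leqNgt lt => /(_ _) hh.
by have : false by apply: hh; apply/asboolP; exists b'.
Qed.

Lemma cmul_delta c a g : cmul c (cdelta R a) g = if mle a g then c (msub g a) else 0.
Proof.
case: ifP => ag.
  have E : msub g (msub g a) = a.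
    by apply/ffunP => i; rewrite !ffunE subKn //; move/mleP: ag.
  rewrite /cmul (@tsum_single _ _ (msub g a)).
    rewrite ifT; first by rewrite E /cdelta eqxx mulr1.
    by apply/mleP => i; rewrite ffunE leq_subr.
  move=> b bn; case: ifP => // bg; rewrite /cdelta.
  case: eqP => [e|]; rewrite ?mulr0 //.
  by move: bn; rewrite -e => /eqP[]; apply/ffunP => i; rewrite !ffunE subKn //; move/mleP: bg.
rewrite -[RHS](@tsum0 R (mindex I)); congr tsum; apply/funext => b; case: ifP => // bg.
rewrite /cdelta; case: eqP => [e|]; rewrite ?mulr0 //.
by move: ag; rewrite -e => /mleP[] i; rewrite ffunE leq_subr.
Qed.

Lemma cmulDr rho c d d' C D D' : (forall i, 0 < rho i) ->
  nb rho c C -> nb rho d D -> nb rho d' D' ->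
  cmul c (fun a => d a + d' a) = (fun g => cmul c d g + cmul c d' g).
Proof.
move=> r0 hc hd hd'; apply/funext => g.
have hE := cmul_abs r0 hc hd g; have hE' := cmul_abs r0 hc hd' g.
rewrite /cmul -(tsumD hE hE'); congr tsum; apply/funext => b.
by case: ifP; rewrite ?addr0 // mulrDr.
Qed.

End key.

(** * Convergent power series form a noetherian ring *)

Section division.
Variables (R : realType) (I : finType) (m : nat) (rho : I -> R).
Variables (a : 'I_m -> mindex I) (g : 'I_m -> mindex I -> R).
Hypotheses (r0 : forall i, 0 < rho i)
  (gt1 : forall j b, g j b != 0 -> (mkey (a j) < mkey b)%N)
  (gn : forall j, nb rho (g j) (mon rho (a j) / 2)).
Implicit Types (c d f F : mindex I -> R) (b al : mindex I).

(** Assigns to an exponent one of the leading exponents that divide it, if any: the divisor that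
    will be used to cancel this monomial. *)
Definition cls al : option 'I_m := [pick j | mle (a j) al].

(** The multiplier of the [j]-th divisor that cancels all the monomials of [F] assigned to
    [j]. *)
Definition quot F j b : R :=
  if cls (madd (a j) b) == Some j then F (madd (a j) b) else 0.

Definition rmd F al : R := if cls al == None then F al else 0.

(** What the tails [g j] of the divisors contribute when the multipliers are read off [F]. *)
Definition red F al : R := - \sum_j cmul (quot F j) (g j) al.

Lemma nb_quot F N j : nb rho F N -> nb rho (quot F j)
  ((mon rho (a j))^-1 *
    tsum (fun al => if cls al == Some j then `|F al * mon rho al| else 0)).
Proof.
move=> hF; set h := fun al => _; have p := mon_gt0 (a j) r0.
have hh : absum h N by apply: absum_restrict; exact: absum_norm.
have h0 al : 0 <= h al by rewrite /h; case: ifP.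
have hq := absum_inj (@madd_inj _ (a j)) (tsum_absum_ge0 h0 hh).
move=> G; have := absumZ (mon rho (a j))^-1 hq G.
rewrite ger0_norm; last by rewrite invr_ge0 ltW.
apply: le_trans; apply: ler_sum => b _; rewrite /quot /h /=.
case: ifP => _; last by rewrite mul0r normr0.
rewrite monD mulrCA [X in _ <= `|_ * X|]normrM (gtr0_norm p) mulKf ?gt_eqF //.
by rewrite normr_id.
Qed.

(** Each monomial of [F] is assigned to one divisor only, so the norms of the multipliers add up
    to at most that of [F], and the tails contribute the factor 1/2. *)
Lemma nb_red F N : nb rho F N -> nb rho (red F) (N / 2).
Proof.
move=> hF.
pose n j := tsum (fun al => if cls al == Some j then `|F al * mon rho al| else 0).
have hj j : nb rho (cmul (quot F j) (g j)) (n j / 2).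
  have := nb_mul r0 (nb_quot j hF) (gn j); congr nb.
  by rewrite -/(n j); field; rewrite gt_eqF // mon_gt0.
have hs := nbZ (-1) (nb_sum (enum 'I_m) hj).
have E : (fun al => -1 * \sum_(j <- enum 'I_m) cmul (quot F j) (g j) al) = red F.
  by apply/funext => al; rewrite /red mulN1r big_enum.
rewrite E normrN1 mul1r in hs; apply: absum_leC hs.
rewrite -mulr_suml ler_wpM2r // big_enum /=.
have hn j : absum (fun al => if cls al == Some j then `|F al * mon rho al| else 0) N.
  by apply: absum_restrict; exact: absum_norm.
rewrite -big_enum /= -(tsum_sum _ hn).
apply: le_trans (ler_norm _) (absum_tsum _) => G'.
apply: le_trans (hF G'); apply: ler_sum => al _.
rewrite big_enum /= ger0_norm; last by apply: sumr_ge0 => j _; case: ifP.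
case: (cls al) => [j|]; last by rewrite big1.
rewrite (bigD1 j) //= eqxx big1 ?addr0 // => k kj; case: eqP => // -[e].
by rewrite e eqxx in kj.
Qed.

(** Tails have larger keys than the leading monomials they come with, so [red] only looks at
    smaller keys. *)
Lemma red_local F F' k : (forall al, (mkey al < k)%N -> F al = F' al) ->
  forall al, (mkey al <= k)%N -> red F al = red F' al.
Proof.
move=> FF' al alk; rewrite /red; congr (- _); apply: eq_bigr => j _.
rewrite /cmul; congr tsum; apply/funext => b; case: ifP => // bal.
have [->|/gt1 lt] := eqVneq (g j (msub al b)) 0; first by rewrite !mulr0.
rewrite /quot; case: ifP => _ //; rewrite FF' //.
apply: leq_trans alk; rewrite -(msubK bal) !mkeyD mulnC ltn_pmul2l ?mkey_gt0 //.
Qed.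

(** Division by several series, after Grauert: [F] is the solution of [F = f + red F]. The
    iteration is stationary at each exponent by [red_local], and [nb_red] bounds the iterates by
    a geometric series of ratio 1/2. *)
Lemma division f C : nb rho f C -> exists F, nb rho F (2 * C) /\
  f = (fun al => rmd F al + \sum_j cmul (quot F j) (fun b => cdelta R (a j) b + g j b) al).
Proof.
move=> hf.
(* the n-th iterate is already correct on the exponents of key at most n *)
pose Fn n := iter n (fun F al => f al + red F al) (fun=> 0).
have hFn n : nb rho (Fn n) (2 * C).
  elim: n => [|n IH] /=.
    move=> G; rewrite big1 ?mulr_ge0 ?(absum_ge0 hf) // => al _.
    by rewrite mul0r normr0.
  apply: absum_leC (nbD hf (nb_red IH)); lra.
have st n al : (mkey al <= n)%N -> Fn n.+1 al = Fn n al.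
  elim: n al => [|n IH] al h; first by have := mkey_gt0 al; lia.
  by rewrite /= -/(Fn n.+1) /=; congr (_ + _); apply: red_local h => b; rewrite ltnS; exact: IH.
pose F al := Fn (mkey al) al.
have FE n al : (mkey al <= n)%N -> Fn n al = F al.
  elim: n => [|n IH] h; first by have := mkey_gt0 al; lia.
  move: h; rewrite leq_eqVlt => /predU1P[e|h]; first by rewrite /F e.
  by rewrite st // IH.
have hF : nb rho F (2 * C).
  move=> G; pose K := (\sum_(al <- G) mkey al)%N.
  apply: le_trans (hFn K G); rewrite big_seq [leRHS]big_seq; apply: ler_sum => al alG.
  by rewrite FE // /K (big_fsetD1 al) //= leq_addr.
exists F; split => //.
have fE al : F al = f al + red F al.
  rewrite -(FE (mkey al).+1) //=; congr (_ + _).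
  by apply: (red_local (k := (mkey al).+1)) => // b; rewrite ltnS => /FE.
apply/funext => al.
have -> : f al = F al - red F al by rewrite fE; ring.
rewrite /red opprK.
under [in RHS]eq_bigr => j _ do rewrite
  (cmulDr r0 (nb_quot j hF) (nb_delta rho (a j)) (gn j)) cmul_delta.
rewrite big_split /= addrA; congr (_ + _).
rewrite /rmd /quot; case E: (cls al) => [j|] /=.
  have aj : mle (a j) al by move: E; rewrite /cls; case: pickP => // k ak [<-].
  rewrite add0r (bigD1 j) //= aj msubK // E eqxx big1 ?addr0 // => k kj.
  case: ifP => // ak; rewrite msubK // E; case: eqP => // -[e].
  by rewrite e eqxx in kj.
rewrite big1 ?addr0 // => k _; case: ifP => // ak.
by rewrite msubK // E.
Qed.

End division.

Section noether.
Variables (R : realType) (I : finType).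
Implicit Types (c d f q : mindex I -> R).

Lemma cvpsB c d : cvps c -> cvps d -> cvps (fun a => c a + -1 * d a).
Proof.
move=> /cvps_krad [s [C hc]] /cvps_krad [s' [D hd]].
apply: (@krad_cvps _ _ _ (maxn s s')).
apply: nbD; first exact: hc _ (leq_maxl _ _).
by apply: nbZ; exact: hd _ (leq_maxr _ _).
Qed.

Lemma cmul_cst k c : cmul (fun a => k * cdelta R (m0 I) a) c = (fun a => k * c a).
Proof.
apply/funext => g; rewrite /cmul (@tsum_single _ _ (m0 I)).
  rewrite ifT; last by apply/mleP => i; rewrite ffunE.
  rewrite /cdelta eqxx mulr1; congr (_ * c _).
  by apply/ffunP => i; rewrite !ffunE subn0.
by move=> b /negbTE b0; rewrite /cdelta b0 mulr0 mul0r if_same.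
Qed.

(** Going from [s0] to [s = s0 + n], a term of key above [k] shrinks by the factor [k.+1 ^- n]
    at least, the bound only by [k ^- n]; the ratio of the two tends to 0. *)
Lemma cvps_tail_small d k : (0 < k)%N -> cvps d -> (forall b, d b != 0 -> (k < mkey b)%N) ->
  exists s0, forall s, (s0 <= s)%N -> nb (krad R s) d (k%:R ^- s / 2).
Proof.
move=> k0 /cvps_krad [s0 [C hC]] hd.
have C0 : 0 <= C := absum_ge0 (hC _ (leqnn _)).
have k0' : 0 < k%:R :> R by rewrite ltr0n.
pose L := 2 * C * k%:R ^+ s0 * k%:R.
pose n0 := Num.bound L.
exists (s0 + n0)%N => s hs G.
pose n := (s - s0)%N.
have n0n : (n0 <= n)%N by rewrite /n; lia.
have sE : s = (s0 + n)%N by rewrite /n; lia.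
have := hC _ (leqnn s0) G.
have kn : 0 < (k.+1%:R : R) ^- n by rewrite invr_gt0 exprn_gt0.
rewrite -(ler_pM2l kn) => h.
apply: le_trans (le_trans _ h) _.
  rewrite mulr_sumr; apply: ler_sum => b _; rewrite !mon_krad.
  have [->|/hd kb] := eqVneq (d b) 0; first by rewrite !mul0r normr0 mulr0.
  rewrite !normrM mulrCA ler_wpM2l // !ger0_norm ?invr_ge0 ?exprn_ge0 //.
  rewrite sE exprD invfM mulrC ler_wpM2r ?invr_ge0 ?exprn_ge0 //.
  rewrite lef_pV2 ?posrE ?exprn_gt0 ?ltr0n ?mkey_gt0 //.
  by rewrite lerXn2r ?nnegrE // ler_nat.
rewrite sE exprD invfM.
have bern : 1 + n%:R / k%:R <= (k.+1%:R / k%:R) ^+ n :> R.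
  elim: (n) => [|l IH]; first by rewrite mul0r addr0 expr0.
  rewrite exprS.
  have e1 : k.+1%:R / k%:R = 1 + k%:R^-1 :> R by rewrite -natr1 mulrDl mulfV ?gt_eqF // mul1r.
  have i0 : 0 <= (k%:R : R)^-1 by rewrite invr_ge0 ltW.
  apply: (@le_trans _ _ ((1 + k%:R^-1) * (1 + l%:R / k%:R))).
    rewrite -natr1; have : 0 <= (k%:R : R)^-1 * (l%:R / k%:R) by rewrite mulr_ge0 // mulr_ge0.
    by nra.
  by rewrite e1 in IH *; rewrite ler_wpM2l // addr_ge0.
have Ln : L <= n%:R.
  have L0 : 0 <= L by rewrite /L !mulr_ge0 // ?exprn_ge0 // ltW.
  apply: le_trans (ltW (archi_boundP L0)) _; by rewrite ler_nat.
have key : 2 * C * k%:R ^+ s0 <= (k.+1%:R / k%:R) ^+ n.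
  apply: le_trans bern; apply: (@le_trans _ _ (n%:R / k%:R)).
    by rewrite ler_pdivlMr.
  by rewrite lerDr.
rewrite expr_div_n in key.
have ks : 0 < (k%:R : R) ^+ s0 by rewrite exprn_gt0.
have kn' : 0 < (k%:R : R) ^+ n by rewrite exprn_gt0.
have kn1 : 0 < (k.+1%:R : R) ^+ n by rewrite exprn_gt0.
rewrite -(ler_pM2l kn1) mulrA mulfV ?gt_eqF // mul1r.
rewrite -(ler_pM2r ks) -(@ler_pM2l _ 2) // mulrA.
apply: le_trans key _.
rewrite le_eqVlt; apply/orP; left; apply/eqP; field.
by rewrite !gt_eqF // -natr1 gt_eqF // addr_gt0.
Qed.

(** By [dickson] finitely many elements of the ideal have leading exponents that divide all the
    leading exponents of the ideal. The remainder of a division by them is in the ideal and none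
    of its exponents is divisible by these leading exponents, so it is zero. *)
Theorem cvps_noetherian (P : (mindex I -> R) -> Prop) :
  (forall c, P c -> cvps c) ->
  (forall c d, P c -> P d -> P (fun a => c a + -1 * d a)) ->
  (forall q c, cvps q -> P c -> P (cmul q c)) ->
  exists (m : nat) (g : 'I_m -> mindex I -> R), (forall j, P (g j)) /\
    forall f, P f -> exists q : 'I_m -> mindex I -> R, (forall j, cvps (q j)) /\
      f = (fun al => \sum_j cmul (q j) (g j) al).
Proof.
move=> Pc PB PM.
have [s hs1 hs2] := dickson (fun a => exists2 c, P c & mlead c a).
pose m := size s; pose a (j : 'I_m) := nth (m0 I) s j.
have /boolp.choice [g0 hg0] : forall j, exists c, P c /\ mlead c (a j).
  move=> j; have [|c Pc' lc] := hs1 (a j); first exact: mem_nth.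
  by exists c.
pose g j al := (g0 j (a j))^-1 * g0 j al.
have gP j : P (g j).
  have [h [nz _]] := hg0 j; rewrite /g; set k := _^-1.
  have := PM (fun al => k * cdelta R (m0 I) al) _ _ h.
  rewrite cmul_cst; apply; apply: (@krad_cvps _ _ _ 0%N).
  by apply: nbZ; exact: nb_delta.
pose gt j al := g j al + -1 * cdelta R (a j) al.
have gtc j : cvps (gt j).
  by apply: cvpsB; [exact/Pc|apply: (@krad_cvps _ _ _ 0%N); exact: nb_delta].
have gt1 j b : gt j b != 0 -> (mkey (a j) < mkey b)%N.
  have [_ [nz h]] := hg0 j; apply: contraR; rewrite -leqNgt leq_eqVlt.
  move=> /predU1P[/mkey_inj ->|lt]; rewrite /gt /g.
    by rewrite mulVf // /cdelta eqxx mulr1 subrr.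
  rewrite (h b) // /cdelta; case: (b =P a j) => [e|_]; last by rewrite !mulr0 addr0.
  by rewrite e ltnn in lt.
have /boolp.choice [S hS] := fun j => cvps_tail_small (mkey_gt0 (a j)) (gtc j) (@gt1 j).
exists m, g; split => // f Pf.
have [sf [C hC]] := cvps_krad (Pc _ Pf).
pose t := (sf + \sum_j S j)%N.
have gn j : nb (krad R t) (gt j) (mon (krad R t) (a j) / 2).
  by rewrite mon_krad; apply: hS; rewrite /t (bigD1 j) //=; lia.
have [|F [hF fE]] := division (@krad_gt0 R I t) gt1 gn (hC t _); first by rewrite /t leq_addr.
have gE j : (fun b => cdelta R (a j) b + gt j b) = g j.
  by apply/funext => b; rewrite /gt; ring.
have qc j : cvps (quot a F j) by have := nb_quot a (@krad_gt0 R I t) j hF; exact: krad_cvps.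
exists (quot a F); split => //.
have Prm : P (rmd a F).
  have -> : rmd a F = (fun al => f al + -1 * \sum_(j <- enum 'I_m) cmul (quot a F j) (g j) al).
    apply/funext => al; rewrite [in RHS]fE big_enum /=.
    by under eq_bigr do rewrite gE; ring.
  elim: (enum _) => [|j r IH].
    by under eq_fun do rewrite big_nil mulr0 addr0.
  have := PB _ _ IH (PM _ _ (qc j) (gP j)); congr P; apply/funext => al.
  by rewrite big_cons; ring.
have rm0 al : rmd a F al = 0.
  apply: contrapT => /eqP nz; have [b bl] := mlead_ex (ex_intro (fun al => rmd a F al != 0) al nz).
  have [b' b's b'b] := hs2 b (ex_intro2 P (fun c => mlead c b) _ Prm bl).
  case: bl => /eqP bn _; apply: bn; rewrite /rmd ifF //; apply/negbTE.
  rewrite /cls; case: pickP => // /(_ (Ordinal (ltac:(by rewrite index_mem) : (index b' s < m)%N))).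
  by rewrite /a /= nth_index // b'b.
by rewrite fE; apply/funext => al; rewrite rm0 add0r; apply: eq_bigr => j _; rewrite gE.
Qed.

End noether.

(** * Exponential asymptotics of scalar linear equations *)

Section asymptotics.
Variable R : realType.
Implicit Types (f g h : R -> R) (K l t T c C : R).

Definition evt (P : R -> Prop) : Prop := exists T, forall t, T < t -> P t.

Lemma evtI (P Q : R -> Prop) : evt P -> evt Q -> evt (fun t => P t /\ Q t).
Proof.
move=> [T hP] [T' hQ]; exists (Num.max T T') => t.
by rewrite gt_max => /andP[/hP ? /hQ ?].
Qed.

Lemma evtW (P Q : R -> Prop) : (forall t, P t -> Q t) -> evt P -> evt Q.
Proof. by move=> h [T hP]; exists T => t /hP /h. Qed.

Lemma evt_gt T : evt (fun t => T < t). Proof. by exists T. Qed.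

Lemma evt_all (A : finType) (P : A -> R -> Prop) : (forall a, evt (P a)) ->
  evt (fun t => forall a, P a t).
Proof.
move=> h; suff : evt (fun t => forall a, a \in enum A -> P a t).
  by apply: evtW => t H a; apply: H; rewrite mem_enum.
elim: (enum A) => [|a s IH]; first by exists 0.
apply: evtW (evtI (h a) IH) => t [pa ps] b; rewrite in_cons => /predU1P[->//|].
exact: ps.
Qed.

Lemma evt_ex (P : R -> Prop) T : evt P -> exists2 t, T < t & P t.
Proof.
move=> [T' h]; exists (Num.max T T' + 1).
  by apply: le_lt_trans (_ : Num.max T T' < _); [rewrite le_max lexx|rewrite ltrDl].
by apply: h; apply: le_lt_trans (_ : Num.max T T' < _); [rewrite le_max lexx orbT|rewrite ltrDl].
Qed.

Definition small K f : Prop := exists C, evt (fun t => `|f t| <= C * expR (- (K * t))).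
Definition big K f : Prop := exists2 c, 0 < c & evt (fun t => c * expR (- (K * t)) <= f t).
Definition sexp f : Prop := forall K, small K f.

Lemma small_evt0 K f : small K f -> exists C, 0 < C /\
  evt (fun t => 0 < t /\ `|f t| <= C * expR (- (K * t))).
Proof.
move=> [C h]; exists (`|C| + 1); split; first by rewrite ltr_wpDl.
apply: evtW (evtI (evt_gt 0) h) => t [t0 ht]; split => //.
apply: le_trans ht _; rewrite ler_wpM2r ?expR_ge0 //.
by rewrite ler_wpDr // ler_norm.
Qed.

Lemma small_le K K' f : K' <= K -> small K f -> small K' f.
Proof.
move=> KK /small_evt0 [C [C0 h]]; exists C; apply: evtW h => t [t0 ht].
apply: le_trans ht _; rewrite ler_wpM2l ?(ltW C0) // ler_expR lerN2 ler_wpM2r //.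
exact: ltW.
Qed.

Lemma small_ext K f g : evt (fun t => `|g t| <= `|f t|) -> small K f -> small K g.
Proof.
by move=> h [C hC]; exists C; apply: evtW (evtI h hC) => t [a b]; apply: le_trans b.
Qed.

Lemma smallD K f g : small K f -> small K g -> small K (fun t => f t + g t).
Proof.
move=> [C h] [D h']; exists (C + D); apply: evtW (evtI h h') => t [a b].
by rewrite mulrDl; apply: le_trans (ler_normD _ _) _; exact: lerD.
Qed.

Lemma smallN K f : small K f -> small K (fun t => - f t).
Proof. by apply: small_ext; exists 0 => t _; rewrite normrN. Qed.

Lemma smallM K K' f g : small K f -> small K' g -> small (K + K') (fun t => f t * g t).
Proof.
move=> [C h] [D h']; exists (C * D); apply: evtW (evtI h h') => t [a b].
rewrite mulrDl opprD expRD mulrACA normrM; exact: ler_pM.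
Qed.

Lemma small_bnd K C f g : evt (fun t => `|g t| <= C) -> small K f ->
  small K (fun t => g t * f t).
Proof.
move=> h hf; have : small 0 g.
  by exists C; apply: evtW h => t; rewrite mul0r oppr0 expR0 mulr1.
by move=> /smallM /(_ hf); rewrite add0r.
Qed.

Lemma smallZ K k f : small K f -> small K (fun t => k * f t).
Proof. by apply: (small_bnd (C := `|k|)); exists 0. Qed.

Lemma small0 K : small K (fun=> 0).
Proof. by exists 0; exists 0 => t _; rewrite normr0 mul0r. Qed.

Lemma small_sum K (A : Type) (s : seq A) (f : A -> R -> R) : (forall a, small K (f a)) ->
  small K (fun t => \sum_(a <- s) f a t).
Proof.
move=> h; elim: s => [|a s IH].
  by under eq_fun do rewrite big_nil; exact: small0.
by under eq_fun do rewrite big_cons; exact: smallD.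
Qed.

Lemma big_le K K' f : K <= K' -> big K f -> big K' f.
Proof.
move=> KK [c c0 h]; exists c => //; apply: evtW (evtI (evt_gt 0) h) => t [t0].
apply: le_trans; rewrite ler_wpM2l ?(ltW c0) // ler_expR lerN2 ler_wpM2r //.
exact: ltW.
Qed.

Lemma evt_expR k C : 0 < k -> evt (fun t => C < expR (k * t)).
Proof.
move=> k0; exists (C / k) => t; rewrite ltr_pdivrMr // => h.
apply: lt_le_trans h _; rewrite mulrC; apply: le_trans (expR_ge1Dx _).
by rewrite lerDr.
Qed.

Lemma evt_expRN k e : 0 < k -> 0 < e -> evt (fun t => expR (- (k * t)) < e).
Proof.
move=> k0 e0; apply: evtW (evt_expR e^-1 k0) => t h.
by rewrite expRN invf_plt ?posrE ?expR_gt0.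
Qed.

Lemma small_big_absurd K K' f : K < K' -> small K' f -> big K f -> False.
Proof.
move=> KK [C h] [c c0 h']; have d0 : 0 < K' - K by rewrite subr_gt0.
have [t _ [[a b] d]] := evt_ex 0 (evtI (evtI h h') (evt_expR (C / c) d0)).
have : c * expR (- (K * t)) <= C * expR (- (K' * t)).
  by apply: le_trans b _; apply: le_trans (ler_norm _) a.
have -> : - (K * t) = (K' - K) * t + (- (K' * t)) by ring.
rewrite expRD mulrA ler_pM2r ?expR_gt0 // leNgt => /negP; apply.
by rewrite mulrC -ltr_pdivrMr.
Qed.

Definition ddt f f' : Prop := evt (fun t => is_derive t (1 : R) f (f' t)).

Lemma mono_on T f f' : (forall t, T < t -> is_derive t (1 : R) f (f' t)) ->
  (forall t, T < t -> 0 <= f' t) -> forall s t, T < s -> s <= t -> f s <= f t.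
Proof.
move=> hf hf' s t Ts; rewrite le_eqVlt => /predU1P[->//|st].
have [||c] := @MVT R f f' s t st.
- by move=> x; rewrite in_itv /= => /andP[sx _]; apply: hf; exact: lt_trans sx.
- apply: derivable_within_continuous => x; rewrite in_itv /= => /andP[sx _].
  by have := hf x (lt_le_trans Ts sx); case.
rewrite in_itv /= => /andP[sc _] e.
by rewrite -subr_ge0 e mulr_ge0 ?subr_ge0 ?(ltW st) // hf' // (lt_trans Ts).
Qed.

Lemma is_derive_congr f g x df dg : is_derive x (1 : R) f df -> f =1 g -> df = dg ->
  is_derive x (1 : R) g dg.
Proof. by move=> h /funext <- <-. Qed.

Lemma is_derive_expRM k t : is_derive t (1 : R) (fun t => expR (k * t)) (k * expR (k * t)).
Proof.
have h : is_derive t (1 : R) ( *%R k) k.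
  have := is_deriveM (is_derive_cst k t 1) (is_derive_id t 1).
  by rewrite scaler0 addr0 /GRing.scale /= mulr1.
by have := is_derive1_comp (is_derive_expR (k * t)) h; rewrite mulrC.
Qed.

Lemma is_derive_expM k t f df : is_derive t (1 : R) f df ->
  is_derive t (1 : R) (fun t => expR (k * t) * f t) (expR (k * t) * (k * f t + df)).
Proof.
move=> h; have := is_deriveM (is_derive_expRM k t) h.
by move/is_derive_congr; apply => //; rewrite /GRing.scale /=; ring.
Qed.

Lemma ddtN f f' : ddt f f' -> ddt (fun t => - f t) (fun t => - f' t).
Proof. by apply: evtW => t h; exact: is_deriveN. Qed.

(** Take [K'] different from [l]. The function [expR (l * t) * f t] minus the multiple [c1] of
    [expR ((l - K') * t)] is nondecreasing. If [l > K'] the exponential tends to infinity and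
    [f] is at least of the order of [expR (- (K' * t))]. If [l < K'] it tends to 0 and [c1] is
    negative: either the function becomes positive, and then [f] is at least of the order of
    [expR (- (l * t))], or it stays nonpositive, and then [- f] is at least of the order of
    [expR (- (K' * t))]. *)
Lemma step_big K K' l f g e : K' < K -> big K' g -> small K e ->
  ddt f (fun t => - l * f t + g t + e t) ->
  exists2 K'', K'' < K & big K'' f \/ big K'' (fun t => - f t).
Proof.
wlog neq : K' / K' != l.
  move=> hw KK gK; have [e0|ne] := eqVneq K' l; last exact: (hw _ ne KK gK).
  apply: (hw ((K' + K) / 2)); [|lra|apply: big_le gK; lra].
  by rewrite -e0; apply/eqP => ?; lra.
move=> KK [c c0 hg] /small_evt0 [C [C0 he]] hf.
have [T hT] : evt (fun t => [/\ is_derive t (1 : R) f (- l * f t + g t + e t), 0 < t &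
    c / 2 * expR (- (K' * t)) <= g t + e t]).
  have d0 : 0 < K - K' by lra.
  have hex := evt_expR (2 * C / c) d0.
  apply: evtW (evtI (evtI hf hg) (evtI he hex)) => t [[a b] [[t0 d] h]]; split => //.
  suff : C * expR (- (K * t)) <= c / 2 * expR (- (K' * t)).
    by move: d; rewrite ler_norml => /andP[? ?] ?; lra.
  have -> : - (K' * t) = (K - K') * t + (- (K * t)) by ring.
  rewrite expRD mulrA ler_pM2r ?expR_gt0 //.
  by move: h; rewrite ltr_pdivrMr // => /ltW h; nra.
pose dl := l - K'.
have dl0 : dl != 0 by rewrite subr_eq0 eq_sym.
pose c1 := c / 2 / dl.
pose H t := expR (l * t) * f t - c1 * expR (dl * t).
have hH t : T < t -> is_derive t (1 : R) H
    (expR (l * t) * (l * f t + (- l * f t + g t + e t)) - c1 * (dl * expR (dl * t))).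
  move=> /hT [h _ _]; apply: (is_deriveB (is_derive_expM l h)).
  have := is_deriveZ c1 (is_derive_expRM dl t).
  by [].
have hH0 t : T < t ->
    0 <= expR (l * t) * (l * f t + (- l * f t + g t + e t)) - c1 * (dl * expR (dl * t)).
  move=> /hT [_ _ h].
  rewrite mulrA /c1 divfK // subr_ge0 addrA addrA mulNr subrr add0r.
  have -> : dl * t = l * t + - (K' * t) by rewrite /dl; ring.
  by rewrite expRD mulrCA ler_wpM2l ?expR_ge0.
have mono := mono_on hH hH0.
have fE t : f t = expR (- (l * t)) * (H t + c1 * expR (dl * t)).
  by rewrite /H subrK mulrA -expRD addNr expR0 mul1r.
have [dpos|dneg] := ltrP 0 dl.
  have c10 : 0 < c1 by rewrite /c1 !divr_gt0.
  exists K' => //; left; exists (c1 / 2); first by rewrite divr_gt0.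
  pose T1 := T + 1.
  have hex := evt_expR (`|H T1| * 2 / c1) dpos.
  apply: evtW (evtI (evt_gt T1) hex) => t [Tt h].
  have m1 : H T1 <= H t by apply: mono; [rewrite /T1 ltrDl|exact: ltW].
  rewrite fE (_ : - (K' * t) = - (l * t) + dl * t); last by rewrite /dl; ring.
  rewrite expRD mulrCA ler_wpM2l ?expR_ge0 //.
  move: h; rewrite ltr_pdivrMr // => h.
  have := lerNnormlW (lexx (`|H T1|)); nra.
have {}dneg : dl < 0 by rewrite lt_neqAle dl0.
have c1n : c1 < 0 by rewrite /c1 pmulr_rlt0 ?invr_lt0 ?divr_gt0.
have [[t1 Tt1 H1]|hno] := pselect (exists2 t1, T < t1 & 0 < H t1).
  exists l; first by rewrite /dl in dneg; lra.
  left; exists (H t1 / 2); first by rewrite divr_gt0.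
  have e0 : 0 < H t1 / 2 / (- c1) by rewrite !divr_gt0 // oppr_gt0.
  have d0 : 0 < - dl by lra.
  apply: evtW (evtI (evt_gt t1) (evt_expRN d0 e0)) => t [Tt h].
  have m1 : H t1 <= H t by apply: mono => //; exact: ltW.
  rewrite fE mulrC ler_wpM2l ?expR_ge0 //.
  move: h; rewrite mulNr opprK ltr_pdivlMr ?oppr_gt0 // => h; lra.
exists K' => //; right; exists (- c1); first by lra.
exists T => t Tt; have Ht : H t <= 0.
  by rewrite leNgt; apply/negP => h; apply: hno; exists t.
rewrite fE (_ : - (K' * t) = - (l * t) + dl * t); last by rewrite /dl; ring.
have := mulr_ge0_le0 (expR_ge0 (- (l * t))) Ht; rewrite expRD; nra.
Qed.

Lemma step_small_half K1 l f h C T : K1 != l ->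
  (forall t, T < t -> is_derive t (1 : R) f (- l * f t + h t)) ->
  (forall t, T < t -> `|h t| <= C * expR (- (K1 * t))) ->
  forall s t, T < s -> s <= t ->
  expR (l * s) * f s + C / (l - K1) * expR ((l - K1) * s) <=
  expR (l * t) * f t + C / (l - K1) * expR ((l - K1) * t).
Proof.
move=> ne hf hh s t Ts st; pose dl := l - K1; rewrite -/dl.
have dl0 : dl != 0 by rewrite subr_eq0 eq_sym.
pose c1 := C / dl; rewrite -/c1.
pose H t := expR (l * t) * f t + c1 * expR (dl * t).
suff : H s <= H t by [].
apply: (mono_on (T := T) (f' := fun t =>
    expR (l * t) * (l * f t + (- l * f t + h t)) + c1 * (dl * expR (dl * t)))) => //.
  move=> u /hf hu; apply: (is_deriveD (is_derive_expM l hu)).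
  exact: (is_deriveZ c1 (is_derive_expRM dl u)).
move=> u /hh; rewrite ler_norml => /andP[hu _].
rewrite mulrA /c1 divfK // addrA mulNr subrr add0r.
have -> : dl * u = l * u + - (K1 * u) by rewrite /dl; ring.
rewrite expRD mulrCA -mulrDr mulr_ge0 ?expR_ge0 //; lra.
Qed.

(** Apply [step_small_half] to [f] and to [- f]. If [l] is above the rate of [h], comparison
    with a fixed time shows that [f] decays like [h]. If it is below, the two monotone functions
    decide: if one of them becomes positive, [f] has a definite sign at the rate [l], and
    otherwise [f] is as small as [h]. *)
Lemma step_small K l f h : (forall K1, K1 < K -> small K1 h) ->
  ddt f (fun t => - l * f t + h t) ->
  [\/ forall K1, K1 < K -> small K1 f, exists2 K'', K'' < K & big K'' f |
      exists2 K'', K'' < K & big K'' (fun t => - f t)].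
Proof.
move=> hh hf.
suff main K1 : K1 < K -> K1 != l -> [\/ small K1 f, (l < K /\ big l f) |
    l < K /\ big l (fun t => - f t)].
  have [[h1 h2]|n1] := pselect (l < K /\ big l f); first by apply: Or32; exists l.
  have [[h1 h2]|n2] := pselect (l < K /\ big l (fun t => - f t)).
    by apply: Or33; exists l.
  apply: Or31 => K1 K1K; have [e|ne] := eqVneq K1 l; last by case: (main K1 K1K ne).
  apply: (@small_le ((K1 + K) / 2)); first by lra.
  have h1 : (K1 + K) / 2 < K by lra.
  have h2 : (K1 + K) / 2 != l by apply/eqP => ?; lra.
  by case: (main _ h1 h2).
move=> K1K ne; have [C [C0 hC]] := small_evt0 (hh _ K1K).
have [T hT] := evtI hf hC.
have hd t : T < t -> is_derive t (1 : R) f (- l * f t + h t) by move=> /hT [].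
have hd' t : T < t -> is_derive t (1 : R) (fun t => - f t) (- l * - f t + - h t).
  by move=> /hd h'; apply: (is_derive_congr (is_deriveN h')) => //; ring.
have hb t : T < t -> `|h t| <= C * expR (- (K1 * t)) by move=> /hT [_ []].
have hb' t : T < t -> `|- h t| <= C * expR (- (K1 * t)) by rewrite normrN; exact: hb.
have A := step_small_half ne hd hb.
have B := step_small_half ne hd' hb'.
set dl := l - K1 in A B; set c1 := C / dl in A B.
have dl0 : dl != 0 by rewrite subr_eq0 eq_sym.
have [dpos|dneg] := ltrP 0 dl.
  apply: Or31; pose T1 := T + 1; pose u := `|expR (l * T1) * f T1|.
  have c10 : 0 < c1 by rewrite divr_gt0.
  exists (c1 + u); exists (Num.max T1 0) => t; rewrite gt_max => /andP[Tt t0].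
  have TT1 : T < T1 by rewrite ltrDl.
  have a := A _ _ TT1 (ltW Tt); have b := B _ _ TT1 (ltW Tt).
  have -> : f t = expR (- (l * t)) * (expR (l * t) * f t).
    by rewrite mulrA -expRD addNr expR0 mul1r.
  rewrite (_ : - (K1 * t) = - (l * t) + dl * t); last by rewrite /dl; ring.
  rewrite expRD normrM ger0_norm ?expR_ge0 // mulrCA ler_wpM2l ?expR_ge0 //.
  have e1 : 1 <= expR (dl * t) by rewrite -expR0 ler_expR mulr_ge0 // ltW.
  have u0 : u <= u * expR (dl * t) by rewrite ler_peMr // normr_ge0.
  have hu : - u <= expR (l * T1) * f T1 <= u by rewrite -ler_norml.
  have := expR_ge0 (dl * T1).
  move: a b; rewrite !mulrN => a b e2; rewrite ler_norml.
  have e3 := mulr_ge0 (ltW c10) e2; rewrite mulrDl.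
  by move/andP: hu => [hu1 hu2]; apply/andP; split; lra.
have {}dneg : dl < 0 by rewrite lt_neqAle dl0.
have c1n : c1 < 0 by rewrite /c1 pmulr_rlt0 ?invr_lt0.
have lK : l < K by rewrite /dl in dneg; lra.
have eb (F : R -> R) t1 : T < t1 ->
   (forall s t, T < s -> s <= t -> expR (l * s) * F s + c1 * expR (dl * s) <=
    expR (l * t) * F t + c1 * expR (dl * t)) ->
   0 < expR (l * t1) * F t1 + c1 * expR (dl * t1) -> big l F.
  move=> Tt1 hF p; exists (expR (l * t1) * F t1 + c1 * expR (dl * t1)) => //.
  exists t1 => t tt; have := hF _ _ Tt1 (ltW tt) => h1.
  have -> : F t = (expR (l * t) * F t) * expR (- (l * t)).
    by rewrite mulrC mulrA -expRD addNr expR0 mul1r.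
  rewrite ler_wpM2r ?expR_ge0 //; have := mulr_le0_ge0 (ltW c1n) (expR_ge0 (dl * t)); lra.
have [[t1 Tt1 p]|n1] := pselect (exists2 t1, T < t1 & 0 < expR (l * t1) * f t1 + c1 * expR (dl * t1)).
  by apply: Or32; split => //; exact: eb p.
have [[t1 Tt1 p]|n2] := pselect (exists2 t1, T < t1 & 0 < expR (l * t1) * - f t1 + c1 * expR (dl * t1)).
  by apply: Or33; split => //; exact: (@eb (fun t => - f t) t1).
apply: Or31; exists (- c1); exists T => t Tt.
have a1 : expR (l * t) * f t + c1 * expR (dl * t) <= 0.
  by rewrite leNgt; apply/negP => h'; apply: n1; exists t.
have a2 : expR (l * t) * - f t + c1 * expR (dl * t) <= 0.
  by rewrite leNgt; apply/negP => h'; apply: n2; exists t.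
have -> : f t = expR (- (l * t)) * (expR (l * t) * f t).
  by rewrite mulrA -expRD addNr expR0 mul1r.
rewrite (_ : - (K1 * t) = - (l * t) + dl * t); last by rewrite /dl; ring.
rewrite expRD normrM ger0_norm ?expR_ge0 // mulrCA ler_wpM2l ?expR_ge0 //.
rewrite mulrN in a2; rewrite ler_norml; apply/andP; split; lra.
Qed.

Definition negl_or_signed K f : Prop := [\/ forall K1, K1 < K -> small K1 f,
   exists2 K'', K'' < K & big K'' f | exists2 K'', K'' < K & big K'' (fun t => - f t)].

(** A positive forcing term makes the solution of definite sign by [step_big], a negligible one
    is the case of [step_small]. *)
Lemma negl_or_signed_step K l f g e : negl_or_signed K g -> (forall K1, K1 < K -> small K1 e) ->
  ddt f (fun t => - l * f t + g t + e t) -> negl_or_signed K f.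
Proof.
move=> dg he hf; case: dg => [gs|[K' KK gb]|[K' KK gb]].
- apply: (@step_small K l f (fun t => g t + e t)).
    by move=> K1 hK; apply: smallD; [exact: gs|exact: he].
  by apply: evtW hf => t; rewrite addrA.
- have h1 : (K' + K) / 2 < K by lra.
  have [|K'' K2 [b|b]] := step_big _ gb (he _ h1) hf; first by lra.
  + by apply: Or32; exists K'' => //; lra.
  + by apply: Or33; exists K'' => //; lra.
have h1 : (K' + K) / 2 < K by lra.
have hfN : ddt (fun t => - f t) (fun t => - l * - f t + - g t + - e t).
  by apply: evtW (ddtN hf) => t h; apply: (is_derive_congr h) => //; ring.
have [|K'' K2 [b|b]] := step_big _ gb (smallN (he _ h1)) hfN; first by lra.
  by apply: Or33; exists K'' => //; lra.
apply: Or32; exists K''; first by lra.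
by move: b; congr big; apply/funext => t; rewrite opprK.
Qed.

Lemma negl_or_signed_small K f : small K f -> negl_or_signed K f.
Proof. by move=> h; apply: Or31 => K1 /ltW K1K; exact: small_le h. Qed.

(** Since [expR (C * t) * G t] is nondecreasing, [G] cannot tend to 0 faster than
    [expR (- C * t)] unless it is zero. *)
Lemma sexp_gronwall_eq0 C T G G' : (forall t, T < t -> is_derive t (1 : R) G (G' t)) ->
  (forall t, T < t -> - (C * G t) <= G' t) -> (forall t, T < t -> 0 <= G t) -> sexp G ->
  forall t, T < t -> G t = 0.
Proof.
move=> hG hG' G0 hs t Tt; apply/eqP; rewrite eq_le G0 // andbT.
have mono s : t <= s -> expR (C * t) * G t <= expR (C * s) * G s.
  apply: (@mono_on T (fun t => expR (C * t) * G t)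
    (fun t => expR (C * t) * (C * G t + G' t))) => // u Tu.
    by apply: is_derive_expM; exact: hG.
  by rewrite mulr_ge0 ?expR_ge0 //; have := hG' u Tu; lra.
have [D [D0 hD]] := small_evt0 (hs (C + 1)).
rewrite leNgt; apply/negP => Gt.
have p : 0 < expR (C * t) * G t / D by rewrite divr_gt0 // mulr_gt0 // expR_gt0.
have [s ts [[s0 hDs] h1]] := evt_ex t (evtI hD (evt_expRN ltr01 p)).
have := mono s (ltW ts); rewrite leNgt => /negP; apply.
move: h1; rewrite ltr_pdivlMr // mul1r => h1; apply: le_lt_trans h1.
apply: (@le_trans _ _ (expR (C * s) * (D * expR (- ((C + 1) * s))))).
  by rewrite ler_wpM2l ?expR_ge0 //; apply: le_trans hDs; exact: ler_norm.
rewrite (_ : - ((C + 1) * s) = - (C * s) + - s); last by ring.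
by rewrite expRD mulrCA [X in _ * X]mulrA -expRD subrr expR0 mul1r mulrC.
Qed.

End asymptotics.

(** * Power series along curves *)

Section series_ops.
Variables (R : realType) (I : finType).
Implicit Types (c d : mindex I -> R) (x : I -> R).

Lemma cvps2 c d : cvps c -> cvps d ->
  exists r C D, [/\ 0 < r, nb (fun=> r) c C & nb (fun=> r) d D].
Proof.
move=> [r [C [r0 hc]]] [r' [D [r0' hd]]]; exists (Num.min r r'), C, D.
have m0 : 0 < Num.min r r' by rewrite lt_min r0.
by split => //; [move: hc|move: hd]; apply: nb_ball => i;
  rewrite ger0_norm ?(ltW m0) // ge_min lexx ?orbT.
Qed.

Lemma cvpsD c d : cvps c -> cvps d -> cvps (fun a => c a + d a).
Proof.
move=> /cvps2 h /h [r [C [D [r0 hc hd]]]].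
by exists r, (C + D); split => //; exact: nbD.
Qed.

Lemma cvpsZ k c : cvps c -> cvps (fun a => k * c a).
Proof. by move=> [r [C [r0 hc]]]; exists r, (`|k| * C); split => //; exact: nbZ. Qed.

Lemma cvpsM c d : cvps c -> cvps d -> cvps (cmul c d).
Proof.
move=> /cvps2 h /h [r [C [D [r0 hc hd]]]].
by exists r, (C * D); split => //; exact: nb_mul.
Qed.

Lemma cvps_der i c : cvps c -> cvps (cder i c).
Proof.
move=> [r [C [r0 hc]]]; exists (2^-1 * r), (r^-1 * C); split; first by rewrite mulr_gt0.
exact: (nb_der i (fun _ : I => r0) hc).
Qed.

Lemma cvps_delta (a : mindex I) : cvps (cdelta R a).
Proof. by exists 1, `|mon (fun=> 1) a|; split => //; exact: nb_delta. Qed.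

Lemma cvps_sum T (s : seq T) (c : T -> mindex I -> R) : (forall t, cvps (c t)) ->
  cvps (fun a => \sum_(t <- s) c t a).
Proof.
move=> h; elim: s => [|t s IH].
  exists 1, 0; split => // F; rewrite big1 // => a _.
  by rewrite big_nil mul0r normr0.
by under eq_fun do rewrite big_cons; exact: cvpsD.
Qed.

Definition near0 (P : (I -> R) -> Prop) : Prop :=
  exists2 r : R, 0 < r & forall x, inball (fun=> r) x -> P x.

Lemma near0I P Q : near0 P -> near0 Q -> near0 (fun x => P x /\ Q x).
Proof.
move=> [r r0 hP] [r' r0' hQ]; exists (Num.min r r'); first by rewrite lt_min r0.
move=> x hx; split; [apply: hP|apply: hQ] => i; apply: le_trans (hx i) _;
  by rewrite ge_min lexx ?orbT.
Qed.

Lemma near0W (P Q : (I -> R) -> Prop) : (forall x, P x -> Q x) -> near0 P -> near0 Q.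
Proof. by move=> h [r r0 hP]; exists r => // x /hP /h. Qed.

Lemma near0_ev_bnd c : cvps c -> exists C, near0 (fun x => `|ev c x| <= C).
Proof. by move=> [r [C [r0 hc]]]; exists C, r => // x hx; exact: ev_le hc hx. Qed.

Lemma near0_evD c d : cvps c -> cvps d ->
  near0 (fun x => ev (fun a => c a + d a) x = ev c x + ev d x).
Proof.
by move=> /cvps2 h /h [r [C [D [r0 hc hd]]]]; exists r => // x hx; exact: evD hc hd hx.
Qed.

Lemma near0_evZ k c : cvps c -> near0 (fun x => ev (fun a => k * c a) x = k * ev c x).
Proof. by move=> [r [C [r0 hc]]]; exists r => // x hx; exact: evZ hc hx. Qed.

Lemma near0_evM c d : cvps c -> cvps d ->
  near0 (fun x => ev (cmul c d) x = ev c x * ev d x).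
Proof.
move=> /cvps2 h /h [r [C [D [r0 hc hd]]]]; exists r => // x hx.
exact: (ev_mul (fun=> r0) hc hd hx).
Qed.

Lemma near0_evS T (s : seq T) (c : T -> mindex I -> R) : (forall t, cvps (c t)) ->
  near0 (fun x => ev (fun a => \sum_(t <- s) c t a) x = \sum_(t <- s) ev (c t) x).
Proof.
move=> h; elim: s => [|t s IH].
  exists 1 => // x _; rewrite big_nil /ev -[RHS](@tsum0 R (mindex I)); congr tsum.
  by apply/funext => a; rewrite big_nil mul0r.
have [r r0 hr] := near0I IH (near0_evD (h t) (cvps_sum s h)).
exists r => // x /hr [e1 e2]; rewrite big_cons -e1 -e2; congr ev.
by apply/funext => a; rewrite big_cons.
Qed.

Lemma cvps_taylor c : cvps c -> exists r M, [/\ 0 < r, 0 <= M & forall x y (e : R), 0 <= e ->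
   inball (fun=> r) x -> inball (fun=> r) y -> (forall i, `|y i - x i| <= e) ->
   `|ev c y - ev c x - \sum_i ev (cder i c) x * (y i - x i)| <= M * e ^+ 2
   /\ `|ev c y - ev c x| <= M * e].
Proof.
move=> [r [C [r0 hc]]]; have [M M0 h] := ev_taylor (fun _ : I => r0) hc.
by exists (4^-1 * r), M; split => //; rewrite mulr_gt0.
Qed.

End series_ops.

Section curves.
Variable R : realType.

Lemma is_derive_cvg (f : R -> R) (t d : R) :
  (fun h => h^-1 *: (f (h *: (1 : R) + t) - f t)) @ 0^' --> d -> is_derive t (1 : R) f d.
Proof.
move=> h; apply: DeriveDef; first by apply/cvg_ex; exists d.
exact: cvg_lim h.
Qed.

Lemma is_derive_eps (f : R -> R) t d :
  (forall e : R, 0 < e -> \forall s \near t, `|f s - f t - d * (s - t)| <= e * `|s - t|) ->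
  is_derive t (1 : R) f d.
Proof.
move=> h; apply: is_derive_cvg; apply/cvgrPdist_le => e e0.
have := h e e0; rewrite nbhs0P => /nbhs_dnbhs; rewrite /dnbhs /within /=.
apply: filterS => s /= hs s0; have := hs s0.
rewrite /GRing.scale /= mulr1 [t + s]addrC addrK => {}hs.
have -> : d - s^-1 * (f (s + t) - f t) = - (s^-1 * (f (s + t) - f t - d * s)).
  by field.
rewrite normrN normrM normfV mulrC ler_pdivrMr ?normr_gt0 //.
Qed.

Lemma eps_is_derive (f : R -> R) t d : is_derive t (1 : R) f d ->
  forall e : R, 0 < e -> \forall s \near t, `|f s - f t - d * (s - t)| <= e * `|s - t|.
Proof.
move=> [fd dE] e e0.
have H : (fun h => h^-1 *: (f (h *: (1 : R) + t) - f t)) @ 0^' --> d by rewrite -dE.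
move/cvgrPdist_le: H => /(_ _ e0); rewrite nbhs0P /dnbhs /within /=.
rewrite near_withinE => H; apply: filterS H => s /= hs.
rewrite [t + s]addrC addrK.
have [->|s0] := eqVneq s 0; first by rewrite add0r subrr mulr0 subrr normr0 mulr0.
have := hs s0; rewrite /GRing.scale /= mulr1 => {}hs.
have -> : f (s + t) - f t - d * s = - ((d - s^-1 * (f (s + t) - f t)) * s).
  by field.
by rewrite normrN normrM ler_wpM2r.
Qed.

Lemma is_derive_lip (f : R -> R) t d : is_derive t (1 : R) f d ->
  \forall s \near t, `|f s - f t| <= (`|d| + 1) * `|s - t|.
Proof.
move=> /eps_is_derive /(_ _ ltr01); apply: filterS => s; rewrite mul1r => h.
have -> : f s - f t = (f s - f t - d * (s - t)) + d * (s - t) by ring.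
by apply: le_trans (ler_normD _ _) _; rewrite normrM mulrDl mul1r; lra.
Qed.

Lemma filter_seq (T : eqType) (A : Type) (Fl : set_system A) (r : seq T) (P : T -> A -> Prop) :
  Filter Fl -> (forall k, k \in r -> Fl (P k)) -> Fl (fun s => forall k, k \in r -> P k s).
Proof.
move=> fF; elim: r => [|k r IH] h; first exact: filterS filterT.
have h1 : Fl (fun s => forall z, z \in r -> P z s).
  by apply: IH => z zr; apply: h; rewrite in_cons zr orbT.
have h2 : Fl (P k) by apply: h; rewrite in_cons eqxx.
apply: filterS2 h2 h1 => s hk hr z; rewrite in_cons => /predU1P[->//|]; exact: hr.
Qed.

Lemma filter_fin (T : finType) (A : Type) (Fl : set_system A) (P : T -> A -> Prop) :
  Filter Fl -> (forall k, Fl (P k)) -> Fl (fun s => forall k, P k s).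
Proof.
move=> fF h; have := filter_seq (r := enum T) fF (fun k _ => h k).
by apply: filterS => s H k; apply: H; rewrite mem_enum.
Qed.

(** The chain rule in the form needed for power series: a first-order expansion of [F] in terms
    of [X] around the one point [X t] suffices. *)
Lemma is_derive_taylor (I : finType) (X : R -> I -> R) (d : I -> R) (F : R -> R)
  (g : I -> R) (t M : R) :
  (forall i, is_derive t (1 : R) (X^~ i) (d i)) -> 0 <= M ->
  (\forall s \near t, forall e : R, 0 <= e -> (forall i, `|X s i - X t i| <= e) ->
     `|F s - F t - \sum_i g i * (X s i - X t i)| <= M * e ^+ 2) ->
  is_derive t (1 : R) F (\sum_i g i * d i).
Proof.
move=> hX M0 hF; apply: is_derive_eps => e e0.
pose L := \sum_i (`|d i| + 1); pose G := \sum_i `|g i|.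
have L0 : 0 <= L by apply: sumr_ge0 => i _; rewrite addr_ge0.
have G0 : 0 <= G by apply: sumr_ge0.
have hL i : `|d i| + 1 <= L.
  by rewrite /L (bigD1 i) //= lerDl sumr_ge0 // => j _; rewrite addr_ge0.
have ge0 : 0 < e / (2 * (G + 1)) by rewrite divr_gt0 // mulr_gt0 // ltr_wpDl.
have me0 : 0 < e / (2 * (M * L ^+ 2 + 1)).
  by rewrite divr_gt0 // mulr_gt0 // ltr_wpDl // mulr_ge0 // sqr_ge0.
have h1 : \forall s \near t, forall i, `|X s i - X t i| <= L * `|s - t|.
  apply: filter_fin => i; apply: filterS (is_derive_lip (hX i)) => s h.
  by apply: le_trans h _; rewrite ler_wpM2r.
have h2 : \forall s \near t, forall i, `|X s i - X t i - d i * (s - t)| <=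
    e / (2 * (G + 1)) * `|s - t|.
  by apply: filter_fin => i; exact: eps_is_derive.
have h3 : \forall s \near t, `|s - t| < e / (2 * (M * L ^+ 2 + 1)).
  by apply/nbhs_ballP; exists (e / (2 * (M * L ^+ 2 + 1))) => //= s; rewrite /ball /= distrC.
near=> s.
have a1 : `|F s - F t - \sum_i g i * (X s i - X t i)| <= M * (L * `|s - t|) ^+ 2.
  by near: s; apply: filterS2 hF h1 => s hF h1; apply: hF => //; rewrite mulr_ge0.
have b2 : forall i, `|X s i - X t i - d i * (s - t)| <= e / (2 * (G + 1)) * `|s - t|.
  by near: s.
have a2 : `|\sum_i g i * (X s i - X t i) - (\sum_i g i * d i) * (s - t)| <=
    e / 2 * `|s - t|.
  rewrite mulr_suml -sumrB; apply: le_trans (ler_norm_sum _ _ _) _.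
  apply: (@le_trans _ _ (\sum_i `|g i| * (e / (2 * (G + 1)) * `|s - t|))).
    apply: ler_sum => i _.
    have -> : g i * (X s i - X t i) - g i * d i * (s - t) =
      g i * (X s i - X t i - d i * (s - t)) by ring.
    by rewrite normrM ler_wpM2l //.
  rewrite -mulr_suml -/G mulrA ler_wpM2r //.
  have -> : G * (e / (2 * (G + 1))) = e / 2 * (G / (G + 1)).
    by field; rewrite gt_eqF // ltr_wpDl.
  by rewrite ler_piMr ?divr_ge0 ?(ltW e0) // ler_pdivrMr ?mul1r ?lerDl // ltr_wpDl.
have a3 : M * (L * `|s - t|) ^+ 2 <= e / 2 * `|s - t|.
  have : `|s - t| < e / (2 * (M * L ^+ 2 + 1)) by near: s.
  rewrite ltr_pdivlMr; last by rewrite mulr_gt0 // ltr_wpDl // mulr_ge0 // sqr_ge0.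
  have := normr_ge0 (s - t); move: (`|s - t|) => u u0 hu.
  have -> : M * (L * u) ^+ 2 = (M * L ^+ 2 * u) * u by ring.
  by rewrite ler_wpM2r //; lra.
have -> : F s - F t - (\sum_i g i * d i) * (s - t) =
  (F s - F t - \sum_i g i * (X s i - X t i)) +
  (\sum_i g i * (X s i - X t i) - (\sum_i g i * d i) * (s - t)) by ring.
apply: le_trans (ler_normD _ _) _; lra.
Unshelve. all: by end_near.
Qed.

End curves.

(** * Analytic functions on a contracting orbit do not oscillate *)

Section core.
Variables (R : realType) (I : finType) (X : R -> I -> R) (lam : I -> R) (w : I -> nat).
Variables (N : I -> mindex I -> R) (e : I -> R -> R) (rate : R).
Hypotheses (w1 : forall i, (w i <= 1)%N) (hN : forall i, cvps (N i)) (rate0 : 0 < rate)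
  (hX : forall i, small rate (fun t => X t i))
  (hd : forall i, ddt (X^~ i) (fun t => - lam i * X t i + ev (N i) (X t) + e i t)).
Implicit Types (c d : mindex I -> R) (a b : mindex I).

(** The weights [w] grade the monomials so that [N i] has order larger than [w i]. Therefore the
    derivation [Lop], by which the equation of [X] acts on power series, is diagonal on the
    lowest part of a series, with the eigenvalues [- lsum]. *)
Definition wdeg a := (\sum_i w i * a i)%N.
Definition lsum a : R := \sum_i lam i * (a i)%:R.

Hypotheses (ordN : forall i a, (wdeg a < (w i).+1)%N -> N i a = 0)
  (fin : forall k, exists s : seq R, forall a, wdeg a = k -> lsum a \in s).

Definition Lop c a : R :=
  \sum_i cmul (N i) (cder i c) a - lsum a * c a.

Lemma wdegD a b : wdeg (madd a b) = (wdeg a + wdeg b)%N.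
Proof.
rewrite /wdeg -big_split; apply: eq_bigr => i _; by rewrite ffunE mulnDr.
Qed.

Lemma wdeg1 i : wdeg (m1 i) = w i.
Proof.
rewrite /wdeg (bigD1 i) //= ffunE eqxx muln1 big1 ?addn0 // => j /negbTE ji.
by rewrite ffunE ji muln0.
Qed.

Lemma lsum_cE c a : lsum a * c a = \sum_i lam i * cmul (cder i c) (cdelta R (m1 i)) a.
Proof.
rewrite /lsum mulr_suml; apply: eq_bigr => i _; rewrite -mulrA cmul_delta m1_le.
congr (_ * _); case: ifP => ai; last by move/negbT: ai; rewrite -eqn0Ngt => /eqP ->; rewrite mul0r.
have ai' : mle (m1 i) a by rewrite m1_le.
by rewrite /cder msubK // ffunE ffunE eqxx subn1 prednK.
Qed.

Lemma LopE c : Lop c = (fun a => \sum_i cmul (N i) (cder i c) a +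
  -1 * \sum_i lam i * cmul (cder i c) (cdelta R (m1 i)) a).
Proof. by apply/funext => a; rewrite /Lop lsum_cE mulN1r. Qed.

Lemma cvps_Lop c : cvps c -> cvps (Lop c).
Proof.
move=> hc; rewrite LopE; apply: cvpsD.
  by apply: cvps_sum => i; apply: cvpsM => //; exact: cvps_der.
apply: cvpsZ; apply: cvps_sum => i; apply: cvpsZ.
by apply: cvpsM; [exact: cvps_der|exact: cvps_delta].
Qed.

Lemma near0_all (T : finType) (P : T -> (I -> R) -> Prop) :
  (forall i, near0 (P i)) -> near0 (fun x => forall i, P i x).
Proof.
move=> h; suff : near0 (fun x => forall i, i \in enum T -> P i x).
  by apply: near0W => s H i; apply: H; rewrite mem_enum.
elim: (enum T) => [|i r IH]; first by exists 1.
apply: near0W (near0I (h i) IH) => x [hi hr] j; rewrite in_cons => /predU1P[->//|]; exact: hr.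
Qed.

Lemma ev_Lop c : cvps c -> near0 (fun x => ev (Lop c) x =
  \sum_i ev (cder i c) x * (- lam i * x i + ev (N i) x)).
Proof.
move=> hc; have hdr i := cvps_der i hc.
have h1 i := cvpsM (hN i) (hdr i).
have h2 i := cvpsZ (lam i) (cvpsM (hdr i) (cvps_delta R (m1 i))).
have A1 := near0_evD (cvps_sum (index_enum I) h1) (cvpsZ (-1) (cvps_sum (index_enum I) h2)).
have A2 := near0_evS (index_enum I) h1.
have A3 := near0_evZ (-1) (cvps_sum (index_enum I) h2).
have A4 := near0_evS (index_enum I) h2.
have A5 := near0_all (fun i => near0_evM (hN i) (hdr i)).
have A6 := near0_all (fun i => near0_evZ (lam i) (cvpsM (hdr i) (cvps_delta R (m1 i)))).
have A7 := near0_all (fun i => near0_evM (hdr i) (cvps_delta R (m1 i))).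
apply: near0W (near0I (near0I (near0I A1 A2) (near0I A3 A4)) (near0I A5 (near0I A6 A7))).
move=> x [[[a1 a2] [a3 a4]] [a5 [a6 a7]]].
rewrite LopE a1 a2 a3 a4 mulN1r -sumrB; apply: eq_bigr => i _.
by rewrite a5 a6 a7 ev_delta mon1; ring.
Qed.

Lemma evt_near0 (P : (I -> R) -> Prop) : near0 P -> evt (fun t => P (X t)).
Proof.
move=> [r r0 hP]; suff : evt (fun t => forall i, `|X t i| <= r).
  by apply: evtW => t h; exact: hP.
apply: evt_all => i; have [C [C0 h]] := small_evt0 (hX i).
have p : 0 < r / C by rewrite divr_gt0.
apply: evtW (evtI h (evt_expRN rate0 p)) => t [[t0 h1] h2].
apply: le_trans h1 _; rewrite mulrC; apply: ltW.
by rewrite -ltr_pdivlMr.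
Qed.

(** The chain rule: along [X] the derivation [Lop] computes time derivatives, up to the error
    terms. *)
Lemma ddt_ev c : cvps c -> ddt (fun t => ev c (X t))
  (fun t => ev (Lop c) (X t) + \sum_i ev (cder i c) (X t) * e i t).
Proof.
move=> hc; have [r [M [r0 M0 hT]]] := cvps_taylor hc.
have hr : near0 (inball (fun _ : I => r)) by exists r.
have [T hT1] := evtI (evtI (evt_all hd) (evt_near0 hr)) (evt_near0 (ev_Lop hc)).
exists T => t Tt; have [[h1 h2] h3] := hT1 t Tt.
rewrite h3 -big_split /=; under eq_bigr do rewrite -mulrDr.
apply: (is_derive_taylor h1 M0 (g := fun i => ev (cder i c) (X t))).
have : \forall s \near t, T < s by exact: lt_nbhsr.
apply: filterS => s Ts d d0 hds.
by case: (hT (X t) (X s) d d0 h2 (hT1 s Ts).1.2 hds).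
Qed.

Lemma ev_bnd c : cvps c -> exists C, evt (fun t => `|ev c (X t)| <= C).
Proof. by move=> /near0_ev_bnd [C h]; exists C; exact: (evt_near0 h). Qed.

Lemma nb_wscale rho c C t k : 0 <= t <= 1 -> nb rho c C ->
  (forall a, (wdeg a < k)%N -> c a = 0) ->
  nb (fun i => t ^+ w i * rho i) c (t ^+ k * C).
Proof.
move=> /andP[t0 t1] hc c0 F.
have monE a : mon (fun i => t ^+ w i * rho i) a = t ^+ wdeg a * mon rho a.
  rewrite /mon /wdeg; under eq_bigr do rewrite exprMn -exprM.
  rewrite big_split /=; congr (_ * _).
  by rewrite -(big_morph _ (exprD t) (expr0 t)).
apply: (@le_trans _ _ (\sum_(a <- F) t ^+ k * `|c a * mon rho a|)); last first.
  by rewrite -mulr_sumr ler_wpM2l // exprn_ge0.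
apply: ler_sum => a _; rewrite monE.
have [/c0 ->|ka] := ltnP (wdeg a) k; first by rewrite !mul0r normr0 mulr0.
rewrite mulrCA normrM ler_wpM2r // ger0_norm ?exprn_ge0 //.
exact: ler_wiXn2l.
Qed.

(** On the polydisc shrunk by [u ^+ w i], with [u] of the order of [expR (- rate * t)], the norm
    of the series drops by [u ^+ k]; and [X t] lies in it because the weights are at most 1. *)
Lemma small_ord c k : cvps c -> (forall a, (wdeg a < k)%N -> c a = 0) ->
  small (k%:R * rate) (fun t => ev c (X t)).
Proof.
move=> [r [C [r0 hc]]] ck.
have h : forall i, exists D, 0 < D /\ evt (fun t => 0 < t /\ `|X t i| <= D * expR (- (rate * t))).
  by move=> i; exact: small_evt0.
have /boolp.choice [D hD] := h.
pose E := \sum_i D i + 1.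
have E0 : 0 < E by rewrite ltr_wpDl // sumr_ge0 // => i _; case: (hD i) => /ltW.
have DE i : D i <= E.
  rewrite /E (bigD1 i) //= -addrA lerDl addr_ge0 // sumr_ge0 // => j _.
  by case: (hD j) => /ltW.
exists ((E / r) ^+ k * C).
have p : 0 < r / E by rewrite divr_gt0.
have hA := evt_all (fun i => (hD i).2).
apply: evtW (evtI hA (evt_expRN rate0 p)) => t [h1 h2].
pose u := E * expR (- (rate * t)) / r.
have u0 : 0 <= u by rewrite /u divr_ge0 ?mulr_ge0 ?expR_ge0 // ltW.
have u1 : u <= 1.
  by rewrite /u ler_pdivrMr // mul1r mulrC -ler_pdivlMr // ltW.
have hu : 0 <= u <= 1 by rewrite u0 u1.
have ur : E * expR (- (rate * t)) = u * r by rewrite /u divfK // gt_eqF.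
have Xu i : `|X t i| <= u * r.
  rewrite -ur; apply: le_trans (h1 i).2 _; rewrite ler_wpM2r ?expR_ge0 //.
have -> : (E / r) ^+ k * C * expR (- (k%:R * rate * t)) = u ^+ k * C.
  have -> : u = (E / r) * expR (- (rate * t)) by rewrite /u; ring.
  by rewrite [in RHS]exprMn -expRM_natl [RHS]mulrAC; congr (_ * expR _); ring.
apply: ev_le (nb_wscale hu hc ck) _ => i; apply: le_trans (Xu i) _.
rewrite ler_wpM2r ?(ltW r0) //; case: (w i) (w1 i) => [|[|//]] _; rewrite ?expr0 ?expr1 //.
Qed.

Lemma cmul_ord c i k a : (forall b, (wdeg b < k)%N -> c b = 0) -> (wdeg a <= k)%N ->
  cmul (N i) (cder i c) a = 0.
Proof.
move=> ck ak; rewrite /cmul -[RHS](@tsum0 R (mindex I)); congr tsum; apply/funext => b.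
case: ifP => // ba; have [h|h] := ltnP (wdeg b) (w i).+1; first by rewrite ordN ?mul0r.
rewrite /cder ck ?mulr0 // wdegD wdeg1.
have := wdegD b (msub a b); rewrite msubK //; lia.
Qed.

Lemma Lop_ord c k a : (forall b, (wdeg b < k)%N -> c b = 0) -> (wdeg a <= k)%N ->
  Lop c a = - lsum a * c a.
Proof.
move=> ck ak; rewrite /Lop big1 ?sub0r ?mulNr // => i _; exact: cmul_ord ck ak.
Qed.

Section err.
Variable K : R.
Hypothesis he : forall K1, K1 < K -> forall i, small K1 (e i).

Lemma err_small c : cvps c -> forall K1, K1 < K ->
  small K1 (fun t => \sum_i ev (cder i c) (X t) * e i t).
Proof.
move=> hc K1 hK; apply: small_sum => i.
have [C hC] := ev_bnd (cvps_der i hc); exact: small_bnd hC (he hK i).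
Qed.

(** Descending induction on the weighted order [n], starting beyond [K / rate], where
    [small_ord] makes the series negligible. By [fin], the operators [Lop + l] for finitely many
    [l] kill the part of order [n] eigenvalue by eigenvalue, and raise the order;
    [negl_or_signed_step] climbs back along this chain. *)
Lemma negl_or_signed_ev c : cvps c -> negl_or_signed K (fun t => ev c (X t)).
Proof.
pose k := Num.bound (`|K| / rate).
have hk : K <= k%:R * rate.
  rewrite -ler_pdivrMr //; apply: le_trans (ltW (archi_boundP (divr_ge0 (normr_ge0 K) (ltW rate0)))).
  by rewrite ler_wpM2r ?invr_ge0 ?(ltW rate0) // ler_norm.
suff H j : (j <= k)%N -> forall c, cvps c -> (forall a, (wdeg a < k - j)%N -> c a = 0) ->
    negl_or_signed K (fun t => ev c (X t)).
  by move=> hc; apply: (H k) => // a; rewrite subnn.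
elim: j => [|j IH] jk {}c hc.
  by rewrite subn0 => ck; apply/negl_or_signed_small/(small_le hk)/small_ord.
set n := (k - j.+1)%N => cn; have nE : (k - j = n.+1)%N by rewrite /n; lia.
have {}IH := IH (ltnW jk); rewrite nE in IH.
have [s hs] := fin n.
suff G : forall (s : seq R) c, cvps c -> (forall a, (wdeg a < n)%N -> c a = 0) ->
    (forall a, wdeg a = n -> c a != 0 -> lsum a \in s) -> negl_or_signed K (fun t => ev c (X t)).
  by apply: (G s) => // a an _; exact: hs.
elim=> [|l {hs}s IHs] {cn hc}c hc cn cs.
  apply: IH => // a; rewrite ltnS leq_eqVlt => /predU1P[an|]; last exact: cn.
  by apply/eqP; apply: contraT => /(cs a an).
pose c' a := Lop c a + l * c a.
have hc' : cvps c' by apply: cvpsD; [exact: cvps_Lop|exact: cvpsZ].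
have c'E a : (wdeg a <= n)%N -> c' a = (l - lsum a) * c a.
  by move=> an; rewrite /c' (Lop_ord cn an); ring.
have dc' : negl_or_signed K (fun t => ev c' (X t)).
  apply: IHs => // [a an|a an]; first by rewrite c'E ?cn ?mulr0 // ltnW.
  rewrite c'E ?an // mulf_eq0 negb_or subr_eq0 => /andP[nl /(cs a an)].
  by rewrite in_cons eq_sym (negbTE nl).
apply: (negl_or_signed_step dc' (err_small hc) (l := l)).
have [T hT] := evtI (ddt_ev hc) (evt_near0 (near0I
  (near0_evD (cvps_Lop hc) (cvpsZ l hc)) (near0_evZ l hc))).
exists T => t /hT [h [e1 e2]]; apply: (is_derive_congr h) => //.
by rewrite /c' e1 e2; ring.
Qed.

End err.

Section conclusion.
Variables (m : nat) (h : 'I_m -> mindex I -> R) (Ce : R).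
Hypotheses (hh : forall k, cvps (h k)) (h0 : forall k, h k (m0 I) = 0)
  (he : forall i, evt (fun t => `|e i t| <= Ce * \sum_k ev (h k) (X t) ^+ 2)).

Let H k t := ev (h k) (X t).

Lemma err_of_h K1 : (forall k, small K1 (H k)) -> forall i, small (K1 + K1) (e i).
Proof.
move=> hs i; apply: (@small_ext _ _ (fun t => Ce * \sum_k H k t ^+ 2)).
  by apply: evtW (he i) => t h1; apply: le_trans h1 (ler_norm _).
by apply: smallZ; apply: small_sum => k; apply: smallM; exact: hs.
Qed.

Lemma h_small0 k : small rate (H k).
Proof.
have [r [M [r0 M0 hT]]] := cvps_taylor (hh k).
have hr : near0 (inball (fun _ : I => r)) by exists r.
apply: (@small_ext _ _ (fun t => M * \sum_i `|X t i|)).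
  apply: evtW (evt_near0 hr) => t ht.
  have s0 : 0 <= \sum_i `|X t i| by apply: sumr_ge0.
  have b0 : inball (fun _ : I => r) (fun=> 0) by move=> i; rewrite normr0 ltW.
  have [i|_] := hT (fun=> 0) (X t) _ s0 b0 ht.
    by rewrite subr0 (bigD1 i) //= lerDl sumr_ge0.
  by rewrite ev0 h0 subr0 => h1; apply: le_trans h1 (ler_norm _).
apply: smallZ; apply: small_sum => i; apply: small_ext (hX i).
by exists 0 => t _; rewrite normr_id.
Qed.

Hypothesis nodef : forall k K1, ~ big K1 (H k) /\ ~ big K1 (fun t => - H k t).

(** If all the [h k] decay at a rate [mu], the error terms decay at the rate [2 mu];
    [negl_or_signed_ev], whose definite signs are excluded, then improves the rate of the [h k]
    to any number below [2 mu]. The factor 3/2 leaves some room. *)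
Lemma h_sexp k : sexp (H k).
Proof.
have step n : forall k, small ((3 / 2) ^+ n * rate) (H k).
  elim: n => [|n IH] {}k; first by rewrite expr0 mul1r; exact: h_small0.
  set mu := (3 / 2) ^+ n * rate in IH.
  have mu0 : 0 < mu by rewrite mulr_gt0 // exprn_gt0.
  have hes K1 : K1 < mu + mu -> forall i, small K1 (e i).
    by move=> /ltW hK i; apply: small_le hK _; exact: err_of_h.
  have -> : (3 / 2) ^+ n.+1 * rate = 3 / 2 * mu by rewrite exprS mulrA.
  case: (negl_or_signed_ev hes (hh k)) => [hs|[K1 _ hb]|[K1 _ hb]].
  - by apply: hs; lra.
  - by case: (nodef k K1).1.
  - by case: (nodef k K1).2.
move=> K; pose n := Num.bound (2 * `|K| / rate).
apply: small_le (step n k).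
have bern : n%:R / 2 <= (3 / 2) ^+ n :> R.
  suff : 1 + n%:R / 2 <= (3 / 2) ^+ n :> R by lra.
  elim: (n) => [|l IH]; first by rewrite mul0r addr0 expr0.
  have l0 : 0 <= l%:R :> R by [].
  rewrite exprS -natr1; nra.
have hn : 2 * `|K| / rate < n%:R.
  by apply: archi_boundP; rewrite divr_ge0 ?mulr_ge0 // ltW.
rewrite ltr_pdivrMr // in hn.
have hK := ler_norm K; have := ler_wpM2r (ltW rate0) bern; lra.
Qed.

Let P c := cvps c /\ sexp (fun t => ev c (X t)).

(** Power series that are superexponentially small along [X] form an ideal. *)
Let Pgen : exists (n : nat) (g : 'I_n -> mindex I -> R), (forall j, P (g j)) /\
  forall f, P f -> exists q : 'I_n -> mindex I -> R, (forall j, cvps (q j)) /\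
    f = (fun al => \sum_j cmul (q j) (g j) al).
Proof.
apply: cvps_noetherian => [c []//|c d [hc cs] [hd' ds]|q c hq [hc cs]].
  split; first by apply: cvpsD => //; exact: cvpsZ.
  move=> K; have A := evt_near0 (near0I (near0_evD hc (cvpsZ (-1) hd')) (near0_evZ (-1) hd')).
  apply: small_ext (smallD (cs K) (smallZ (-1) (ds K))).
  by apply: evtW A => t [-> ->].
split; first exact: cvpsM.
move=> K; have [C hC] := ev_bnd hq; apply: small_ext (small_bnd hC (cs K)).
by apply: evtW (evt_near0 (near0_evM hq hc)) => t ->.
Qed.

(** If [Lop c] had a definite sign along [X], so would [c], by [step_big] with [l = 0]; but [c]
    is superexponentially small. *)
Let PL c : P c -> P (Lop c).
Proof.
move=> [hc cs]; split; first exact: cvps_Lop.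
have es : forall K, forall i, small K (e i).
  move=> K i; have -> : K = K / 2 + K / 2 by lra.
  by apply: err_of_h => k; exact: h_sexp.
have esum K : small K (fun t => \sum_i ev (cder i c) (X t) * e i t).
  by apply: (@err_small (K + 1)) => //; rewrite ltrDl.
have nb1 (K2 : R) (f : R -> R) : sexp f -> big K2 f -> False.
  by move=> fs fb; apply: (small_big_absurd _ (fs (K2 + 1)) fb); rewrite ltrDl.
move=> K; have esK : forall K1, K1 < K + 1 -> forall i, small K1 (e i) by [].
case: (negl_or_signed_ev esK (cvps_Lop hc)) => [hs|[K1 K1K hb]|[K1 K1K hb]].
- by apply: hs; rewrite ltrDl.
- have dd : ddt (fun t => ev c (X t)) (fun t => - 0 * ev c (X t) + ev (Lop c) (X t) +
      \sum_i ev (cder i c) (X t) * e i t).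
    by apply: evtW (ddt_ev hc) => t; rewrite oppr0 mul0r add0r.
  have [K2 _ [b|b]] := step_big K1K hb (esum _) dd; first by case: (nb1 _ _ cs b).
  by case: (nb1 K2 (fun t => - ev c (X t))) => // K3; exact: smallN.
have dd : ddt (fun t => - ev c (X t)) (fun t => - 0 * - ev c (X t) + - ev (Lop c) (X t) +
    - \sum_i ev (cder i c) (X t) * e i t).
  apply: evtW (ddtN (ddt_ev hc)) => t hh1; apply: (is_derive_congr hh1) => //.
  by ring.
have [K2 _ [b|b]] := step_big K1K hb (smallN (esum _)) dd.
  by case: (nb1 K2 (fun t => - ev c (X t))) => // K3; exact: smallN.
case: (nb1 K2 (fun t => - - ev c (X t))) => // K3; do 2 apply: smallN; exact: cs.
Qed.

(** The generators [g] of the ideal dominate all its elements, in particular the [h k], hence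
    the error terms, and the [Lop (g j)]. So the sum [G] of their squares along [X] has a
    derivative bounded by a multiple of [G], and is superexponentially small. *)
Lemma h_eq0 k : evt (fun t => H k t = 0).
Proof.
have [n [g [gP gen]]] := Pgen.
pose S t := \sum_j `|ev (g j) (X t)|.
have S0 t : 0 <= S t by apply: sumr_ge0.
have dom f : P f -> exists2 C, 0 <= C & evt (fun t => `|ev f (X t)| <= C * S t).
  move=> /gen [q [hq fE]].
  have /boolp.choice [C hC] := fun j => ev_bnd (hq j).
  have A1 := evt_near0 (near0_evS (index_enum 'I_n) (fun j => cvpsM (hq j) (gP j).1)).
  have A2 := evt_near0 (near0_all (fun j => near0_evM (hq j) (gP j).1)).
  exists (\sum_j `|C j|); first exact: sumr_ge0.
  apply: evtW (evtI (evtI A1 A2) (evt_all hC)) => t [[a1 a2] a3].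
  rewrite fE a1; apply: le_trans (ler_norm_sum _ _ _) _.
  rewrite /S mulr_sumr; apply: ler_sum => j _; rewrite a2 normrM ler_wpM2r //.
  apply: le_trans (a3 j) _; apply: le_trans (ler_norm _) _.
  by rewrite (bigD1 j) //= lerDl sumr_ge0.
have hP k' : P (h k') by split; [exact: hh|exact: h_sexp].
have [Ch Ch0 hCh] := dom _ (hP k).
suff : evt (fun t => S t = 0).
  move=> hS; apply: evtW (evtI hCh hS) => t [a b].
  by apply/eqP; rewrite -normr_le0 /H; apply: le_trans a _; rewrite b mulr0.
pose G t := \sum_j ev (g j) (X t) ^+ 2.
suff : evt (fun t => G t = 0).
  apply: evtW => t /eqP; rewrite /G psumr_eq0 => [/allP z|j _]; last exact: sqr_ge0.
  apply: big1 => j _; have := z j (mem_index_enum j); rewrite sqrf_eq0 => /eqP ->.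
  exact: normr0.
have SG t : S t ^+ 2 <= (n * n)%:R * G t.
  rewrite expr2 /S mulr_suml.
  have gle j : ev (g j) (X t) ^+ 2 <= G t.
    by rewrite /G (bigD1 j) //= lerDl sumr_ge0 // => i _; exact: sqr_ge0.
  apply: (@le_trans _ _ (\sum_(j < n) \sum_(l < n) G t)).
    apply: ler_sum => j _; rewrite mulr_sumr; apply: ler_sum => l _.
    have a := gle j; have b := gle l.
    rewrite -(real_normK (num_real (ev (g j) (X t)))) in a.
    rewrite -(real_normK (num_real (ev (g l) (X t)))) in b.
    have := sqr_ge0 (`|ev (g j) (X t)| - `|ev (g l) (X t)|); lra.
  by rewrite !sumr_const !card_ord -mulrnA mulr_natl.
have hPall := fun k' => dom _ (hP k').
have /boolp.choice [Dh hDh] : forall k', exists C, 0 <= C /\ evt (fun t => `|H k' t| <= C * S t).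
  by move=> k'; have [C C0 hC] := hPall k'; exists C.
have /boolp.choice [DL hDL] : forall j, exists C, 0 <= C /\ evt (fun t => `|ev (Lop (g j)) (X t)| <= C * S t).
  by move=> j; have [C C0 hC] := dom _ (PL (gP j)); exists C.
have /boolp.choice [B hB] : forall ij : I * 'I_n, exists C, evt (fun t => `|ev (cder ij.1 (g ij.2)) (X t)| <= C).
  by move=> [i j]; apply: ev_bnd; exact: cvps_der (gP j).1.
have hH1 k' : evt (fun t => `|H k' t| <= 1).
  have [C [C0 hC]] := small_evt0 (h_small0 k').
  have p : 0 < 1 / C by rewrite divr_gt0.
  apply: evtW (evtI hC (evt_expRN rate0 p)) => t [[t0 a] b]; apply: le_trans a _.
  by rewrite mulrC; apply: ltW; rewrite -ltr_pdivlMr.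
pose E := `|Ce| * \sum_k' Dh k'.
have Dh0 : 0 <= \sum_k' Dh k' by apply: sumr_ge0 => k' _; case: (hDh k').
have E0 : 0 <= E by rewrite mulr_ge0.
have A1 : evt (fun t => forall i, `|e i t| <= E * S t).
  have a := evt_all (fun k' => evtI (hH1 k') (hDh k').2).
  apply: evtW (evtI (evt_all he) a) => t [b c] i; apply: le_trans (b i) _.
  rewrite /E -mulrA; apply: (@le_trans _ _ (`|Ce| * \sum_k' H k' t ^+ 2)).
    rewrite ler_wpM2r ?ler_norm // sumr_ge0 // => k' _; exact: sqr_ge0.
  rewrite ler_wpM2l // mulr_suml; apply: ler_sum => k' _; have [c1 c2] := c k'.
  by apply: le_trans c2; rewrite -(real_normK (num_real _)) expr2 ler_piMl.
pose F := \sum_j (DL j + \sum_i `|B (i, j)| * E).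
have F0j j : 0 <= DL j + \sum_i `|B (i, j)| * E.
  by rewrite addr_ge0 ?(hDL j).1 // sumr_ge0 // => i _; rewrite mulr_ge0.
have dd := evt_all (fun j => ddt_ev (gP j).1).
have [T hT] := evtI (evtI (evt_all (fun j => (hDL j).2)) (evt_all hB)) (evtI A1 dd).
exists T; apply: (@sexp_gronwall_eq0 _ (2 * F * (n * n)%:R) T G (fun t =>
    \sum_j 2 * ev (g j) (X t) * (ev (Lop (g j)) (X t) + \sum_i ev (cder i (g j)) (X t) * e i t))).
- move=> t /hT [_ [_ ddt']].
  have hsum (s : seq 'I_n) : is_derive t (1 : R) (fun t => \sum_(j <- s) ev (g j) (X t) ^+ 2)
      (\sum_(j <- s) 2 * ev (g j) (X t) *
        (ev (Lop (g j)) (X t) + \sum_i ev (cder i (g j)) (X t) * e i t)).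
    elim: s => [|j s IH].
      by apply: (is_derive_congr (is_derive_cst 0 t 1)) => [u|]; rewrite big_nil.
    apply: (is_derive_congr (is_deriveD (is_deriveM (ddt' j) (ddt' j)) IH)) => [u|].
      by rewrite big_cons.
    by rewrite big_cons /GRing.scale /=; congr (_ + _); ring.
  exact: hsum.
- move=> t /hT [[b1 b2] [b3 _]].
  rewrite lerNl; apply: le_trans (ler_norm _) _; rewrite normrN.
  apply: le_trans (ler_norm_sum _ _ _) _.
  apply: (@le_trans _ _ (\sum_j 2 * S t * ((DL j + \sum_i `|B (i, j)| * E) * S t))).
    apply: ler_sum => j _; rewrite !normrM (@ger0_norm _ 2) // -!mulrA ler_wpM2l //.
    apply: ler_pM => //; first by rewrite /S (bigD1 j) //= lerDl sumr_ge0.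
    apply: le_trans (ler_normD _ _) _; rewrite mulrDl; apply: lerD; first exact: b1.
    apply: le_trans (ler_norm_sum _ _ _) _; rewrite mulr_suml; apply: ler_sum => i _.
    rewrite normrM -mulrA; apply: ler_pM => //.
    by apply: le_trans (b2 (i, j)) _; exact: ler_norm.
  rewrite -mulr_sumr -mulr_suml -/F.
  have -> : 2 * S t * (F * S t) = 2 * F * S t ^+ 2 by ring.
  rewrite -[leRHS]mulrA ler_wpM2l // mulr_ge0 // /F; exact: sumr_ge0.
- by move=> t _; apply: sumr_ge0 => j _; exact: sqr_ge0.
move=> K; apply: small_sum => j; have -> : K = K / 2 + K / 2 by lra.
by apply: smallM; exact: (gP j).2.
Qed.

End conclusion.

(** Unless one of the [h k] has a definite sign along [X], all of them are superexponentially
    small by [h_sexp], hence zero by [h_eq0]. *)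
Theorem definite_or_zero (m : nat) (h : 'I_m -> mindex I -> R) (Ce : R) :
  (forall k, cvps (h k)) -> (forall k, h k (m0 I) = 0) ->
  (forall i, evt (fun t => `|e i t| <= Ce * \sum_k ev (h k) (X t) ^+ 2)) ->
  (exists k, evt (fun t => 0 < ev (h k) (X t)) \/ evt (fun t => ev (h k) (X t) < 0)) \/
  (forall k, evt (fun t => ev (h k) (X t) = 0)).
Proof.
move=> hh h0 he; rewrite -implyNp => /forallNP nk.
apply: (h_eq0 hh h0 he) => k K1; split => -[c c0 hc]; apply: (nk k); [left|right].
  by apply: evtW hc => t; apply: lt_le_trans; rewrite mulr_gt0 // expR_gt0.
by apply: evtW hc => t; rewrite -oppr_gt0; apply: lt_le_trans; rewrite mulr_gt0 // expR_gt0.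
Qed.

End core.

(** * Polyhedra and their bad half spaces along a curve *)

Section geometry_basics.
Variable R : realType.

Lemma sqr_sum_le (T : Type) (s : seq T) (f : T -> R) :
  (\sum_(k <- s) f k) ^+ 2 <= 2 ^+ size s * \sum_(k <- s) f k ^+ 2.
Proof.
elim: s => [|k s IH]; first by rewrite !big_nil expr0n mulr0.
rewrite !big_cons /= (exprS 2); set S := \sum_(_ <- s) _ in IH *.
set Q := \sum_(_ <- s) _ in IH *; set m := 2 ^+ _ in IH *.
have m1 : 1 <= m by apply: exprn_ege1; rewrite ler1n.
have := sqr_ge0 (f k - S); have : f k ^+ 2 <= m * f k ^+ 2 by rewrite ler_peMl ?sqr_ge0.
lra.
Qed.

(** The supremum of the points up to which the inequality holds has it too, by continuity, and
    cannot be less than [b]. *)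
Lemma lip_of_local (u : R -> R) (a b L : R) : a <= b ->
  (forall s, a <= s <= b -> {for s, continuous u}) ->
  (forall s, a <= s < b -> exists2 d, 0 < d &
     forall s', s <= s' < s + d -> `|u s' - u s| <= L * (s' - s)) ->
  `|u b - u a| <= L * (b - a).
Proof.
move=> ab uc ul; pose S := [set s | a <= s <= b /\ `|u s - u a| <= L * (s - a)].
have Sa : S a by split; rewrite ?lexx // !subrr normr0 mulr0.
have hS : has_sup S by split; [exists a|exists b => s [/andP[]]].
set c := sup S.
have ac : a <= c by apply: ub_le_sup => //; case: hS.
have cb : c <= b by apply: ge_sup; [exists a|move=> s [/andP[]]].
have Sc : S c.
  split; first by rewrite ac.
  apply/ler_addgt0Pl => e e0.
  pose k := e / (2 * (`|L| + 1)).
  have k0 : 0 < k by rewrite divr_gt0 // mulr_gt0 // ltr_wpDl.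
  have e20 : 0 < e / 2 by rewrite divr_gt0.
  have /cvgrPdist_le /(_ _ e20) /nbhs_ballP [d d0 hd] := uc c (introT andP (conj ac cb)).
  have m0 : 0 < Num.min d k by rewrite lt_min d0.
  have [s [/andP[as_ sb] hs] cs] := sup_adherent m0 hS; rewrite -/c in cs.
  have sc : s <= c by apply: ub_le_sup; [case: hS|split; rewrite ?as_].
  have h1 : `|u c - u s| <= e / 2.
    apply: hd; rewrite /ball /= ger0_norm ?subr_ge0 //.
    have : Num.min d k <= d by rewrite ge_min lexx.
    lra.
  have mk : Num.min d k <= k by rewrite ge_min lexx orbT.
  have h2 : c - s <= k by lra.
  have h3 : L * (s - a) <= L * (c - a) + e / 2.
    have : `|L| * (c - s) <= e / 2.
      apply: (@le_trans _ _ (`|L| * k)); first by rewrite ler_wpM2l.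
      rewrite /k mulrA ler_pdivrMr; last by rewrite mulr_gt0 // ltr_wpDl.
      have := normr_ge0 L; nra.
    have := ler_norm (- L); rewrite normrN => hL.
    have : - L * (c - s) <= `|L| * (c - s) by rewrite ler_wpM2r // subr_ge0.
    lra.
  have -> : u c - u a = (u c - u s) + (u s - u a) by ring.
  apply: le_trans (ler_normD _ _) _; lra.
have [cb'|bc] := ltrP c b; last first.
  have -> : b = c by apply/eqP; rewrite eq_le bc cb.
  by case: Sc.
have [|d d0 hd] := ul c; first by rewrite ac.
pose s := Num.min b (c + d / 2).
have cs : c < s by rewrite /s lt_min cb' ltrDl divr_gt0.
have sd : s < c + d by rewrite /s gt_min; apply/orP; right; rewrite ltrD2l; lra.
have sb : s <= b by rewrite /s ge_min lexx.
suff : S s.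
  move=> Ss; have : s <= c by apply: ub_le_sup => //; case: hS.
  by rewrite leNgt cs.
split; first by rewrite sb (le_trans ac (ltW cs)).
have -> : u s - u a = (u s - u c) + (u c - u a) by ring.
apply: le_trans (ler_normD _ _) _.
have := hd s; rewrite (ltW cs) sd => /(_ isT).
by case: Sc => _; lra.
Qed.

Lemma derive_right_eq (f g : R -> R) t a b d : 0 < d ->
  is_derive t (1 : R) f a -> is_derive t (1 : R) g b ->
  (forall s, t <= s < t + d -> f s = g s) -> a = b.
Proof.
move=> d0 hf hg fg; apply/eqP; rewrite -subr_eq0 -normr_le0.
apply/ler_addgt0Pl => e e0; rewrite addr0.
have e20 : 0 < e / 2 by rewrite divr_gt0.
have /nbhs_ballP [r r0 h1] := eps_is_derive hf e20.
have /nbhs_ballP [r' r0' h2] := eps_is_derive hg e20.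
pose m := Num.min d (Num.min r r').
have m0 : 0 < m by rewrite !lt_min d0 r0.
have [md [mr mr']] : m <= d /\ m <= r /\ m <= r'.
  by rewrite /m !ge_min !lexx !orbT.
pose s := t + m / 2.
have st : s - t = m / 2 by rewrite /s addrAC subrr add0r.
have fs : f s = g s by apply: fg; rewrite /s lerDl ltrD2l; apply/andP; split; lra.
have ft : f t = g t by apply: fg; rewrite lexx ltrDl.
have hb q : m <= q -> ball t q s.
  by move=> mq; rewrite /ball /= -normrN opprB st gtr0_norm; lra.
have := h1 s (hb _ mr); have := h2 s (hb _ mr').
rewrite /= fs ft st (@gtr0_norm _ (m / 2)) ?divr_gt0 // => k2 k1.
have : `|(a - b) * (m / 2)| <= e * (m / 2).
  have -> : (a - b) * (m / 2) = (g s - g t - b * (m / 2)) - (g s - g t - a * (m / 2)) by ring.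
  by apply: le_trans (ler_normB _ _) _; lra.
by rewrite normrM (@gtr0_norm _ (m / 2)) ?divr_gt0 // ler_pM2r // divr_gt0.
Qed.

Lemma germ_C2 (I : finType) (v : (I -> R) -> R) : germ v ->
  exists (g : I -> (I -> R) -> R) (r L : R), [/\ 0 < r, 0 <= L &
   forall x y (e : R), 0 <= e -> inball (fun=> r) x -> inball (fun=> r) y ->
   (forall i, `|y i - x i| <= e) ->
   `|v y - v x - \sum_i g i x * (y i - x i)| <= L * e ^+ 2 /\
   forall i, `|g i y - g i x| <= L * e].
Proof.
move=> hv; have [g [r [M [r0 M0 hg hT]]]] := germ_taylor hv.
have /boolp.choice [rM hrM] : forall i, exists rM : R * R, [/\ 0 < rM.1, 0 <= rM.2 &
   forall x y (e : R), 0 <= e -> inball (fun=> rM.1) x -> inball (fun=> rM.1) y ->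
   (forall i, `|y i - x i| <= e) -> `|g i y - g i x| <= rM.2 * e].
  move=> i; have [g' [r' [M' [r0' M0' _ hT']]]] := germ_taylor (hg i).
  by exists (r', M'); split => // x y e e0 hx hy he; case: (hT' x y e e0 hx hy he).
pose r1 := \big[Num.min/r]_(i : I) (rM i).1.
have r10 : 0 < r1.
  rewrite /r1; elim/big_ind: _ => // [a b|i _]; first by rewrite lt_min => -> ->.
  by case: (hrM i).
have r1r : r1 <= r.
  by rewrite /r1; elim/big_rec: _ => // i x _ xr; rewrite ge_min xr orbT.
have r1i i : r1 <= (rM i).1 by rewrite /r1 (bigD1 i) //= ge_min lexx.
have S0 : 0 <= \sum_i (rM i).2 by apply: sumr_ge0 => i _; case: (hrM i).
exists g, r1, (M + \sum_i (rM i).2); split => //; first by rewrite addr_ge0.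
move=> x y e e0 hx hy he; split.
  have [|||h _] := hT x y e e0; [exact: inballW hx|exact: inballW hy|exact: he|].
  by apply: le_trans h _; rewrite ler_wpM2r ?sqr_ge0 // lerDl.
move=> i; have [_ _ h] := hrM i.
apply: le_trans (h x y e e0 _ _ he) _; [exact: inballW hx|exact: inballW hy|].
rewrite ler_wpM2r // (bigD1 i) //=.
have : 0 <= \sum_(j | j != i) (rM j).2 by apply: sumr_ge0 => j _; case: (hrM j).
by move: (\sum_(j | _) _) => q; have := M0; lra.
Qed.

Lemma avoid_pos (s : seq R) : exists2 d : R, 0 < d & d \notin s.
Proof.
suff [d d0 h] : exists2 d : R, 0 < d & forall x, x \in s -> x < d.
  by exists d => //; apply/negP => /h; rewrite ltxx.
elim: s => [|x s [d d0 IH]]; first by exists 1.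
exists (Num.max d (x + 1)); first by rewrite lt_max d0.
move=> z; rewrite in_cons => /predU1P[->|/IH zd]; rewrite lt_max ?zd //.
by rewrite [x < x + 1]ltrDl ltr01 orbT.
Qed.

End geometry_basics.

Section geometry.
Variables (R : realType) (n : nat).
Implicit Types (a x e : 'rV[R]_n).

Definition dot a x : R := \sum_(i < n) a 0 i * x 0 i.

Lemma dotD a x e : dot a (x + e) = dot a x + dot a e.
Proof. by rewrite /dot -big_split; apply: eq_bigr => i _; rewrite mxE mulrDr. Qed.

Lemma dotZ a x k : dot a (k *: x) = k * dot a x.
Proof. by rewrite /dot mulr_sumr; apply: eq_bigr => i _; rewrite mxE mulrCA. Qed.

Lemma dotB a x e : dot a (x - e) = dot a x - dot a e.
Proof. by rewrite -scaleN1r dotD dotZ mulN1r. Qed.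

Definition eclose r x e := forall l, `|x 0 l - e 0 l| <= r.

Lemma nbhs_close p (P : set 'rV[R]_n) : nbhs p P ->
  exists2 r, 0 < r & forall x, eclose r x p -> P x.
Proof.
move=> /nbhs_ballP [r r0 h]; exists (r / 2); first by rewrite divr_gt0.
move=> x hx; apply: h; split => // i j; rewrite ord1 /ball /= distrC.
by apply: le_lt_trans (hx j) _; rewrite ltr_pdivrMr // ltr_pMr // ltr1n.
Qed.

Lemma dot_close a (k : R) : 0 < k -> exists2 r, 0 < r &
  forall x e, eclose r x e -> `|dot a x - dot a e| <= k.
Proof.
move=> k0; pose S := \sum_i `|a 0 i|.
have S0 : 0 < S + 1 by rewrite ltr_wpDl // sumr_ge0.
exists (k / (S + 1)); first by rewrite divr_gt0.
move=> x e h; rewrite -dotB; apply: le_trans (ler_norm_sum _ _ _) _.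
apply: (@le_trans _ _ (S * (k / (S + 1)))).
  rewrite /S mulr_suml; apply: ler_sum => i _; rewrite normrM ler_wpM2l //.
  by have := h i; rewrite !mxE.
by rewrite mulrA ler_pdivrMr // mulrC ler_wpM2l ?(ltW k0) // lerDl.
Qed.

Variables (I : finType) (hs : I -> seq ('rV[R]_n * R)) (y : R -> 'rV[R]_n).
Definition polyh i : set 'rV[R]_n := [set x | forall ab, ab \in hs i -> ab.2 <= dot ab.1 x].
Definition slack (ab : 'rV[R]_n * R) s : R := dot ab.1 (y s) - ab.2.

Definition sgnconst (f : R -> R) : Prop :=
  [\/ evt (fun s => 0 < f s), evt (fun s => f s < 0) | evt (fun s => f s = 0)].

Definition allhs : seq ('rV[R]_n * R) := flatten [seq hs i | i <- enum I].

Lemma allhsP i ab : ab \in hs i -> ab \in allhs.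
Proof. by move=> h; apply/flattenP; exists (hs i) => //; apply: map_f; rewrite mem_enum. Qed.

Lemma evt_seq (T : eqType) (r : seq T) (P : T -> R -> Prop) :
  (forall k, k \in r -> evt (P k)) -> evt (fun s => forall k, k \in r -> P k s).
Proof.
elim: r => [|k r IH] h; first by exists 0.
have h1 : evt (fun s => forall z, z \in r -> P z s).
  by apply: IH => z zr; apply: h; rewrite in_cons zr orbT.
have h2 : evt (P k) by apply: h; rewrite in_cons eqxx.
apply: evtW (evtI h2 h1) => s [hk hr] z; rewrite in_cons => /predU1P[->//|]; exact: hr.
Qed.

(** At late times the sign of each slack is the final one, so a polyhedron that contains the
    curve at one such time contains it at all later times. *)
Lemma one_piece : evt (fun s => exists i, polyh i (y s)) ->
  (forall ab, ab \in allhs -> sgnconst (slack ab)) -> exists j, evt (fun s => polyh j (y s)).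
Proof.
move=> hc hsg.
have h1 : evt (fun s => forall ab, ab \in allhs -> 0 <= slack ab s -> evt (fun s => 0 <= slack ab s)).
  apply: evt_seq => ab /hsg [h|h|h].
  - by exists 0 => t _ _; apply: evtW h => s /ltW.
  - by apply: evtW h => s h1 h2; move: h1; rewrite ltNge h2.
  - by exists 0 => t _ _; apply: evtW h => s ->.
have [s _ [[j hj] h]] := evt_ex 0 (evtI hc h1).
exists j; apply: evt_seq => ab abj.
have : 0 <= slack ab s by rewrite /slack subr_ge0; exact: hj.
move/(h ab (allhsP abj)); apply: evtW => t; by rewrite /slack subr_ge0.
Qed.

Variable p : 'rV[R]_n.
Hypothesis hy : forall r, 0 < r -> evt (fun s => eclose r (y s) p).

(** The half spaces that obstruct [one_piece]. Their boundaries pass through the limit point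
    ([badhs_p]). *)
Definition badhs : seq ('rV[R]_n * R) := [seq ab <- allhs | ~~ `[< sgnconst (slack ab) >]].

Lemma badhsP ab : ab \in badhs -> ab \in allhs /\ ~ sgnconst (slack ab).
Proof. by rewrite mem_filter => /andP[/asboolPn]. Qed.

Lemma slack_cvg ab k : 0 < k -> evt (fun s => `|slack ab s - (dot ab.1 p - ab.2)| <= k).
Proof.
move=> k0; have [r r0 h] := dot_close ab.1 k0; apply: evtW (hy r0) => s /h.
by rewrite /slack; have -> : dot ab.1 (y s) - ab.2 - (dot ab.1 p - ab.2) = dot ab.1 (y s) - dot ab.1 p by ring.
Qed.

Lemma badhs_p ab : ab \in badhs -> dot ab.1 p = ab.2.
Proof.
move=> /badhsP [_ nc]; apply/eqP; rewrite -subr_eq0; apply: contra_notT nc => nz.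
have k0 : 0 < `|dot ab.1 p - ab.2| / 2 by rewrite divr_gt0 // normr_gt0.
have h := slack_cvg ab k0; have [neg|pos] := ltrP (dot ab.1 p - ab.2) 0.
  apply: Or32; apply: evtW h => s; rewrite (ltr0_norm neg) ler_norml => /andP[]; lra.
have {}pos : 0 < dot ab.1 p - ab.2 by rewrite lt_neqAle eq_sym nz.
apply: Or31; apply: evtW h => s; rewrite (gtr0_norm pos) ler_norml => /andP[]; lra.
Qed.

(** Seen from [p], the direction [e] lies on the same side of the well-behaved hyperplanes as
    the curve. *)
Definition compatible e : Prop := forall ab, ab \in allhs -> dot ab.1 p = ab.2 ->
  [/\ evt (fun s => 0 < slack ab s) -> 0 < dot ab.1 e,
     evt (fun s => slack ab s < 0) -> dot ab.1 e < 0 &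
     evt (fun s => slack ab s = 0) -> dot ab.1 e = 0].

Lemma compatibleD e e' k : 0 < k -> compatible e -> compatible e' -> compatible (e + k *: e').
Proof.
move=> k0 ge ge' ab abs abp; have [h1 h2 h3] := ge ab abs abp.
have [h1' h2' h3'] := ge' ab abs abp; rewrite dotD dotZ; split => h.
- by rewrite addr_gt0 ?h1 // mulr_gt0 // h1'.
- by rewrite -oppr_gt0 opprD addr_gt0 ?oppr_gt0 ?h2 // pmulr_rlt0 // h2'.
- by rewrite h3 // h3' // mulr0 addr0.
Qed.

Lemma compatible_y : evt (fun s => compatible (y s - p)).
Proof.
have : evt (fun s => forall ab, ab \in allhs -> [/\ evt (fun s => 0 < slack ab s) -> 0 < slack ab s,
     evt (fun s => slack ab s < 0) -> slack ab s < 0 &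
     evt (fun s => slack ab s = 0) -> slack ab s = 0]).
  apply: evt_seq => ab _.
  have imp (P : R -> Prop) : evt (fun s => evt P -> P s).
    have [h|h] := pselect (evt P); first by apply: (evtW _ h) => s.
    by exists 0 => s _ ?; case: h.
  apply: evtW (evtI (imp (fun s => 0 < slack ab s)) (evtI (imp (fun s => slack ab s < 0))
    (imp (fun s => slack ab s = 0)))) => s [h1 [h2 h3]]; by split.
apply: evtW => s h ab abs abp; have := h ab abs.
by rewrite /slack -abp dotB.
Qed.

(** The curve itself supplies compatible directions, and one that is not parallel to a given bad
    hyperplane, because the slack of a bad half space is not eventually zero. Positive
    combinations stay compatible; a generic coefficient avoids the remaining bad hyperplanes. *)
Lemma transversal_direction : exists2 e, compatible e & forall ab, ab \in badhs -> dot ab.1 e != 0.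
Proof.
have [s0 _ g0] := evt_ex 0 compatible_y.
have hb : forall ab, ab \in badhs -> ab \in badhs by [].
move: {1 3}badhs hb => r; elim: r => [|ab r IH] hr; first by exists (y s0 - p).
have [|e ge ne] := IH; first by move=> ab' h; apply: hr; rewrite in_cons h orbT.
have abb : ab \in badhs by apply: hr; rewrite in_cons eqxx.
have [z|nz] := eqVneq (dot ab.1 e) 0; last first.
  exists e; first exact: ge.
  move=> ab'; rewrite in_cons => /predU1P[->|h]; first exact: nz.
  exact: ne.
have [s [gs Fs]] : exists s, compatible (y s - p) /\ slack ab s != 0.
  have [_ nc] := badhsP abb.
  apply: contrapT => /forallNP hno; apply: nc; apply: Or33.
  by apply: evtW compatible_y => s gs; apply/eqP/negPn/negP => nz; apply: (hno s).
have [k k0 kn] := avoid_pos [seq - dot ab'.1 e / dot ab'.1 (y s - p) | ab' <- r].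
exists (e + k *: (y s - p)); first exact: compatibleD.
move=> ab'; rewrite in_cons dotD dotZ => /predU1P[->|abr].
  by rewrite z add0r mulf_eq0 negb_or gt_eqF //= dotB (badhs_p abb).
apply: contra kn => /eqP h; apply/mapP; exists ab' => //.
have d0 : dot ab'.1 (y s - p) != 0.
  by apply: contraNneq (ne _ abr) => d0; rewrite -h d0 mulr0 addr0.
by rewrite -[LHS](mulfK d0); congr (_ / _); lra.
Qed.

End geometry.

(** * Comparing the field with one of its analytic pieces *)

Lemma cvg_sum_real (R : realType) (T : Type) (Fl : set_system T) (J : Type) (r : seq J)
  (f : J -> T -> R) (l : J -> R) : Filter Fl -> (forall k, f k @ Fl --> l k) ->
  (fun s => \sum_(k <- r) f k s) @ Fl --> \sum_(k <- r) l k.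
Proof.
move=> FF h; elim: r => [|k r IH].
  rewrite big_nil (_ : (fun s => _) = (fun=> 0)); first exact: cvg_cst.
  by apply/funext => s; rewrite big_nil.
rewrite big_cons (_ : (fun s => _) = (fun s => f k s + \sum_(j <- r) f j s)).
  exact: cvgD.
by apply/funext => s; rewrite big_cons.
Qed.

Definition rel_coord (R : realType) (n : nat) (p x : 'rV[R]_n) : 'I_n -> R :=
  fun l => x 0 l - p 0 l.

Section bound.
Variables (R : realType) (n : nat) (U : set 'rV[R]_n) (V : 'rV[R]_n -> 'rV[R]_n).
Hypotheses (hU : open U) (hV : C1_on V U).
Implicit Types (x e : 'rV[R]_n).

Lemma close_nbhs (p : 'rV[R]_n) (P : set 'rV[R]_n) (r : R) : 0 < r ->
  (forall x, eclose r x p -> P x) -> nbhs p P.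
Proof.
move=> r0 h; apply/nbhs_ballP; exists r => // x [_ hx]; apply: h => l.
by rewrite distrC; apply: ltW; exact: (hx 0 l).
Qed.

Lemma line_cont (x e : 'rV[R]_n) : continuous (fun t : R => x + t *: e).
Proof.
by move=> t; apply: cvgD; [exact: cvg_cst|apply: cvgZ; [exact: cvg_id|exact: cvg_cst]].
Qed.

Lemma line_derive x e t j : U (x + t *: e) ->
  is_derive t (1 : R) (fun t => V (x + t *: e) 0 j) ((e *m jacobian V (x + t *: e)) 0 j).
Proof.
move=> Ux; apply: is_derive_cvg; set x0 := x + t *: e.
have df : differentiable V x0 by apply: hV.1.
have h : (fun h => h^-1 *: (V (h *: e + x0) - V x0)) @ 0^' --> 'D_e V x0 by exact: diff_derivable.
rewrite deriveE // in h.
have {h} := continuous_cvg _ (@coord_continuous R 1 n 0 j ('d V x0 e)) h.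
rewrite mul_rV_lin1 => h.
suff -> : (fun s => s^-1 *: (V (x + (s *: (1 : R) + t) *: e) 0 j - V x0 0 j)) =
  (fun h => (h^-1 *: (V (h *: e + x0) - V x0)) 0 j) by exact: h.
apply/funext => s; have -> : s *: (1 : R) = s by rewrite /GRing.scale /= mulr1.
by rewrite !mxE /x0 scalerDl [x + (_ + _)]addrCA.
Qed.

Lemma line_jac_cont x e t j : U (x + t *: e) ->
  {for t, continuous (fun t : R => (e *m jacobian V (x + t *: e)) 0 j : R)}.
Proof.
move=> Ux; have jc : {for (x + t *: e), continuous (jacobian V)}.
  by have := hV.2; rewrite continuous_open_subspace // => h; apply: h; rewrite inE.
have -> : (fun t : R => (e *m jacobian V (x + t *: e)) 0 j) =
    (fun t : R => \sum_k e 0 k * jacobian V (x + t *: e) k j).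
  by apply/funext => s; rewrite mxE.
have h : jacobian V (x + s *: e) @[s --> t] --> jacobian V (x + t *: e).
  by apply: continuous_cvg => //; exact: line_cont.
have hk k : (e 0 k * jacobian V (x + s *: e) k j) @[s --> t] -->
    (e 0 k * jacobian V (x + t *: e) k j).
  apply: cvgMr; exact: (continuous_cvg _ (@coord_continuous R n n k j _) h).
exact: (@cvg_sum_real R R (nbhs t) _ (index_enum 'I_n)
  (fun k s => e 0 k * jacobian V (x + s *: e) k j) _ _ hk).
Qed.

Variables (p : 'rV[R]_n) (I : finType) (hs : I -> seq ('rV[R]_n * R)) (y : R -> 'rV[R]_n).
Local Notation D := (polyh hs).
Local Notation F := (slack y).
Local Notation rel_coord := (rel_coord p).
Variable v : I -> 'I_n -> ('I_n -> R) -> R.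
Hypotheses (Up : U p) (hcov : forall x, U x -> exists i, D i x)
  (hy : forall r, 0 < r -> evt (fun s => eclose r (y s) p))
  (hv : forall i j, D i p -> germ (v i j))
  (hvV : forall i j, D i p -> \forall x \near p, D i x -> V x 0 j = v i j (rel_coord x)).

Lemma dot_near a k : 0 < k -> \forall x \near p, `|dot a x - dot a p| <= k.
Proof.
move=> k0; have [r r0 h] := dot_close a k0.
by apply: (close_nbhs r0) => x hx; exact: h.
Qed.

Lemma near_notin i : ~ D i p -> \forall x \near p, ~ D i x.
Proof.
move=> nD; have [ab abi lt] : exists2 ab, ab \in hs i & dot ab.1 p < ab.2.
  apply: contrapT => h; apply: nD => ab abi; rewrite leNgt; apply/negP => lt.
  by apply: h; exists ab.
have k0 : 0 < (ab.2 - dot ab.1 p) / 2 by rewrite divr_gt0 // subr_gt0.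
apply: filterS (dot_near ab.1 k0) => x; rewrite ler_norml => /andP[_ h] /(_ _ abi); lra.
Qed.

Lemma near_strict ab : \forall x \near p, ab.2 < dot ab.1 p -> ab.2 <= dot ab.1 x.
Proof.
have [lt|] := boolP (ab.2 < dot ab.1 p); last by move=> _; exact: filterS filterT.
have k0 : 0 < (dot ab.1 p - ab.2) / 2 by rewrite divr_gt0 // subr_gt0.
apply: filterS (dot_near ab.1 k0) => x; rewrite ler_norml => /andP[h _] _; lra.
Qed.

Lemma evt_consistent : evt (fun s => forall ab, ab \in allhs hs ->
   [/\ evt (fun s => 0 < F ab s) -> 0 < F ab s & evt (fun s => F ab s = 0) -> F ab s = 0]).
Proof.
apply: evt_seq => ab _.
have imp (P : R -> Prop) : evt (fun s => evt P -> P s).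
  have [h|h] := pselect (evt P); first by apply: (evtW _ h) => s.
  by exists 0 => s _ ?; case: h.
apply: evtW (evtI (imp (fun s => 0 < F ab s)) (imp (fun s => F ab s = 0))).
by move=> s [h1 h2]; split.
Qed.

(** The same constants serve all the pieces that meet at [p]. *)
Lemma pieces_C2 : exists (g : I -> 'I_n -> 'I_n -> ('I_n -> R) -> R) (r L : R),
  [/\ 0 < r, 0 <= L & forall i j, D i p -> forall z1 z2 (d : R), 0 <= d ->
   inball (fun=> r) z1 -> inball (fun=> r) z2 -> (forall l, `|z2 l - z1 l| <= d) ->
   `|v i j z2 - v i j z1 - \sum_l g i j l z1 * (z2 l - z1 l)| <= L * d ^+ 2 /\
   forall l, `|g i j l z2 - g i j l z1| <= L * d].
Proof.
have /boolp.choice [G hG] : forall ij : I * 'I_n, exists q : ('I_n -> ('I_n -> R) -> R) * R * R,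
   [/\ 0 < q.1.2, 0 <= q.2 & D ij.1 p -> forall z1 z2 (d : R), 0 <= d ->
   inball (fun=> q.1.2) z1 -> inball (fun=> q.1.2) z2 -> (forall l, `|z2 l - z1 l| <= d) ->
   `|v ij.1 ij.2 z2 - v ij.1 ij.2 z1 - \sum_l q.1.1 l z1 * (z2 l - z1 l)| <= q.2 * d ^+ 2 /\
   forall l, `|q.1.1 l z2 - q.1.1 l z1| <= q.2 * d].
  move=> [i j] /=; have [Dp|nD] := pselect (D i p); last by exists ((fun _ _ => 0), 1, 0); split.
  have [g [r [L [r0 L0 h]]]] := germ_C2 (hv j Dp).
  by exists ((g, r), L); split.
pose r := \big[Num.min/1]_(ij : I * 'I_n) (G ij).1.2.
have ri ij : r <= (G ij).1.2 by rewrite /r (bigD1 ij) //= ge_min lexx.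
have r0 : 0 < r.
  rewrite /r; elim/big_ind: _ => // [a b|ij _]; first by rewrite lt_min => -> ->.
  by case: (hG ij).
pose L := \sum_ij (G ij).2.
have Li ij : (G ij).2 <= L.
  by rewrite /L (bigD1 ij) //= lerDl sumr_ge0 // => kl _; case: (hG kl).
exists (fun i j => (G (i, j)).1.1), r, L; split => //.
  by apply: sumr_ge0 => ij _; case: (hG ij).
move=> i j Dp z1 z2 d d0 hx hz he; have [_ _ /(_ Dp) h] := hG (i, j).
have [h1 h2] := h z1 z2 d d0 (inballW (ri _) hx) (inballW (ri _) hz) he.
split; first by apply: le_trans h1 _; rewrite ler_wpM2r ?sqr_ge0.
by move=> l; apply: le_trans (h2 l) _; rewrite ler_wpM2r.
Qed.

(** An affine function of one variable has a constant sign immediately to the right of any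
    point. *)
Lemma halfspaces_right i x e t : exists d : R, 0 < d /\
  ((forall t', t <= t' < t + d -> D i (x + t' *: e)) \/
   (forall t', t < t' < t + d -> ~ D i (x + t' *: e))).
Proof.
rewrite /polyh; elim: (hs i) => [|ab r [d [d0 IH]]].
  by exists 1; split => //; left.
pose phi t' := dot ab.1 (x + t' *: e) - ab.2.
have phiE t' : phi t' = phi t + (t' - t) * dot ab.1 e by rewrite /phi !dotD !dotZ; ring.
have hab : exists2 d', 0 < d' & (forall t', t <= t' < t + d' -> 0 <= phi t') \/
    (forall t', t < t' < t + d' -> phi t' < 0).
  have [p0|] := eqVneq (phi t) 0.
    exists 1 => //; have [e0|e0] := lerP 0 (dot ab.1 e); [left|right] => t' /andP[h1 h2].
      by rewrite (phiE t') p0 add0r mulr_ge0 // subr_ge0.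
    by rewrite (phiE t') p0 add0r pmulr_rlt0 // subr_gt0.
  move=> nz; have a0 : 0 < `|dot ab.1 e| + 1 by rewrite ltr_wpDl.
  have bnd t' : t <= t' < t + `|phi t| / (`|dot ab.1 e| + 1) ->
      `|(t' - t) * dot ab.1 e| < `|phi t|.
    move=> /andP[h1]; rewrite -ltrBlDl ltr_pdivlMr // => h2.
    rewrite normrM (@ger0_norm _ (t' - t)) ?subr_ge0 //; apply: le_lt_trans h2.
    by rewrite ler_wpM2l ?subr_ge0 // lerDl.
  exists (`|phi t| / (`|dot ab.1 e| + 1)); first by rewrite divr_gt0 // normr_gt0.
  have [neg|pos] := ltrP (phi t) 0; [right|left] => t' ht'.
    have /bnd : t <= t' < t + `|phi t| / (`|dot ab.1 e| + 1).
      by case/andP: ht' => /ltW -> ->.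
    rewrite (phiE t') (ltr0_norm neg) ltr_norml => /andP[]; lra.
  by move/bnd: ht'; rewrite (phiE t') (ger0_norm pos) ltr_norml => /andP[]; lra.
have [d' d'0 h'] := hab; exists (Num.min d d'); split; first by rewrite lt_min d0.
have m1 : Num.min d d' <= d by rewrite ge_min lexx.
have m2 : Num.min d d' <= d' by rewrite ge_min lexx orbT.
case: h' => [h'|h']; last first.
  right => t' /andP[k1 k2] /(_ ab); rewrite in_cons eqxx => /(_ isT).
  have : phi t' < 0 by apply: h'; apply/andP; split => //; lra.
  by rewrite /phi; lra.
case: IH => [IH|IH]; last first.
  right => t' /andP[k1 k2] h; apply: (IH t'); first by apply/andP; split => //; lra.
  by move=> ab' h1; apply: h; rewrite in_cons h1 orbT.
left => t' /andP[k1 k2] ab'; rewrite in_cons => /predU1P[->|h1].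
  by rewrite -subr_ge0; apply: h'; apply/andP; split => //; lra.
by apply: (IH t') => //; apply/andP; split => //; lra.
Qed.

End bound.

(** Let [e] be a transversal direction, and [i1] a piece that contains [p + Th *: e]. Starting
    from [x = y s], the point [x + t *: e] is in the piece [i1] for [t] between [lam s] and
    [Th], where [lam s] is a weighted sum of the absolute values of the bad slacks at [s]: this
    is where compatibility and transversality are used. So [V - v i1] and its derivative along
    the segment vanish at [lam s]. On the rest of the segment that derivative is continuous,
    because [V] is of class [C^1], and Lipschitz on each of the pieces, hence at most
    [Lu * (lam s - t)]. One more integration gives [Lu * lam s ^+ 2]. *)
Lemma field_near_piece (R : realType) (n : nat) (U : set 'rV[R]_n) (V : 'rV[R]_n -> 'rV[R]_n)
  (p : 'rV[R]_n) (I : finType) (hs : I -> seq ('rV[R]_n * R)) (y : R -> 'rV[R]_n)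
  (v : I -> 'I_n -> ('I_n -> R) -> R) : open U -> C1_on V U -> U p ->
  (forall x, U x -> exists i, polyh hs i x) ->
  (forall r : R, 0 < r -> evt (fun s => eclose r (y s) p)) ->
  (forall i j, polyh hs i p -> germ (v i j)) ->
  (forall i j, polyh hs i p -> \forall x \near p, polyh hs i x -> V x 0 j = v i j (rel_coord p x)) ->
  exists2 i1, polyh hs i1 p & exists C, evt (fun s => forall j,
  `|V (y s) 0 j - v i1 j (rel_coord p (y s))| <= C * \sum_(ab <- badhs hs y) slack y ab s ^+ 2).
Proof.
move=> hU hV Up hcov hy hv hvV;
have [e ge ne] := transversal_direction hs hy.
have [g [r [L [r0 L0 hg]]]] := pieces_C2 hv.
pose E := \sum_l `|e 0 l|.
have El l : `|e 0 l| <= E by rewrite /E (bigD1 l) //= lerDl sumr_ge0.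
have E0 : 0 <= E by exact: sumr_ge0.
have nearU : \forall x \near p, U x by exact: open_nbhs_nbhs.
have nearD : \forall x \near p, forall i, ~ polyh hs i p -> ~ polyh hs i x.
  apply: filter_fin => i; have [Dp|nD] := pselect (polyh hs i p).
    by apply: filterS filterT => x _ /(_ Dp).
  by apply: filterS (near_notin nD).
have nearV : \forall x \near p, forall ij : I * 'I_n, polyh hs ij.1 p -> polyh hs ij.1 x ->
    V x 0 ij.2 = v ij.1 ij.2 (rel_coord p x).
  apply: filter_fin => -[i j] /=; have [Dp|nD] := pselect (polyh hs i p).
    by apply: filterS (hvV i j Dp) => x h _; exact: h.
  by apply: filterS filterT => x _ /nD.
have nearS : \forall x \near p, forall ab, ab \in allhs hs ->
    ab.2 < dot ab.1 p -> ab.2 <= dot ab.1 x.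
  by apply: filter_seq => ab _; exact: near_strict.
have [rho1 rho10 hrho1] := nbhs_close (filterI (filterI nearU nearD) (filterI nearV nearS)).
pose rho := Num.min rho1 r.
have rho0 : 0 < rho by rewrite lt_min rho10.
have rhor : rho <= r by rewrite ge_min lexx orbT.
have hrho x : eclose rho x p -> [/\ U x, forall i, ~ polyh hs i p -> ~ polyh hs i x,
    forall i j, polyh hs i p -> polyh hs i x -> V x 0 j = v i j (rel_coord p x) &
    forall ab, ab \in allhs hs -> ab.2 < dot ab.1 p -> ab.2 <= dot ab.1 x].
  move=> hx; have [|[h1 h2] [h3 h4]] := hrho1 x.
    by move=> l; apply: le_trans (hx l) _; rewrite ge_min lexx.
  by split => // i j; exact: (h3 (i, j)).
pose Th := rho / 4 / (E + 1).
have E10 : 0 < E + 1 by rewrite ltr_wpDl.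
have Th0 : 0 < Th by rewrite !divr_gt0.
have eTh l t : 0 <= t <= Th -> `|t * e 0 l| <= rho / 4.
  move=> /andP[t0 tT]; rewrite normrM (ger0_norm t0).
  apply: (@le_trans _ _ (Th * (E + 1))).
    by apply: ler_pM => //; apply: le_trans (El l) _; rewrite lerDl.
  by rewrite /Th divfK ?gt_eqF.
(* the piece with which the field is compared *)
have [i1 Di1] : exists i, polyh hs i (p + Th *: e).
  apply: hcov; have [] := hrho (p + Th *: e) => // l.
  rewrite !mxE addrAC subrr add0r; apply: le_trans (eTh l Th _) _; last by lra.
  by rewrite (ltW Th0) lexx.
have Di1p : polyh hs i1 p.
  apply: contrapT => nD; have [_ h _ _] := hrho (p + Th *: e) (ltac:(
    move=> l; rewrite !mxE addrAC subrr add0r; apply: le_trans (eTh l Th _) _;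
     [by rewrite (ltW Th0) lexx|by lra])).
  exact: h nD Di1.
exists i1 => //.
pose lam s := \sum_(ab <- badhs hs y) `|slack y ab s| / `|dot ab.1 e|.
have lam0 s : 0 <= lam s by apply: sumr_ge0 => ab _; rewrite divr_ge0.
pose W := \sum_(ab <- badhs hs y) (`|dot ab.1 e|^-1) ^+ 2.
pose Lu := 2 * (L * E * E).
exists (Lu * 2 ^+ size (badhs hs y) * W).
have lamT : evt (fun s => lam s < Th).
  pose k := Th / ((size (badhs hs y))%:R + 1).
  have k0 : 0 < k by rewrite divr_gt0 // ltr_wpDl.
  have hk : evt (fun s => forall ab, ab \in badhs hs y -> `|slack y ab s| / `|dot ab.1 e| <= k).
    apply: evt_seq => ab abb; have nz := ne ab abb.
    have k0' : 0 < k * `|dot ab.1 e| by rewrite mulr_gt0 // normr_gt0.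
    apply: evtW (slack_cvg hy ab k0') => t; rewrite (badhs_p hy abb) subrr subr0.
    by rewrite ler_pdivrMr // normr_gt0.
  apply: evtW hk => t hk; apply: (@le_lt_trans _ _ (\sum_(ab <- badhs hs y) k)).
    by rewrite /lam big_seq [leRHS]big_seq; apply: ler_sum => ab; exact: hk.
  rewrite big_const_seq count_predT iter_addr addr0 -mulr_natl /k mulrA.
  rewrite ltr_pdivrMr; last by rewrite ltr_wpDl.
  by rewrite mulrC ltr_pM2l // ltrDl.
have h4 : 0 < rho / 4 by rewrite divr_gt0.
apply: evtW (evtI (evtI (hy _ h4) lamT) (evt_consistent hs y)) => s [[hys lT] cons] j.
set x := y s in hys *.
have cl t : 0 <= t <= Th -> eclose (rho / 2) (x + t *: e) p.
  move=> ht l; rewrite !mxE addrAC; apply: le_trans (ler_normD _ _) _.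
  have := hys l; have := eTh l t ht; clear; lra.
have cl' t : 0 <= t <= Th -> \forall u \near t, eclose rho (x + u *: e) p.
  move=> ht; apply/nbhs_ballP; exists Th => // u; rewrite /ball /= => tu l.
  have -> : (x + u *: e) 0 l - p 0 l = ((x + t *: e) 0 l - p 0 l) + (u - t) * e 0 l.
    by rewrite !mxE; ring.
  apply: le_trans (ler_normD _ _) _.
  have h1 := cl t ht l; suff : `|(u - t) * e 0 l| <= rho / 4 by clear -h1 rho0; lra.
  rewrite normrM distrC; have hT : 0 <= `|t - u| <= Th by rewrite normr_ge0 ltW.
  by have := eTh l _ hT; rewrite normrM normr_id.
have clr t : 0 <= t <= Th -> eclose rho (x + t *: e) p.
  by move=> /cl h l; apply: le_trans (h l) _; clear -rho0; lra.
have inD t : lam s <= t <= Th -> polyh hs i1 (x + t *: e).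
  move=> /andP[lt tT] ab abi; have abs := allhsP abi.
  have t0 : 0 <= t by apply: le_trans lt.
  have ht : 0 <= t <= Th by rewrite t0.
  have := Di1p ab abi; rewrite le_eqVlt => /predU1P[abp|strict]; last first.
    by have [_ _ _ h] := hrho _ (clr t ht); exact: h.
  have de : 0 <= dot ab.1 e.
    by have := Di1 ab abi; rewrite dotD dotZ -abp lerDl pmulr_rge0.
  have [k1 k2 k3] := ge ab abs (esym abp); have [c1 c3] := cons ab abs.
  rewrite dotD dotZ; have te : 0 <= t * dot ab.1 e by rewrite mulr_ge0.
  have [[h|h|h]|nsg] := pselect (sgnconst (slack y ab)).
  - by have := c1 h; rewrite /slack -/x; clear -te; lra.
  - by have := k2 h; rewrite ltNge de.
  - by have := c3 h; rewrite /slack -/x; clear -te; lra.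
  have abb : ab \in badhs hs y by rewrite mem_filter abs andbT; apply/asboolPn.
  have de0 : 0 < dot ab.1 e by rewrite lt_neqAle de eq_sym ne.
  have : `|slack y ab s| / `|dot ab.1 e| <= lam s.
    by rewrite /lam (big_rem _ abb) /= lerDl sumr_ge0 // => ab' _; rewrite divr_ge0.
  rewrite (gtr0_norm de0) ler_pdivrMr // => h1.
  have h2 : lam s * dot ab.1 e <= t * dot ab.1 e by rewrite ler_wpM2r.
  have := lerNnormlW (lexx `|slack y ab s|); rewrite /slack -/x in h1 *; clear -h1 h2; lra.
pose u i t := \sum_l g i j l (rel_coord p (x + t *: e)) * e 0 l.
have inb t : eclose rho (x + t *: e) p -> inball (fun=> r) (rel_coord p (x + t *: e)).
  by move=> h l; apply: le_trans (h l) rhor.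
have crdB t t' l : rel_coord p (x + t' *: e) l - rel_coord p (x + t *: e) l = (t' - t) * e 0 l.
  by rewrite /rel_coord !mxE; ring.
have du i t : polyh hs i p -> 0 <= t <= Th ->
    is_derive t (1 : R) (fun t => v i j (rel_coord p (x + t *: e))) (u i t).
  move=> Dp ht; apply: (@is_derive_taylor R 'I_n (fun t => rel_coord p (x + t *: e)) (e 0)
    _ (fun l => g i j l (rel_coord p (x + t *: e))) t L) => // [l|].
    apply: is_derive_eps => d d0; apply: filterS filterT => t' _.
    by rewrite crdB mulrC subrr normr0 mulr_ge0 // ltW.
  apply: filterS (cl' t ht) => t' ht' d d0 hd.
  by case: (hg i j Dp _ _ d d0 (inb t (clr t ht)) (inb t' ht') hd).
have ulip i t t' : polyh hs i p -> eclose rho (x + t *: e) p -> eclose rho (x + t' *: e) p ->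
    `|u i t' - u i t| <= L * E * E * `|t' - t|.
  move=> Dp ht ht'; rewrite /u -sumrB; apply: le_trans (ler_norm_sum _ _ _) _.
  have d0 : 0 <= `|t' - t| * E by rewrite mulr_ge0.
  have [|_ hl] := hg i j Dp _ _ _ d0 (inb t ht) (inb t' ht').
    by move=> l; rewrite crdB normrM ler_wpM2l.
  apply: (@le_trans _ _ (\sum_l L * (`|t' - t| * E) * `|e 0 l|)).
    by apply: ler_sum => l _; rewrite -mulrBl normrM ler_wpM2r.
  by rewrite -mulr_sumr -/E le_eqVlt; apply/orP; left; apply/eqP; ring.
pose Vj t := (e *m jacobian V (x + t *: e)) 0 j.
have dV t : 0 <= t <= Th -> is_derive t (1 : R) (fun t => V (x + t *: e) 0 j) (Vj t).
  by move=> ht; apply: (line_derive hV); case: (hrho _ (clr _ ht)).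
have Vc t : 0 <= t <= Th -> {for t, continuous Vj}.
  by move=> ht; apply: (line_jac_cont hU hV); case: (hrho _ (clr t ht)).
clearbody Vj u.
have right t : 0 <= t < Th -> exists i, polyh hs i p /\
    exists2 d, 0 < d & forall t', t <= t' < t + d -> polyh hs i (x + t' *: e).
  move=> /andP[t0 tT].
  have /boolp.choice [d hd] : forall i, exists d, 0 < d /\
      ((forall t', t <= t' < t + d -> polyh hs i (x + t' *: e)) \/
       (forall t', t < t' < t + d -> ~ polyh hs i (x + t' *: e))).
    by move=> i; exact: halfspaces_right.
  pose m := \big[Num.min/Th - t]_i d i.
  have md i : m <= d i by rewrite /m (bigD1 i) //= ge_min lexx.
  have mT : m <= Th - t.
    by rewrite /m; elim/big_rec: _ => // i z _ h; rewrite ge_min h orbT.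
  have m0 : 0 < m.
    rewrite /m; elim/big_ind: _ => [|a b|i _]; first by rewrite subr_gt0.
      by rewrite lt_min => -> ->.
    by case: (hd i).
  pose t' := t + m / 2; have tt' : t < t' by rewrite ltrDl divr_gt0.
  have ht' : 0 <= t' <= Th by clear -t0 mT m0; rewrite /t'; apply/andP; split; lra.
  have [Ux nDx _ _] := hrho _ (clr t' ht').
  have [i Di] := hcov _ Ux; exists i; split.
    by apply: contrapT => /nDx; apply.
  have [di [hi|hi]] := hd i; first by exists (d i).
  case: (hi t' _ Di); rewrite tt' /t' /=; have := md i; clear -m0; lra.
have agree i t d : 0 <= t < Th -> polyh hs i p -> 0 < d ->
    (forall t', t <= t' < t + d -> polyh hs i (x + t' *: e)) -> Vj t = u i t.
  move=> /andP[t0 tT] Dp d0 hd; have ht : 0 <= t <= Th by rewrite t0 ltW.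
  have m0 : 0 < Num.min d (Th - t) by rewrite lt_min d0 subr_gt0.
  apply: (derive_right_eq m0 (dV t ht) (du i t Dp ht)) => t' /andP[tt' t'm].
  have [m1 m2] : Num.min d (Th - t) <= d /\ Num.min d (Th - t) <= Th - t.
    by rewrite !ge_min !lexx orbT.
  have ht' : 0 <= t' <= Th by clear -t0 tt' t'm m2; apply/andP; split; lra.
  have [_ _ h _] := hrho _ (clr t' ht'); apply: h => //.
  by apply: hd; rewrite tt'; clear -t'm m1; lra.
have Lu0 : 0 <= L * E * E by rewrite !mulr_ge0.
have ucont t : 0 <= t <= Th -> {for t, continuous (fun t => Vj t - u i1 t)}.
  move=> ht; apply: cvgB; first exact: Vc.
  apply/cvgrPdist_le => d d0.
  have q0 : 0 < d / (L * E * E + 1) by rewrite divr_gt0 // ltr_wpDl.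
  have near_t : \forall t' \near t, `|t' - t| <= d / (L * E * E + 1).
    apply/nbhs_ballP; exists (d / (L * E * E + 1)) => // t' /=.
    by rewrite /ball /= distrC => /ltW.
  apply: filterS2 near_t (cl' t ht) => t' h1 h2.
  rewrite distrC; apply: le_trans (ulip i1 t t' Di1p (clr t ht) h2) _.
  apply: (@le_trans _ _ ((L * E * E + 1) * `|t' - t|)).
    by rewrite ler_wpM2r // lerDl.
  by rewrite mulrC -ler_pdivlMr // ltr_wpDl.
have ragree i t d t' : 0 <= t -> polyh hs i p -> 0 < d ->
    (forall t', t <= t' < t + d -> polyh hs i (x + t' *: e)) -> t <= t' < t + d -> t' < Th ->
    Vj t' = u i t'.
  move=> t0 Dp d0 hd /andP[tt' t'd] t'T; apply: (agree i t' (t + d - t')) => //.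
  - by rewrite t'T (le_trans t0).
  - by rewrite subr_gt0.
  move=> t'' /andP[k1 k2]; apply: hd; rewrite (le_trans tt') //=; clear -k2; lra.
have w0 : Vj (lam s) - u i1 (lam s) = 0.
  apply/eqP; rewrite subr_eq0; apply/eqP.
  have q0 : 0 < Th - lam s by rewrite subr_gt0.
  apply: (agree i1 (lam s) (Th - lam s)) => //; first by rewrite lam0.
  by move=> t' /andP[k1 k2]; apply: inD; rewrite k1; clear -k2; lra.
have wlip t : 0 <= t <= lam s -> `|Vj t - u i1 t| <= Lu * (lam s - t).
  move=> /andP[t0 tl].
  suff H : `|(Vj (lam s) - u i1 (lam s)) - (Vj t - u i1 t)| <= Lu * (lam s - t).
    by rewrite w0 sub0r normrN in H.
  apply: (@lip_of_local R (fun t => Vj t - u i1 t) t (lam s) Lu tl).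
    move=> t' /andP[k1 k2]; apply: ucont; rewrite (le_trans t0 k1) /=.
    exact: le_trans k2 (ltW lT).
  move=> t1 /andP[k1 k2].
  have t10 : 0 <= t1 by exact: le_trans k1.
  have t1T : t1 < Th by exact: lt_trans lT.
  have [i [Dp [d d0 hd]]] := right t1 (introT andP (conj t10 t1T)).
  exists (Num.min d (Th - t1)); first by rewrite lt_min d0 subr_gt0.
  move=> t2 /andP[k3 k4].
  have [m1 m2] : Num.min d (Th - t1) <= d /\ Num.min d (Th - t1) <= Th - t1.
    by rewrite !ge_min !lexx orbT.
  have t2T : t2 < Th by clear -k4 m2; lra.
  have t2d : t1 <= t2 < t1 + d by clear -k3 k4 m1; apply/andP; split => //; lra.
  have t1d : t1 <= t1 < t1 + d by rewrite lexx ltrDl.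
  rewrite (ragree i t1 d t2) // (ragree i t1 d t1) //.
  have c1 : eclose rho (x + t1 *: e) p by apply: clr; rewrite t10 ltW.
  have c2 : eclose rho (x + t2 *: e) p by apply: clr; rewrite (le_trans t10) // ltW.
  have := ulip i t1 t2 Dp c1 c2; have := ulip i1 t1 t2 Di1p c1 c2.
  rewrite (@ger0_norm _ (t2 - t1)) ?subr_ge0 // => a1 a2.
  have -> : u i t2 - u i1 t2 - (u i t1 - u i1 t1) = (u i t2 - u i t1) - (u i1 t2 - u i1 t1).
    by ring.
  by apply: le_trans (ler_normB _ _) _; rewrite /Lu; clear -a1 a2; lra.
have Wsum : lam s ^+ 2 <= 2 ^+ size (badhs hs y) * W * \sum_(ab <- badhs hs y) slack y ab s ^+ 2.
  apply: le_trans (sqr_sum_le _ _) _; rewrite -mulrA ler_wpM2l ?exprn_ge0 //.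
  rewrite mulr_sumr big_seq [leRHS]big_seq; apply: ler_sum => ab abb.
  rewrite exprMn mulrC real_normK ?num_real // ler_wpM2r ?sqr_ge0 //.
  by rewrite /W (big_rem _ abb) /= lerDl sumr_ge0 // => ab' _; exact: sqr_ge0.
have Lu0' : 0 <= Lu by rewrite /Lu mulr_ge0.
suff main : `|V x 0 j - v i1 j (rel_coord p x)| <= Lu * lam s ^+ 2.
  by apply: le_trans main _; have := ler_wpM2l Lu0' Wsum; rewrite !mulrA.
have Dl : V (x + lam s *: e) 0 j - v i1 j (rel_coord p (x + lam s *: e)) = 0.
  apply/eqP; rewrite subr_eq0; apply/eqP.
  have hl : 0 <= lam s <= Th by rewrite lam0 ltW.
  have [_ _ h _] := hrho _ (clr _ hl); apply: h => //; apply: inD.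
  by rewrite lexx ltW.
have := lam0 s; rewrite le_eqVlt => /predU1P[l0|lpos].
  by move: Dl; rewrite -l0 scale0r addr0 => ->; rewrite normr0 mulr_ge0 // sqr_ge0.
have dD t : 0 <= t <= Th -> is_derive t (1 : R)
   (fun t => V (x + t *: e) 0 j - v i1 j (rel_coord p (x + t *: e))) (Vj t - u i1 t).
  by move=> ht; apply: is_deriveB; [exact: dV|exact: du].
have [||c hc eqD] := @MVT R (fun t => V (x + t *: e) 0 j - v i1 j (rel_coord p (x + t *: e)))
  (fun t => Vj t - u i1 t) 0 (lam s) lpos.
- move=> t; rewrite in_itv /= => /andP[a b]; apply: dD; rewrite (ltW a).
  by rewrite ltW // (lt_trans b).
- apply: derivable_within_continuous => t; rewrite in_itv /= => /andP[a b].
  by have [] := dD t (introT andP (conj a (ltW (le_lt_trans b lT)))).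
move: eqD; rewrite Dl scale0r addr0 sub0r subr0 => eqD.
rewrite -normrN eqD normrM (ger0_norm (ltW lpos)) expr2 mulrA ler_wpM2r ?(ltW lpos) //.
move: hc; rewrite in_itv /= => /andP[c0 cl0].
apply: le_trans (wlip c _) _; first by rewrite (ltW c0) ltW.
by rewrite ler_wpM2l // lerBlDr lerDl ltW.
Qed.

(** * One polyhedron on each side of a finite time *)

Section finite_time.
Variable R : realType.

Lemma germ_cvps (I : finType) (f : (I -> R) -> R) : germ f ->
  exists2 c, cvps c & near0 (fun x => f x = ev c x).
Proof.
move=> [r [C [r0 [c hc h]]]]; exists c; first by exists r, C.
by exists r.
Qed.

(** A function that tends to 0 is recovered from its derivative by integration from infinity. *)
Lemma rate_of_derive (f h : R -> R) B : (forall k, 0 < k -> evt (fun s => `|f s| <= k)) ->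
  ddt f h -> evt (fun s => `|h s| <= B * expR (- s)) -> evt (fun s => `|f s| <= B * expR (- s)).
Proof.
move=> f0 hf hB; have [T hT] := evtI hf hB.
have main (g g' : R -> R) : (forall k, 0 < k -> evt (fun s => `|g s| <= k)) ->
    (forall s, T < s -> is_derive s (1 : R) g (g' s)) ->
    (forall s, T < s -> `|g' s| <= B * expR (- s)) -> forall s, T < s -> g s <= B * expR (- s).
  move=> g0 hg hg' s Ts.
  pose A t := g t - B * expR (-1 * t).
  have mono : forall t, s <= t -> A s <= A t.
    move=> t st; apply: (@mono_on R T A (fun t => g' t - B * (-1 * expR (-1 * t)))) => // u Tu.
      exact: (is_deriveB (hg u Tu) (is_deriveZ B (is_derive_expRM (-1) u))).
    have := hg' u Tu; rewrite ler_norml !mulN1r => /andP[h1 _]; lra.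
  rewrite -subr_le0 -[- s]mulN1r -/(A s); apply/ler_addgt0Pl => k k0; rewrite addr0.
  have k20 : 0 < k / 2 by rewrite divr_gt0.
  have k30 : 0 < k / 2 / (`|B| + 1) by rewrite divr_gt0 // ltr_wpDl.
  have [t st [h1 h2]] := evt_ex s (evtI (g0 _ k20) (evt_expRN ltr01 k30)).
  apply: le_trans (mono t (ltW st)) _; rewrite /A.
  rewrite mul1r ltr_pdivlMr in h2; last by rewrite ltr_wpDl.
  have h3 : - B * expR (- t) <= `|B| * expR (- t).
    by rewrite ler_wpM2r ?expR_ge0 // -normrN ler_norm.
  have := expR_ge0 (- t); move: h1 (ler_norm (g t)); rewrite mulN1r; lra.
exists T => s Ts; rewrite ler_norml; apply/andP; split.
  rewrite lerNl; apply: (main (fun s => - f s) (fun s => - h s)) => //.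
  - by move=> k k0; apply: evtW (f0 k k0) => t; rewrite normrN.
  - by move=> t /hT [h1 _]; exact: is_deriveN.
  - by move=> t /hT [_ h1]; rewrite normrN.
apply: (main f h) => // t /hT; by case.
Qed.

End finite_time.

(** With a bad half space, [definite_or_zero] would give an eventually constant sign to the
    slack of one of them. *)
Lemma one_piece_of_system (R : realType) (A : finType) (X : R -> A -> R) (lam : A -> R)
  (w : A -> nat) (N : A -> mindex A -> R) (err : A -> R -> R) (rate : R) (n : nat) (I : finType)
  (hs : I -> seq ('rV[R]_n * R)) (y : R -> 'rV[R]_n) (C : R) :
  (forall o, (w o <= 1)%N) -> (forall o, cvps (N o)) -> 0 < rate ->
  (forall o, small rate (X^~ o)) ->
  (forall o, ddt (X^~ o) (fun s => - lam o * X s o + ev (N o) (X s) + err o s)) ->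
  (forall o a, (wdeg w a < (w o).+1)%N -> N o a = 0) ->
  (forall k, exists s : seq R, forall a, wdeg w a = k -> lsum lam a \in s) ->
  evt (fun s => exists i, polyh hs i (y s)) ->
  (forall ab, ab \in badhs hs y -> exists f, [/\ germ f, f (fun=> 0) = 0 &
     evt (fun s => f (X s) = slack y ab s)]) ->
  (forall o, evt (fun s => `|err o s| <= C * \sum_(ab <- badhs hs y) slack y ab s ^+ 2)) ->
  exists j, evt (fun s => polyh hs j (y s)).
Proof.
move=> w1 hN r0 hX hdX ordN fin hev hgh herr; apply: one_piece => //.
suff hb : badhs hs y = [::].
  move=> ab abs; apply: contrapT => nsg.
  have : ab \in badhs hs y by rewrite mem_filter abs andbT; apply/asboolPn.
  by rewrite hb.
pose m := size (badhs hs y).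
pose ab (k : 'I_m) := tnth (in_tuple (badhs hs y)) k.
have abb k : ab k \in badhs hs y by exact: mem_tnth.
have /boolp.choice [h hh] : forall k, exists c, [/\ cvps c, c (m0 A) = 0 &
    evt (fun s => ev c (X s) = slack y (ab k) s)].
  move=> k; have [f [gf f0 hf]] := hgh _ (abb k).
  have [c hc [r rp hr]] := germ_cvps gf; exists c; split => //.
    by rewrite -ev0 -hr // => o; rewrite normr0 ltW.
  have hr' : near0 (fun x => f x = ev c x) by exists r.
  by apply: evtW (evtI hf (evt_near0 r0 hX hr')) => s [<- <-].
have hF : evt (fun s => forall k, ev (h k) (X s) = slack y (ab k) s).
  by apply: evt_all => k; case: (hh k).
have he o : evt (fun s => `|err o s| <= C * \sum_k ev (h k) (X s) ^+ 2).
  apply: evtW (evtI hF (herr o)) => s [h1 h2]; apply: le_trans h2 _.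
  by rewrite [in leLHS]big_tnth; under [in leRHS]eq_bigr do rewrite h1.
have hcv k : cvps (h k) by case: (hh k).
have h0 k : h k (m0 A) = 0 by case: (hh k).
have nosg k : ~ sgnconst (slack y (ab k)) by case: (badhsP (abb k)).
have hall : forall k : 'I_m, False.
  have [[k hk]|hz] := definite_or_zero w1 hN r0 hX hdX ordN fin hcv h0 he.
    case: (nosg k); case: hk => hk; [apply: Or31|apply: Or32];
    by apply: evtW (evtI hk hF) => s [h1 h2]; rewrite -h2.
  move=> k; apply: (nosg k); apply: Or33.
  by apply: evtW (evtI (hz k) hF) => s [h1 <-].
apply/eqP; rewrite -size_eq0 -/m; case: (m) hall => // m' hall.
by case: (hall ord0).
Qed.

(** The deviation from [p] and [tau = expR (- s)] satisfy the system [X' = - sg tau V],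
    [tau' = - tau]. The weights are 0 for the deviation and 1 for [tau]; the field always
    appears with the factor [tau], so its components have order 1, and a monomial [a] has the
    eigenvalue [a None], which is its weighted degree. *)
Theorem piece_finite_time (R : realType) (n : nat) (U : set 'rV[R]_n) (V : 'rV[R]_n -> 'rV[R]_n)
  (p : 'rV[R]_n) (I : finType) (hs : I -> seq ('rV[R]_n * R)) (x : R -> 'rV[R]_n)
  (v : I -> 'I_n -> ('I_n -> R) -> R) (t0 sg : R) : open U -> C1_on V U -> U p ->
  (forall x, U x -> exists i, polyh hs i x) ->
  (forall i j, polyh hs i p -> germ (v i j)) ->
  (forall i j, polyh hs i p -> \forall x \near p, polyh hs i x -> V x 0 j = v i j (rel_coord p x)) ->
  `|sg| = 1 ->
  (forall r : R, 0 < r -> evt (fun s => eclose r (x (t0 + sg * expR (- s))) p)) ->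
  evt (fun s => forall j, is_derive (t0 + sg * expR (- s)) (1 : R) (fun t => x t 0 j)
     (V (x (t0 + sg * expR (- s))) 0 j)) ->
  exists j, evt (fun s => polyh hs j (x (t0 + sg * expR (- s)))).
Proof.
move=> hU hV Up hcov hv hvV sg1; pose y s := x (t0 + sg * expR (- s)) => hy hd.
have [i1 Di1 [C hC]] := field_near_piece hU hV Up hcov hy hv hvV.
have evtU : evt (fun s => U (y s)).
  have nU : nbhs p U by exact: open_nbhs_nbhs.
  by have [r r0 h] := nbhs_close nU; apply: evtW (hy r r0) => s; exact: h.
(* the index None stands for the variable tau *)
pose X s (o : option 'I_n) := if o is Some l then rel_coord p (y s) l else expR (- s).
pose w (o : option 'I_n) := if o is Some _ then 0%N else 1%N.
pose lam o : R := (w o)%:R.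
have hgc l : germ (fun z : option 'I_n -> R => - sg * v i1 l (fun l' => z (Some l'))).
  apply: germZ; apply: (germ_comp (psi := fun z l' => z (Some l')) (hv i1 l Di1)) => // l'.
  exact: germ_var.
have /boolp.choice [c hc] : forall l, exists c, cvps c /\
    near0 (fun z : option 'I_n -> R => - sg * v i1 l (fun l' => z (Some l')) = ev c z).
  by move=> l; have [c h1 h2] := germ_cvps (hgc l); exists c.
pose N (o : option 'I_n) : mindex (option 'I_n) -> R :=
  if o is Some l then cmul (c l) (cdelta R (m1 None)) else fun=> 0.
pose err (o : option 'I_n) s : R :=
  if o is Some l then - sg * expR (- s) * (V (y s) 0 l - v i1 l (rel_coord p (y s))) else 0.
have dy : evt (fun s => forall l, is_derive s (1 : R) (fun s => X s (Some l))
    (- sg * expR (- s) * V (y s) 0 l)).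
  apply: evtW hd => s hs' l.
  have h1 : is_derive s (1 : R) (fun s => t0 + sg * expR (-1 * s)) (sg * (-1 * expR (-1 * s))).
    have := is_deriveD (is_derive_cst t0 s 1) (is_deriveZ sg (is_derive_expRM (-1) s)).
    by rewrite add0r.
  have h2 : is_derive (t0 + sg * expR (-1 * s)) (1 : R) (fun t => x t 0 l) (V (y s) 0 l).
    by rewrite mulN1r; exact: hs'.
  have h3 := @is_derive1_comp R (fun t => x t 0 l) (fun s => t0 + sg * expR (-1 * s)) s _ _ h2 h1.
  have := is_deriveB h3 (is_derive_cst (p 0 l) s 1).
  move/is_derive_congr; apply; first by move=> u; rewrite /X /rel_coord /y -(mulN1r u).
  by rewrite subr0 -(mulN1r s); ring.
have X0 l k : 0 < k -> evt (fun s => `|X s (Some l)| <= k).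
  by move=> k0; apply: evtW (hy k k0) => s; exact.
have hX o : small 1 (fun s => X s o).
  case: o => [l|]; last by exists 1; exists 0 => s _; rewrite !mul1r ger0_norm ?expR_ge0.
  have Vp : {for p, continuous V} by apply: differentiable_continuous; exact: hV.1.
  have Vl : (fun z => V z 0 l) @ p --> V p 0 l.
    exact: (continuous_cvg _ (@coord_continuous R 1 n 0 l (V p)) Vp).
  move/cvgrPdist_le: Vl => /(_ 1 ltr01) /nbhs_close [r r0 hr].
  have hB : evt (fun s => `|- sg * expR (- s) * V (y s) 0 l| <= (`|V p 0 l| + 1) * expR (- s)).
    apply: evtW (hy r r0) => s /hr h1.
    rewrite !normrM normrN sg1 mul1r (ger0_norm (expR_ge0 _)) mulrC ler_wpM2r ?expR_ge0 //.
    have -> : V (y s) 0 l = V p 0 l - (V p 0 l - V (y s) 0 l) by ring.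
    by apply: le_trans (ler_normB _ _) _; rewrite lerD2l.
  have hl : ddt (fun s => X s (Some l)) (fun s => - sg * expR (- s) * V (y s) 0 l).
    by apply: evtW dy => s; exact.
  exists (`|V p 0 l| + 1); apply: evtW (rate_of_derive (X0 l) hl hB) => s.
  by rewrite mul1r.
have w1 o : (w o <= 1)%N by case: o.
have hN o : cvps (N o).
  case: o => [l|] /=; first by apply: cvpsM; [case: (hc l)|exact: cvps_delta].
  by exists 1, 0; split => // F; rewrite big1 // => a _; rewrite mul0r normr0.
have hr z : near0 z -> evt (fun s => z (X s)).
  exact: (evt_near0 ltr01 hX).
have hdX o : ddt (X^~ o) (fun s => - lam o * X s o + ev (N o) (X s) + err o s).
  case: o => [l|]; last first.
    exists 0 => s _; apply: (is_derive_congr (is_derive_expRM (-1) s)) => [u|].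
      by rewrite /X mulN1r.
    have -> : ev (N None) (X s) = 0.
      by rewrite /ev -[RHS](@tsum0 R (mindex (option 'I_n))); congr tsum; apply/funext => a; rewrite mul0r.
    by rewrite !addr0 /lam /X /w !mulN1r.
  have [c1 c2] := hc l.
  apply: evtW (evtI dy (evtI (hr _ c2) (hr _ (near0_evM c1 (cvps_delta R (m1 None)))))).
  move=> s [h1 [h2 h3]]; apply: (is_derive_congr (h1 l)) => //.
  rewrite /N h3 -h2 ev_delta mon1 /lam /= oppr0 mul0r add0r /X.
  by rewrite (_ : (fun l' => rel_coord p (y s) l') = rel_coord p (y s)) //; ring.
have wE a : wdeg w a = a None.
  rewrite /wdeg (bigD1 None) //= mul1n big1 ?addn0 // => -[l|//] _.
  by rewrite mul0n.
have ordN o a : (wdeg w a < (w o).+1)%N -> N o a = 0.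
  case: o => [l|//]; rewrite wE /= => a0.
  by rewrite cmul_delta m1_le lt0n; case: (a None) a0.
have fin k : exists s : seq R, forall a, wdeg w a = k -> lsum lam a \in s.
  exists [:: k%:R] => a <-; rewrite inE /lsum /wdeg natr_sum; apply/eqP.
  by apply: eq_bigr => o _; rewrite natrM.
apply: (one_piece_of_system w1 hN ltr01 hX hdX ordN fin (C := `|C|)).
- by apply: evtW evtU => s; exact: hcov.
- move=> ab abb; exists (fun z => \sum_l ab.1 0 l * z (Some l)); split.
  + by apply: germ_sum => l; apply: germZ; exact: germ_var.
  + by rewrite big1 // => l _; rewrite mulr0.
  exists 0 => s _; rewrite /slack -(badhs_p hy abb) -dotB; apply: eq_bigr => l _.
  by rewrite !mxE.
case=> [l|]; last first.
  exists 0 => s _; rewrite normr0 mulr_ge0 // sumr_ge0 // => k _; exact: sqr_ge0.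
apply: evtW (evtI hC (evt_gt 0)) => s [h2 s0].
rewrite /err !normrM normrN sg1 mul1r (ger0_norm (expR_ge0 _)).
have e1 : expR (- s) <= 1 by rewrite -expR0 ler_expR oppr_le0 ltW.
apply: (@le_trans _ _ (1 * `|V (y s) 0 l - v i1 l (rel_coord p (y s))|)).
  by rewrite ler_wpM2r.
rewrite mul1r; apply: le_trans (h2 l) _.
by rewrite ler_wpM2r ?ler_norm // sumr_ge0 // => k _; exact: sqr_ge0.
Qed.

(** * Eigenbasis and gradients *)

Section linear_algebra.
Variable R : realType.

(** The rows of [b] are a basis of eigenvectors of the invariant subspace; multiplication by
    [bi] reads off coordinates in this basis. *)
Lemma eigenbasis n (J : 'M[R]_n) (S : set 'rV[R]_n) : diagonalizable_neg_on J S ->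
  exists (r : nat) (b : 'M[R]_(r, n)) (bi : 'M[R]_(n, r)) (l : 'rV[R]_r),
  [/\ b *m bi = 1%:M, b *m J = diag_mx (- l) *m b, forall i, 0 < l 0 i &
      forall v, S v -> (v <= b)%MS].
Proof.
move=> [B [SB stB [P Pu /diagonalizable_forPex [D PD]] neg]].
have free : row_free (P *m row_base B) by rewrite /row_free mxrankMfree ?row_base_free // -/(row_free _) row_free_unit.
have E1 : row_base B *m J = restrictmx B J *m row_base B.
  by rewrite /conjmx mulmxKpV // stablemx_row_base.
have E2 := elimT (simmxP Pu) PD.
exists (\rank B), (P *m row_base B), (pinvmx (P *m row_base B)), (- D); split.
- exact: mulmxVp.
- by rewrite opprK -mulmxA E1 (mulmxA P) E2 -mulmxA.
- move=> i; rewrite mxE oppr_gt0; apply: neg; apply/eigenvalueP; exists (row i P).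
    by rewrite -row_mul E2 row_mul row_diag_mx -scalemxAl -rowE.
  apply/eqP => rz; have := congr1 (fun u => u *m invmx P) rz.
  rewrite -row_mul mulmxV // mul0mx => /rowP /(_ i); rewrite !mxE eqxx => /eqP.
  by rewrite oner_eq0.
move=> v; rewrite SB /= => vB; rewrite (submx_trans vB) //.
rewrite -(eq_row_base B) -[X in (X <= _)%MS]mul1mx -(mulVmx Pu) -mulmxA.
exact: submxMl.
Qed.

Lemma cvg_mx (T : Type) (Fl : set_system T) n (f : T -> 'rV[R]_n) (l : 'rV[R]_n) :
  Filter Fl -> (forall j, (fun s => f s 0 j) @ Fl --> l 0 j) -> f @ Fl --> l.
Proof.
move=> FF h; apply/cvg_ballP => e e0; rewrite /ball /=.
have : \forall s \near Fl, forall j, ball (l 0 j) e (f s 0 j).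
  by apply: filter_fin => j; move/cvg_ballP: (h j) => /(_ e e0).
by apply: filterS => s hs; split => // i j; rewrite ord1.
Qed.

End linear_algebra.

Section gradients.
Variable R : realType.

(** Quantitative differentiability on a polydisc, in the form in which germs provide it; a
    relation rather than an existential, since gradients of different germs have to be
    compared. *)
Definition has_grad (A : finType) (f : (A -> R) -> R) (g : A -> (A -> R) -> R) (r M : R) :=
  [/\ 0 < r, 0 <= M & forall x y (e : R), 0 <= e ->
   inball (fun=> r) x -> inball (fun=> r) y -> (forall i, `|y i - x i| <= e) ->
   `|f y - f x - \sum_i g i x * (y i - x i)| <= M * e ^+ 2 /\ `|f y - f x| <= M * e].

Lemma has_grad_chain (A : finType) f g r M (X : R -> A -> R) (d : A -> R) t :
  has_grad f g r M -> (forall i, is_derive t (1 : R) (X^~ i) (d i)) ->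
  (\forall s \near t, inball (fun=> r) (X s)) ->
  is_derive t (1 : R) (fun s => f (X s)) (\sum_i g i (X t) * d i).
Proof.
move=> [r0 M0 h] hX hb; have hbt := nbhs_singleton hb.
apply: (is_derive_taylor (g := fun i => g i (X t)) hX M0).
apply: filterS hb => s hs e e0 hd.
by case: (h _ _ e e0 hbt hs hd).
Qed.

Lemma near_ray (A : finType) (e : A -> R) (r : R) : 0 < r ->
  \forall s \near (0 : R), inball (fun=> r) (fun i => s * e i).
Proof.
move=> r0; have p : 0 < \sum_i `|e i| + 1 by rewrite ltr_wpDl // sumr_ge0.
apply/nbhs_ballP; exists (r / (\sum_i `|e i| + 1)); first by rewrite /= divr_gt0.
move=> s; rewrite /ball /= sub0r normrN ltr_pdivlMr // => h i.
rewrite normrM; apply: le_trans (ltW h); rewrite ler_wpM2l //.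
by rewrite (bigD1 i) //= -addrA lerDl addr_ge0 // sumr_ge0.
Qed.

Lemma is_derive_ray (A : finType) (e : A -> R) i t : is_derive t (1 : R) (fun s => s * e i) (e i).
Proof.
apply: is_derive_eps => k k0; apply: filterS filterT => s _.
by rewrite -mulrBl mulrC subrr normr0 mulr_ge0 // ltW.
Qed.

Lemma has_grad_ray (A : finType) f g r M (e : A -> R) : has_grad f g r M ->
  is_derive (0 : R) (1 : R) (fun s => f (fun i => s * e i)) (\sum_i g i (fun=> 0) * e i).
Proof.
move=> hf; have [r0 _ _] := hf.
have H : is_derive (0 : R) (1 : R) (fun s => f (fun i => s * e i))
    (\sum_i g i (fun j => 0 * e j) * e i).
  exact: (has_grad_chain hf (fun i => is_derive_ray e i 0) (near_ray e r0)).
by rewrite (_ : (fun j => 0 * e j) = (fun=> 0)) in H; last by apply/funext => j; rewrite mul0r.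
Qed.

Lemma analytic_on_germ n m (f : 'rV[R]_n -> 'rV[R]_m) (W : set 'rV[R]_n) (p : 'rV[R]_n) j :
  analytic_on f W -> open W -> W p -> germ (fun z : 'I_n -> R => f (p + \row_i z i) 0 j).
Proof.
move=> [W' [f' [oW' WW' an ff']]] oW Wp.
have := analytic_at_germ j (an p (WW' p Wp)).
have [r r0 hr] : exists2 r, 0 < r & forall x, eclose r x p -> W x.
  by apply: nbhs_close; exact: open_nbhs_nbhs.
apply: (germ_ext r0) => z hz; rewrite ff' //; apply: hr => i.
by rewrite !mxE addrAC subrr add0r.
Qed.

Lemma has_gradP (A : finType) (f : (A -> R) -> R) : germ f ->
  exists g r M, (forall i, germ (g i)) /\ has_grad f g r M.
Proof. by move=> /germ_taylor [g [r [M [r0 M0 hg h]]]]; exists g, r, M. Qed.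

End gradients.

(** The field and its piece agree on the segments from the origin to the points of [D], so the
    two linear maps agree on [D], and the interior points of [D] span the space. *)
Lemma grad_jacobian (R : realType) (n : nat) (U : set 'rV[R]_n) (V : 'rV[R]_n -> 'rV[R]_n)
  (D : set 'rV[R]_n) (v : ('I_n -> R) -> R) g r M (j : 'I_n) :
  open U -> C1_on V U -> U 0 ->
  (forall q s, D q -> 0 <= s <= 1 -> D (s *: q)) -> D° !=set0 ->
  (\forall x \near (0 : 'rV[R]_n), D x -> V x 0 j = v (rel_coord 0 x)) -> has_grad v g r M ->
  forall k, g k (fun=> 0) = jacobian V 0 k j.
Proof.
move=> hU hV U0 star [q0 Dq0] hv hg.
have key q : D q -> \sum_k g k (fun=> 0) * q 0 k = (q *m jacobian V 0) 0 j.
  move=> Dq; have [rho rho0 hrho] := nbhs_close hv.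
  have /nbhs_ballP [d d0 hd] := near_ray (q 0) rho0.
  have h1 := has_grad_ray (q 0) hg.
  have h2 : is_derive (0 : R) (1 : R) (fun t => V (0 + t *: q) 0 j) ((q *m jacobian V (0 + 0 *: q)) 0 j).
    by apply: (line_derive hV); rewrite scale0r addr0.
  rewrite scale0r addr0 in h2.
  have m0 : 0 < Num.min d 1 by rewrite lt_min d0 ltr01.
  apply: (derive_right_eq m0 h1 h2) => s /andP[s0]; rewrite add0r => sm.
  have sd : s < d by apply: lt_le_trans sm _; rewrite ge_min lexx.
  have s1 : s <= 1 by apply: le_trans (ltW sm) _; rewrite ge_min lexx orbT.
  rewrite add0r (hrho (s *: q)).
  - by congr v; apply/funext => i; rewrite /rel_coord !mxE subr0.
  - move=> i; rewrite !mxE subr0; apply: hd.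
    by rewrite /ball /= sub0r normrN ger0_norm.
  by apply: star => //; rewrite s0.
have [rho rho0 hrho] := nbhs_close Dq0.
move=> k; pose q1 := q0 + rho *: delta_mx 0 k.
have D0 : D q0 by exact: nbhs_singleton.
have D1 : D q1.
  apply: hrho => i; rewrite !mxE addrAC subrr add0r eqxx /=.
  by case: (_ == _); rewrite ?mulr1 ?mulr0 ?normr0 ?(ltW rho0) // gtr0_norm.
have := key q1 D1; rewrite /q1 mulmxDl -scalemxAl -rowE [in RHS]mxE -key //.
under eq_bigr do rewrite !mxE mulrDr.
rewrite big_split /= => /addrI.
rewrite (bigD1 k) //= !eqxx mulr1 big1 ?addr0; last first.
  by move=> i /negbTE ik; rewrite ik ?andbF !mulr0.
by rewrite !mxE mulrC => /(mulfI (lt0r_neq0 rho0)).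
Qed.

(** * Coordinates on the manifold adapted to the eigenbasis *)

Section tangent.
Variable R : realType.

Lemma has_grad_cont (A : finType) (f : (A -> R) -> R) g r M (e : A -> R) (s : R) :
  has_grad f g r M -> (\forall u \near s, inball (fun=> r) (fun i => u * e i)) ->
  {for s, continuous (fun u : R => f (fun i => u * e i))}.
Proof.
move=> hf hb; have H := has_grad_chain hf (fun i => is_derive_ray e i s) hb.
by apply: differentiable_continuous; apply/derivable1_diffP; case: H.
Qed.

Lemma analytic_curve_tangent n (M B : set 'rV[R]_n) (psi : 'rV[R]_n -> 'rV[R]_n) y0 (e : 'rV[R]_n)
  g (r K : 'I_n -> R) :
  (forall l, has_grad (fun z : 'I_n -> R => psi (y0 + \row_i z i) 0 l) (g l) (r l) (K l)) ->
  (forall l i, germ (g l i)) ->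
  (\forall s \near (0 : R), M (psi (y0 + s *: e))) ->
  tangent_space M (psi y0) (\row_l \sum_i g l i (fun=> 0) * e 0 i).
Proof.
move=> hg gg hM; pose c s := psi (y0 + s *: e).
pose F s := \row_l \sum_i g l i (fun k => s * e 0 k) * e 0 i.
have cE l : (fun s => c s 0 l) = (fun s => psi (y0 + \row_i (s * e 0 i)) 0 l).
  apply/funext => s; rewrite /c; congr (psi (_ + _) 0 l).
  by apply/rowP => i; rewrite !mxE.
have /boolp.choice [G hG] : forall li : 'I_n * 'I_n, exists G : ('I_n -> ('I_n -> R) -> R) * (R * R),
    has_grad (g li.1 li.2) G.1 G.2.1 G.2.2.
  by move=> li; have [G [r' [M' [_ h]]]] := has_gradP (gg li.1 li.2); exists (G, (r', M')).
have hb : \forall s \near (0 : R), (forall l, \forall u \near s, inball (fun=> r l) (fun i => u * e 0 i)) /\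
    (forall li, \forall u \near s, inball (fun=> (G li).2.1) (fun i => u * e 0 i)).
  apply: filterI; apply: filter_fin => k.
    by apply: nbhs_interior; apply: near_ray; case: (hg k).
  by apply: nbhs_interior; apply: near_ray; case: (hG k).
have dl s : (forall l, \forall u \near s, inball (fun=> r l) (fun i => u * e 0 i)) ->
    forall l, is_derive s (1 : R) (fun s => c s 0 l) (F s 0 l).
  move=> h l; rewrite cE mxE; exact: (has_grad_chain (hg l) (fun i => is_derive_ray _ i s) (h l)).
have dc s : (forall l, \forall u \near s, inball (fun=> r l) (fun i => u * e 0 i)) ->
    derivable c s 1 /\ derive1 c s = F s.
  move=> /dl h; have dcs : derivable c s 1.
    by apply/derivable_mxP => i l; rewrite ord1; case: (h l).
  split => //; rewrite derive1E derive_mx //; apply/rowP => l; rewrite mxE.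
  by case: (h l).
exists c; split.
- by rewrite /c scale0r addr0.
- by [].
- by apply: filterS hb => s [/dc []].
- have hb1 : \forall s \near (0 : R), \forall u \near s, derive1 c u = F u.
    apply: nbhs_interior; apply: filterS hb => s [/dc []] //.
  apply: filterS (filterI hb hb1) => s [[_ h2] h3].
  have e1 : derive1 c s = F s by exact: nbhs_singleton h3.
  rewrite /prop_for /continuous_at e1.
  have : F u @[u --> s] --> F s.
    apply: cvg_mx => l; rewrite mxE.
    rewrite (_ : (fun u => F u 0 l) = (fun u => \sum_i g l i (fun k => u * e 0 k) * e 0 i)); last first.
      by apply/funext => u; rewrite mxE.
    apply: cvg_sum_real => i; apply: cvgMl.
    exact: (has_grad_cont (hG (l, i)) (h2 (l, i))).
  apply: cvg_trans; apply: near_eq_cvg.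
  by apply: filterS h3 => u.
- have [h1 _] := nbhs_singleton hb.
  have [_ ->] := dc 0 h1; apply/rowP => l; rewrite !mxE; apply: eq_bigr => i _.
  by congr (g l i _ * _); apply/funext => k; rewrite mul0r.
Qed.

End tangent.

Section chart.
Variable R : realType.

Lemma derive_near_eq (f g : R -> R) t a b : is_derive t (1 : R) f a -> is_derive t (1 : R) g b ->
  (\forall s \near t, f s = g s) -> a = b.
Proof.
move=> hf hg /nbhs_ballP [d d0 h]; apply: (derive_right_eq d0 hf hg) => s /andP[ts sd].
by apply: h; rewrite /ball /= distrC ger0_norm ?subr_ge0 // ltrBlDl.
Qed.

Lemma near_inball (A : finType) (X : R -> A -> R) (d : A -> R) t r : 0 < r ->
  (forall i, is_derive t (1 : R) (X^~ i) (d i)) -> (forall i, X t i = 0) ->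
  \forall s \near t, inball (fun=> r) (X s).
Proof.
move=> r0 hX X0; apply: filter_fin => i.
have p : 0 < `|d i| + 1 by rewrite ltr_wpDl.
have h2 : \forall s \near t, `|s - t| < r / (`|d i| + 1).
  by apply/nbhs_ballP; exists (r / (`|d i| + 1)); rewrite /= ?divr_gt0 // => s; rewrite /ball /= distrC.
apply: filterS (filterI (is_derive_lip (hX i)) h2) => s [h3 h4].
move: h3; rewrite X0 subr0 => h3; apply: le_trans h3 _.
by move: h4; rewrite ltr_pdivlMr // mulrC => /ltW.
Qed.

Definition unitv (A : finType) (j : A) : A -> R := fun i => (i == j)%:R.

Lemma sum_unitv (A : finType) (j : A) (F : A -> R) : \sum_i F i * unitv j i = F j.
Proof.
rewrite (bigD1 j) //= /unitv eqxx mulr1 big1 ?addr0 // => i /negbTE ->.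
by rewrite mulr0.
Qed.

Lemma has_grad_unit (A : finType) f g r M (j : A) : has_grad f g r M ->
  is_derive (0 : R) (1 : R) (fun s => f (fun i => s * unitv j i)) (g j (fun=> 0)).
Proof. by move=> /(@has_grad_ray R A f g r M (unitv j)); rewrite sum_unitv. Qed.

Lemma has_grad_uniq (A : finType) f g r M (j : A) a : has_grad f g r M ->
  is_derive (0 : R) (1 : R) (fun s => f (fun i => s * unitv j i)) a -> g j (fun=> 0) = a.
Proof. by move=> /(has_grad_unit j) h1 h2; apply: (derive_near_eq h1 h2); exact: filterS filterT. Qed.

Lemma is_derive_sum_real (T : Type) (s : seq T) (f : T -> R -> R) (d : T -> R) t :
  (forall k, is_derive t (1 : R) (f k) (d k)) ->
  is_derive t (1 : R) (fun s' => \sum_(k <- s) f k s') (\sum_(k <- s) d k).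
Proof.
move=> h; elim: s => [|k s IH].
  apply: (is_derive_congr (is_derive_cst (0 : R) t 1)) => [u|]; by rewrite big_nil.
apply: (is_derive_congr (is_deriveD (h k) IH)) => [u|]; by rewrite big_cons.
Qed.

Lemma is_derive_mulr (f : R -> R) d k t : is_derive t (1 : R) f d ->
  is_derive t (1 : R) (fun s => f s * k) (d * k).
Proof.
move=> h; apply: (is_derive_congr (is_deriveZ k h)) => [u|]; by rewrite mulrC.
Qed.

(** Let [P] and [Q] be the linear parts of a chart of [M] and of its inverse. The first [d] rows
    of [Q] are velocities of curves in [M] ([analytic_curve_tangent]), hence lie in the row
    space of [b]. The displacement [u] of a point of [M] in the chart is a combination of the
    first [d] coordinates, so [u *m Q = w *m b] with [w = u *m (Q *m bi)], and
    [u = w *m (b *m P)]. [W] computes [w] from the point and [Psi] the point from [w]. *)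
Lemma adapted_chart n (U M : set 'rV[R]_n) r (b : 'M[R]_(r, n)) (bi : 'M[R]_(n, r)) :
  analytic_submanifold U M -> M 0 -> (forall v, tangent_space M 0 v -> (v <= b)%MS) ->
  b *m bi = 1%:M ->
  exists (W : 'I_r -> ('I_n -> R) -> R) (Psi : 'I_n -> ('I_r -> R) -> R),
  [/\ forall k, germ (W k) /\ W k (fun=> 0) = 0, forall l, germ (Psi l) /\ Psi l (fun=> 0) = 0,
    forall k g r' K, has_grad (W k) g r' K -> forall j, g j (fun=> 0) = bi j k,
    forall l g r' K, has_grad (Psi l) g r' K -> forall k, g k (fun=> 0) = b k l &
    \forall x \near (0 : 'rV[R]_n), M x -> forall l, x 0 l = Psi l (fun k => W k (rel_coord 0 x))].
Proof.
move=> [MU [d dn hM]] M0 htan bbi.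
have [A [B [phi [psi [[oA A0 oB] [[anphi anpsi hphi hpsi] [psiK phiK hMA]]]]]]] := hM 0 M0.
pose y0 := phi 0; have By0 : B y0 by apply: hphi; exists 0.
pose f j (z : 'I_n -> R) := phi (0 + \row_i z i) 0 j.
pose h l (z : 'I_n -> R) := psi (y0 + \row_i z i) 0 l.
have gf j : germ (f j) by exact: (analytic_on_germ j anphi oA A0).
have gh l : germ (h l) by exact: (analytic_on_germ l anpsi oB By0).
have /boolp.choice [F hF] : forall j, exists G : ('I_n -> ('I_n -> R) -> R) * (R * R),
    has_grad (f j) G.1 G.2.1 G.2.2.
  by move=> j; have [G [r' [M' [_ h']]]] := has_gradP (gf j); exists (G, (r', M')).
have /boolp.choice [H hH] : forall l, exists G : ('I_n -> ('I_n -> R) -> R) * (R * R),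
    (forall i, germ (G.1 i)) /\ has_grad (h l) G.1 G.2.1 G.2.2.
  by move=> l; have [G [r' [M' [h1 h2]]]] := has_gradP (gh l); exists (G, (r', M')).
pose P := \matrix_(k, j) (F j).1 k (fun=> 0).
pose Q := \matrix_(i, l) (H l).1 i (fun=> 0).
have rowE0 (z : 'I_n -> R) : z = (fun=> 0) -> \row_i z i = 0 :> 'rV[R]_n.
  by move=> ->; apply/rowP => i; rewrite !mxE.
have f0 j : f j (fun=> 0) = y0 0 j by rewrite /f rowE0 // addr0.
have h0 l : h l (fun=> 0) = 0.
  by rewrite /h rowE0 // addr0 /y0 psiK // mxE.
have PQ : P *m Q = 1%:M.
  apply/matrixP => k l; rewrite !mxE.
  pose X s j := f j (fun i => s * unitv k i) - y0 0 j.
  have dX j : is_derive (0 : R) (1 : R) (X^~ j) (P k j).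
    rewrite mxE; have := is_deriveB (has_grad_unit k (hF j)) (is_derive_cst (y0 0 j) (0 : R) 1).
    by rewrite subr0.
  have X0 j : X 0 j = 0.
    rewrite /X (_ : (fun i => 0 * unitv k i) = fun=> 0) ?f0 ?subrr //.
    by apply/funext => i; rewrite mul0r.
  have [_ hHl] := hH l; have [r0 _ _] := hHl.
  have := has_grad_chain hHl dX (near_inball r0 dX X0).
  have -> : X 0 = fun=> 0 by apply/funext.
  have -> : \sum_i (H l).1 i (fun=> 0) * P k i = \sum_j P k j * Q j l.
    by apply: eq_bigr => j _; rewrite mulrC [Q j l]mxE.
  rewrite [k == l]eq_sym => hd; apply: (derive_near_eq hd (is_derive_ray (unitv k) l 0)).
  have [rho rho0 hrho] := nbhs_close (open_nbhs_nbhs (conj oA A0)).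
  apply: filterS (near_ray (unitv k) rho0) => s hs; rewrite /h /X.
  have -> : y0 + \row_i (f i (fun i => s * unitv k i) - y0 0 i) = phi (\row_i (s * unitv k i)).
    by apply/rowP => i; rewrite !mxE addrC subrK /f add0r.
  rewrite psiK ?mxE //; apply: hrho => i; rewrite !mxE subr0; exact: hs.
have QP : Q *m P = 1%:M by exact: mulmx1C.
have y0d (i : 'I_n) : (d <= i)%N -> y0 0 i = 0.
  have : (B `&` [set y | forall i : 'I_n, (d <= i)%N -> y 0 i = 0]) y0.
    by rewrite -hMA; exists 0.
  by move=> [_]; exact.
have rowQ (i : 'I_n) : (i < d)%N -> (row i Q <= b)%MS.
  move=> id; apply: htan.
  have -> : row i Q = \row_l \sum_i' (H l).1 i' (fun=> 0) * (delta_mx 0 i : 'rV[R]_n) 0 i'.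
    apply/rowP => l; rewrite !mxE -[LHS](sum_unitv i (fun i' => (H l).1 i' (fun=> 0))).
    by apply: eq_bigr => i' _; rewrite mxE eqxx.
  have -> : (0 : 'rV[R]_n) = psi y0 by rewrite /y0 psiK.
  apply: (@analytic_curve_tangent R n M B psi y0 _ (fun l => (H l).1) (fun l => (H l).2.1) (fun l => (H l).2.2)).
  - by move=> l; case: (hH l).
  - by move=> l i'; case: (hH l).
  have [rho rho0 hrho] := nbhs_close (open_nbhs_nbhs (conj oB By0)).
  apply: filterS (near_ray (unitv i) rho0) => s hs.
  have : (B `&` [set y | forall i : 'I_n, (d <= i)%N -> y 0 i = 0]) (y0 + s *: delta_mx 0 i).
    split=> [|i' di']; last first.
      rewrite !mxE y0d // add0r eqxx /=; case: eqP => [ii|]; last by rewrite mulr0.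
      by move: di'; rewrite ii leqNgt id.
    by apply: hrho => i'; rewrite !mxE addrAC subrr add0r eqxx; exact: hs.
  by rewrite -hMA => -[x [Mx Ax] <-]; rewrite psiK.
pose W k (z : 'I_n -> R) := \sum_i (Q *m bi) i k * (f i z - y0 0 i).
pose zz i (w : 'I_r -> R) := \sum_k (b *m P) k i * w k.
pose Psi l (w : 'I_r -> R) := h l (fun i => zz i w).
have zz0 i : zz i (fun=> 0) = 0 by rewrite /zz big1 // => k _; rewrite mulr0.
exists W, Psi; split.
- move=> k; split; last by rewrite /W big1 // => i _; rewrite f0 subrr mulr0.
  apply: germ_sum => i; apply: germZ; apply: germD; [exact: gf|exact: germ_cst].
- move=> l; split; last by rewrite /Psi (_ : (fun i => zz i _) = fun=> 0) ?h0 //; apply/funext => i; rewrite zz0.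
  apply: (germ_comp (psi := fun w i => zz i w) (gh l)) => [i|//].
  by apply: germ_sum => k; apply: germZ; exact: germ_var.
- move=> k g r' K hg j; apply: (has_grad_uniq hg).
  have biE : bi = P *m (Q *m bi) by rewrite mulmxA PQ mul1mx.
  have -> : bi j k = \sum_i P j i * (Q *m bi) i k by rewrite {1}biE mxE.
  have := is_derive_sum_real (index_enum 'I_n) (fun i => is_derive_mulr ((Q *m bi) i k)
    (is_deriveB (has_grad_unit j (hF i)) (is_derive_cst (y0 0 i) (0 : R) 1))).
  move/is_derive_congr; apply=> [s|].
    by apply: eq_bigr => i _; rewrite mulrC.
  by apply: eq_bigr => i _; rewrite subr0 [P j i]mxE.
- move=> l g r' K hg k; apply: (has_grad_uniq hg).
  have bE : b = b *m P *m Q by rewrite -mulmxA PQ mulmx1.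
  have -> : b k l = \sum_i (b *m P) k i * Q i l by rewrite {1}bE mxE.
  pose X s i := zz i (fun k' => s * unitv k k').
  have dX i : is_derive (0 : R) (1 : R) (X^~ i) ((b *m P) k i).
    apply: (is_derive_congr (is_derive_mulr ((b *m P) k i) (is_derive_id (0 : R) 1))) => [s|].
      rewrite /X /zz; rewrite -[LHS]mulr1; under [RHS]eq_bigr do rewrite mulrCA.
      by rewrite -mulr_sumr sum_unitv mulr1.
    by rewrite mul1r.
  have X0 i : X 0 i = 0.
    by rewrite /X -[RHS](zz0 i); congr (zz i); apply/funext => k'; rewrite mul0r.
  have [_ hHl] := hH l; have [r0 _ _] := hHl.
  have := has_grad_chain hHl dX (near_inball r0 dX X0).
  have -> : X 0 = fun=> 0 by apply/funext.
  move/is_derive_congr; apply=> //.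
  by apply: eq_bigr => i _; rewrite mulrC [Q i l]mxE.
- apply: filterS (open_nbhs_nbhs (conj oA A0)) => x Ax Mx l.
  have [By yd] : (B `&` [set y | forall i : 'I_n, (d <= i)%N -> y 0 i = 0]) (phi x).
    by rewrite -hMA; exists x.
  pose u := phi x - y0.
  have ub : (u *m Q <= b)%MS.
    rewrite mulmx_sum_row; apply: summx_sub => i _; have [di|id] := leqP d i.
      by rewrite /u !mxE yd // y0d // subr0 scale0r sub0mx.
    by apply: scalemx_sub; exact: rowQ.
  pose w := u *m (Q *m bi).
  have wb : u *m Q = w *m b.
    have /submxP [D DE] := ub.
    by rewrite /w mulmxA DE -(mulmxA D) bbi mulmx1.
  have uE : u = w *m (b *m P) by rewrite mulmxA -wb -mulmxA QP mulmx1.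
  rewrite -[in LHS](psiK x Ax) /Psi /h; congr (psi _ 0 l).
  rewrite -[LHS](subrK y0) addrC; congr (_ + _); rewrite -/u uE.
  apply/rowP => i; rewrite mxE [RHS]mxE; apply: eq_bigr => k _; rewrite mulrC; congr (_ * _).
  rewrite /W mxE; apply: eq_bigr => i' _; rewrite mulrC; congr (_ * _).
  rewrite /u !mxE /f; congr (phi _ 0 i' - _).
  by apply/rowP => i''; rewrite !mxE add0r /rel_coord mxE subr0.
Qed.

End chart.

(** * One polyhedron near infinity *)

Section infinity_tools.
Variable R : realType.

Lemma germ_coef (A : finType) (f : (A -> R) -> R) : germ f ->
  exists c, [/\ cvps c, near0 (fun x => f x = ev c x), c (m0 A) = f (fun=> 0) &
    forall g r M, has_grad f g r M -> forall i, c (m1 i) = g i (fun=> 0)].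
Proof.
move=> /germ_cvps [c hc hf]; exists c; split => //.
  have [r r0 h] := hf; rewrite -ev0 -h // => i; by rewrite normr0 ltW.
move=> g r M hg i.
have [r' [M' [r0' M0' h']]] := cvps_taylor hc.
have hgc : has_grad (ev c) (fun i => ev (cder i c)) r' M' by [].
have [rho rho0 hrho] := hf.
have := derive_near_eq (has_grad_unit i hg) (has_grad_unit i hgc).
rewrite ev0 /cder ffunE mul1r (_ : madd (m1 i) (m0 A) = m1 i); last by rewrite maddC madd0.
move=> e; apply/esym/e.
by apply: filterS (near_ray (unitv R i) rho0) => s; exact: hrho.
Qed.

Lemma sqr_le_sum (A : finType) (x : A -> R) i : `|x i| <= Num.sqrt (\sum_j x j ^+ 2).
Proof.
rewrite -sqrtr_sqr ler_sqrt; last by apply: sumr_ge0 => j _; exact: sqr_ge0.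
by rewrite (bigD1 i) //= lerDl; apply: sumr_ge0 => j _; exact: sqr_ge0.
Qed.

Lemma sum_sqr_ge0 (A : finType) (x : A -> R) : 0 <= \sum_j x j ^+ 2.
Proof. by apply: sumr_ge0 => j _; exact: sqr_ge0. Qed.

Lemma germ_sqr_bnd (A : finType) (f : (A -> R) -> R) : germ f -> f (fun=> 0) = 0 ->
  exists C, near0 (fun x => f x ^+ 2 <= C * \sum_j x j ^+ 2).
Proof.
move=> /has_gradP [g [r [M [_ [r0 M0 h]]]]] f0; exists (M ^+ 2); exists r => // x hx.
have h0 : inball (fun _ : A => r) (fun=> 0) by move=> i; rewrite normr0 ltW.
have [|_] := h (fun=> 0) x _ (sqrtr_ge0 (\sum_j x j ^+ 2)) h0 hx.
  by move=> i; rewrite subr0; exact: sqr_le_sum.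
rewrite f0 subr0 => hf; rewrite -real_normK ?num_real //.
rewrite -[X in _ * X](sqr_sqrtr (sum_sqr_ge0 x)) -exprMn.
by apply: lerXn2r hf; rewrite nnegrE // mulr_ge0 // sqrtr_ge0.
Qed.

Lemma germ_flat_bnd (A : finType) (f : (A -> R) -> R) g r M : has_grad f g r M ->
  f (fun=> 0) = 0 -> (forall i, g i (fun=> 0) = 0) ->
  exists C, near0 (fun x => `|f x| <= C * \sum_j x j ^+ 2).
Proof.
move=> [r0 M0 h] f0 g0; exists M; exists r => // x hx.
have h0 : inball (fun _ : A => r) (fun=> 0) by move=> i; rewrite normr0 ltW.
have [|] := h (fun=> 0) x _ (sqrtr_ge0 (\sum_j x j ^+ 2)) h0 hx.
  by move=> i; rewrite subr0; exact: sqr_le_sum.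
rewrite f0 subr0 sqr_sqrtr ?sum_sqr_ge0 // big1 ?subr0 // => i _.
by rewrite g0 mul0r.
Qed.

(** The sum of squares is a Lyapunov function: its derivative is at most [- 2 m] times the sum,
    up to a cubic term that is eventually less than half of this. *)
Lemma exp_decay (A : finType) (X : R -> A -> R) (lam : A -> R) (F : A -> R -> R) C :
  (forall i, 0 < lam i) -> (forall i k, 0 < k -> evt (fun s => `|X s i| <= k)) ->
  (forall i, ddt (X^~ i) (F i)) ->
  (forall i, evt (fun s => `|F i s + lam i * X s i| <= C * \sum_j X s j ^+ 2)) ->
  exists2 rate, 0 < rate & forall i, small rate (X^~ i).
Proof.
move=> lam0 X0 hF hC.
pose m := \big[Num.min/1]_i lam i.
have mp : 0 < m.
  by rewrite /m; elim/big_ind: _ => // a b; rewrite lt_min => -> ->.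
have ml i : m <= lam i by rewrite /m (bigD1 i) //= ge_min lexx.
clearbody m.
pose S s := \sum_j X s j ^+ 2.
have S0 s : 0 <= S s by exact: sum_sqr_ge0.
pose K := `|C| * #|A|%:R + 1.
have Kp : 0 < K by rewrite ltr_wpDl // mulr_ge0.
have kp : 0 < m / (2 * K) by rewrite divr_gt0 // mulr_gt0.
have hE := evtI (evt_all (fun i => X0 i _ kp)) (evtI (evt_all hF) (evt_all hC)).
have [T hT] := hE.
have dS t : T < t -> is_derive t (1 : R) S (\sum_j 2 * X t j * F j t).
  move=> /hT [_ [h _]]; apply: is_derive_sum_real => j.
  apply: (is_derive_congr (is_deriveM (h j) (h j))) => [u|]; first by rewrite expr2.
  by rewrite /GRing.scale /=; ring.
have dS' t : T < t -> \sum_j 2 * X t j * F j t <= - m * S t.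
  move=> /hT [h1 [_ h2]].
  have h3 j : 2 * X t j * F j t <= - (2 * m) * X t j ^+ 2 + (m / K) * (`|C| * S t).
    have -> : 2 * X t j * F j t = - (2 * lam j) * X t j ^+ 2 + 2 * (X t j * (F j t + lam j * X t j)) by ring.
    apply: lerD; first by rewrite ler_wpM2r ?sqr_ge0 // lerN2 ler_pM2l.
    have h4 : `|X t j * (F j t + lam j * X t j)| <= m / (2 * K) * (`|C| * S t).
      rewrite normrM; apply: ler_pM => //; apply: le_trans (h2 j) _.
      by rewrite ler_wpM2r ?S0 // ler_norm.
    have h5 := ler_norm (X t j * (F j t + lam j * X t j)).
    have h6 : m / K * (`|C| * S t) = 2 * (m / (2 * K) * (`|C| * S t)).
      by field; rewrite gt_eqF.
    rewrite h6 ler_pM2l //; exact: le_trans h5 h4.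
  apply: le_trans (ler_sum _ (fun j _ => h3 j)) _.
  rewrite big_split /= -mulr_sumr -/(S t) sumr_const -mulr_natr.
  have h7 : m / K * (`|C| * S t) * #|A|%:R <= m * S t.
    have -> : m / K * (`|C| * S t) * #|A|%:R = m * S t * ((`|C| * #|A|%:R) / K).
      by field; rewrite gt_eqF.
    rewrite ler_piMr ?mulr_ge0 ?(ltW mp) // ler_pdivrMr // mul1r /K; lra.
  lra.
exists (m / 2); first by rewrite divr_gt0.
move=> i; pose E t := - (expR (m * t) * S t).
pose T1 := Num.max T 0 + 1.
have T1T : T < T1 by rewrite /T1; apply: (@le_lt_trans _ _ (Num.max T 0)); rewrite ?le_max ?lexx // ltrDl.
have mono t : T1 <= t -> E T1 <= E t.
  apply: (@mono_on R T E (fun t => - (expR (m * t) * (m * S t + \sum_j 2 * X t j * F j t)))) => // u Tu.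
    exact: (is_deriveN (is_derive_expM m (dS u Tu))).
  rewrite oppr_ge0 pmulr_rle0 ?expR_gt0 //; have := dS' u Tu; rewrite mulNr.
  by rewrite -lerBrDl sub0r.
pose B := expR (m * T1) * S T1; have B0 : 0 <= B by rewrite mulr_ge0 ?expR_ge0.
have mono' t : T1 <= t -> expR (m * t) * S t <= B by move=> /mono; rewrite /E lerN2.
clearbody B; exists (Num.sqrt B), T1 => t T1t.
have h1 : S t <= B * expR (- (m * t)).
  have h := mono' t (ltW T1t).
  by rewrite expRN ler_pdivlMr ?expR_gt0 // mulrC.
apply: le_trans (sqr_le_sum (X t) i) _.
have -> : Num.sqrt B * expR (- (m / 2 * t)) = Num.sqrt (B * expR (- (m * t))).
  rewrite sqrtrM //; congr (_ * _).
  have -> : - (m * t) = - (m / 2 * t) + - (m / 2 * t) by field.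
  by rewrite expRD -expr2 sqrtr_sqr ger0_norm ?expR_ge0.
by rewrite ler_sqrt // mulr_ge0 ?expR_ge0.
Qed.

Lemma finite_sums (A : finType) (lam : A -> R) k :
  exists s : seq R, forall a : mindex A, wdeg (fun=> 1%N) a = k -> lsum lam a \in s.
Proof.
exists [seq \sum_i lam i * (f i)%:R | f : {ffun A -> 'I_k.+1}] => a ak.
have h i : (a i < k.+1)%N by rewrite ltnS -ak /wdeg (bigD1 i) //= mul1n leq_addr.
apply/fintype.imageP; exists [ffun i => Ordinal (h i)] => //.
by apply: eq_bigr => i _; rewrite ffunE.
Qed.

Lemma order2_of_coef (A : finType) (c : mindex A -> R) : c (m0 A) = 0 -> (forall i, c (m1 i) = 0) ->
  forall a, (wdeg (fun=> 1%N) a < 2)%N -> c a = 0.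
Proof.
move=> c0 c1 a.
have -> : wdeg (fun=> 1%N) a = mdeg a by apply: eq_bigr => i _; rewrite mul1n.
move: a; apply: mindex_ind => // i b _; rewrite mdegD mdeg1 add1n ltnS ltnS leqn0 => /eqP b0.
suff -> : madd (m1 i) b = m1 i by [].
apply/ffunP => j; rewrite !ffunE; have : (b j <= mdeg b)%N by exact: mdeg_le.
by rewrite b0 leqn0 => /eqP ->; rewrite addn0.
Qed.

End infinity_tools.

Section infinity.
Variable R : realType.

Lemma germ_comp_grad (A B : finType) (f : (A -> R) -> R) (Psi : A -> (B -> R) -> R)
  gf rf Mf (P : A -> R) k : has_grad f gf rf Mf ->
  (forall a, Psi a (fun=> 0) = 0) ->
  (forall a, is_derive (0 : R) (1 : R) (fun s => Psi a (fun i => s * unitv R k i)) (P a)) ->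
  is_derive (0 : R) (1 : R) (fun s => f (fun a => Psi a (fun i => s * unitv R k i)))
    (\sum_a gf a (fun=> 0) * P a).
Proof.
move=> hf Psi0 hP; pose X s a := Psi a (fun i => s * unitv R k i).
have X0 a : X 0 a = 0.
  by rewrite /X -[RHS](Psi0 a); congr (Psi a); apply/funext => i; rewrite mul0r.
have [r0 _ _] := hf.
have := has_grad_chain hf hP (near_inball r0 hP X0).
by rewrite (_ : (fun i => Psi i _) = fun=> 0) //; apply/funext => a; exact: X0.
Qed.

(** [N] is the [l]-th component of the field in the coordinates of [adapted_chart], without its
    linear part: as [v] vanishes at the origin, that linear part is the [l]-th column of
    [b *m J *m bi], which is diagonal. *)
Lemma field_in_chart_flat n r (b : 'M[R]_(r, n)) (bi : 'M[R]_(n, r)) (J : 'M[R]_n) (lv : 'rV[R]_r)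
  (gW : 'I_r -> 'I_n -> ('I_n -> R) -> R) (v : 'I_n -> ('I_n -> R) -> R)
  (Psi : 'I_n -> ('I_r -> R) -> R) l :
  b *m bi = 1%:M -> b *m J = diag_mx (- lv) *m b ->
  (forall i, germ (gW l i) /\ gW l i (fun=> 0) = bi i l) ->
  (forall j, [/\ germ (v j), v j (fun=> 0) = 0 &
     forall g r' K, has_grad (v j) g r' K -> forall k, g k (fun=> 0) = J k j]) ->
  (forall j, [/\ germ (Psi j), Psi j (fun=> 0) = 0 &
     forall g r' K, has_grad (Psi j) g r' K -> forall k, g k (fun=> 0) = b k j]) ->
  let N w := \sum_i gW l i (Psi^~ w) * v i (Psi^~ w) + lv 0 l * w l in
  [/\ germ N, N (fun=> 0) = 0 &
    forall g r' K, has_grad N g r' K -> forall k, g k (fun=> 0) = 0].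
Proof.
move=> bbi bJ hW hv hPsi N.
have Psi0 j : Psi j (fun=> 0) = 0 by case: (hPsi j).
have gPsi j : germ (Psi j) by case: (hPsi j).
have PsiE : Psi^~ (fun=> 0) = fun=> 0 by apply/funext.
have gc f : germ f -> germ (fun w => f (Psi^~ w)).
  by move=> hf; apply: (germ_comp (psi := fun w a => Psi a w) hf).
split.
- apply: germD; last by apply: germZ; exact: germ_var.
  apply: germ_sum => i; apply: germM; apply: gc; first by case: (hW i).
  by case: (hv i).
- rewrite /N mulr0 addr0 big1 // => i _; rewrite PsiE.
  by case: (hv i) => _ -> _; rewrite mulr0.
move=> g r' K hg k; apply: (has_grad_uniq hg).
have dPsi a : is_derive (0 : R) (1 : R) (fun s => Psi a (fun i => s * unitv R k i)) (b k a).
  have [h1 _ h2] := hPsi a; have [gp [rp [Mp [_ hp]]]] := has_gradP h1.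
  by rewrite -(h2 _ _ _ hp k); exact: has_grad_unit hp.
have dprod i : is_derive (0 : R) (1 : R) (fun s => gW l i (fun a => Psi a (fun i => s * unitv R k i)) *
    v i (fun a => Psi a (fun i => s * unitv R k i))) (bi i l * (b *m J) k i).
  have [gw w0] := hW i; have [G [rG [MG [_ hG]]]] := has_gradP gw.
  have [gv v0 vJ] := hv i; have [H [rH [MH [_ hH]]]] := has_gradP gv.
  have d1 := germ_comp_grad hG Psi0 dPsi; have d2 := germ_comp_grad hH Psi0 dPsi.
  have z : (fun a => Psi a (fun i => 0 * unitv R k i)) = fun=> 0.
    by apply/funext => a; rewrite -[RHS](Psi0 a); congr (Psi a); apply/funext => i'; rewrite mul0r.
  apply: (is_derive_congr (is_deriveM d1 d2)) => // .
  rewrite z w0 v0 scale0r addr0 /GRing.scale /=; congr (_ * _).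
  rewrite mxE; apply: eq_bigr => a _; by rewrite (vJ _ _ _ hH) mulrC.
have dlin : is_derive (0 : R) (1 : R) (fun s => lv 0 l * (s * unitv R k l)) (lv 0 l * unitv R k l).
  exact: (is_deriveZ (lv 0 l) (is_derive_ray (unitv R k) l 0)).
have := is_deriveD (is_derive_sum_real (index_enum 'I_n) dprod) dlin.
move/is_derive_congr; apply=> //.
have -> : \sum_i bi i l * (b *m J) k i = (b *m J *m bi) k l.
  by rewrite [RHS]mxE; apply: eq_bigr => i _; rewrite mulrC.
rewrite bJ -mulmxA bbi mulmx1 !mxE /unitv (eq_sym l) -mulr_natr.
have [->|_] := eqVneq k l; last by rewrite !mulr0 addr0.
by rewrite !mulr1n mulr1 mulr1 addNr.
Qed.

Lemma polyh_star n (I : finType) (hs : I -> seq ('rV[R]_n * R)) i (q : 'rV[R]_n) s :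
  polyh hs i 0 -> polyh hs i q -> 0 <= s <= 1 -> polyh hs i (s *: q).
Proof.
move=> h0 hq /andP[s0 s1] ab abi; rewrite dotZ.
have b0 : ab.2 <= 0 by have := h0 ab abi; rewrite -(scale0r q) dotZ mul0r.
have := hq ab abi; nra.
Qed.

End infinity.

(** In the coordinates of [adapted_chart] the orbit satisfies
    [X_l' = - lv_l X_l + N_l(X) + err_l], where [N_l] is flat to first order by
    [field_in_chart_flat] and [err_l] is quadratic in the bad slacks by [field_near_piece]. The
    bad slacks are analytic functions of [X] that vanish at the origin, so the error is
    [O(|X|^2)] and [X] decays exponentially by [exp_decay]. All the weights are 1. *)
Theorem piece_infinity (R : realType) (n : nat) (U M : set 'rV[R]_n) (V : 'rV[R]_n -> 'rV[R]_n)
  (I : finType) (hs : I -> seq ('rV[R]_n * R)) (x : R -> 'rV[R]_n)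
  (v : I -> 'I_n -> ('I_n -> R) -> R) : open U -> C1_on V U -> U 0 -> V 0 = 0 ->
  (forall x, U x -> exists i, polyh hs i x) ->
  (forall i j, polyh hs i 0 -> germ (v i j)) ->
  (forall i j, polyh hs i 0 ->
    \forall x \near (0 : 'rV[R]_n), polyh hs i x -> V x 0 j = v i j (rel_coord 0 x)) ->
  (forall i, polyh hs i 0 -> (polyh hs i)° !=set0) ->
  analytic_submanifold U M -> M 0 ->
  diagonalizable_neg_on (jacobian V 0) (tangent_space M 0) ->
  (forall r : R, 0 < r -> evt (fun s => eclose r (x s) 0)) ->
  evt (fun s => M (x s)) ->
  evt (fun s => forall j, is_derive s (1 : R) (fun t => x t 0 j) (V (x s) 0 j)) ->
  exists j, evt (fun s => polyh hs j (x s)).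
Proof.
move=> hU hV U0 V0 hcov hv hvV fat hM M0 hdiag hy hMx hd.
have [i1 Di1 [C hC]] := field_near_piece hU hV U0 hcov hy hv hvV.
have [r [b [bi [lv [bbi bJ lv0 htan]]]]] := eigenbasis hdiag.
have [W [Psi [hW hPsi gradW gradPsi hMW]]] := adapted_chart hM M0 htan bbi.
have evtx (P : set 'rV[R]_n) : nbhs (0 : 'rV[R]_n) P -> evt (fun s => P (x s)).
  by move=> /nbhs_close [q q0 h]; apply: evtW (hy q q0) => s; exact: h.
pose vv := v i1.
have gvv j : germ (vv j) by exact: hv.
have vv0 j : vv j (fun=> 0) = 0.
  have := nbhs_singleton (hvV i1 j Di1) Di1; rewrite V0 mxE => h; rewrite [RHS]h; congr (v i1 j _).
  by apply/funext => k; rewrite /rel_coord subrr.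
have gradv j g r' K : has_grad (vv j) g r' K -> forall k, g k (fun=> 0) = jacobian V 0 k j.
  move=> hg; apply: (grad_jacobian hU hV U0 _ (fat i1 Di1) (hvV i1 j Di1) hg).
  by move=> q s hq; exact: (polyh_star Di1 hq).
have /boolp.choice [G hG] : forall l, exists G : ('I_n -> ('I_n -> R) -> R) * (R * R),
    (forall i, germ (G.1 i)) /\ has_grad (W l) G.1 G.2.1 G.2.2.
  move=> l; have [gW _] := hW l; have [g [r' [K [h1 h2]]]] := has_gradP gW.
  by exists (g, (r', K)).
pose gW l := (G l).1.
pose X s l := W l (rel_coord 0 (x s)).
have xX : evt (fun s => rel_coord 0 (x s) = Psi^~ (X s)).
  apply: evtW (evtI hMx (evtx _ hMW)) => s [h1 h2]; apply/funext => i.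
  by rewrite {1}/rel_coord mxE subr0; exact: h2.
have cb q : 0 < q -> evt (fun s => inball (fun=> q) (rel_coord 0 (x s))).
  by move=> q0; exact: hy.
have X0 l k : 0 < k -> evt (fun s => `|X s l| <= k).
  move=> k0; have [_ W0] := hW l; have [_ [r0 K0 h]] := hG l.
  have Kp : 0 < (G l).2.2 + 1 by rewrite ltr_wpDl.
  have e0 : 0 < k / ((G l).2.2 + 1) by rewrite divr_gt0.
  apply: evtW (evtI (cb _ r0) (cb _ e0)) => s [h1 h2].
  have [|||_] := h (fun=> 0) (rel_coord 0 (x s)) _ (ltW e0).
  - by move=> i; rewrite normr0 ltW.
  - exact: h1.
  - by move=> i; rewrite subr0; exact: h2.
  rewrite W0 subr0 => h3; apply: le_trans h3 _.
  by rewrite mulrA ler_pdivrMr // mulrC ler_wpM2l ?(ltW k0) // lerDl.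
pose Nf l w := \sum_i gW l i (Psi^~ w) * vv i (Psi^~ w) + lv 0 l * w l.
have flat l : [/\ germ (Nf l), Nf l (fun=> 0) = 0 &
    forall g r' K, has_grad (Nf l) g r' K -> forall k, g k (fun=> 0) = 0].
  apply: (field_in_chart_flat (gW := gW) bbi bJ) => [i|j|j].
  - by split; [exact: (hG l).1|exact: (gradW l _ _ _ (hG l).2 i)].
  - by split; [exact: gvv|exact: vv0|exact: gradv].
  - by split; [exact: (hPsi j).1|exact: (hPsi j).2|exact: gradPsi].
have /boolp.choice [N hN] : forall l, exists c, [/\ cvps c, near0 (fun w => Nf l w = ev c w),
    c (m0 'I_r) = 0 & forall i, c (m1 i) = 0].
  move=> l; have [gN N0 dN] := flat l.
  have [c [c1 c2 c3 c4]] := germ_coef gN; exists c; split => //; first by rewrite c3.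
  have [g [r' [K [_ h]]]] := has_gradP gN.
  by move=> i; rewrite (c4 _ _ _ h) (dN _ _ _ h).
pose err l s := \sum_i gW l i (rel_coord 0 (x s)) * (V (x s) 0 i - vv i (rel_coord 0 (x s))).
have dx : evt (fun s => forall i, is_derive s (1 : R) (fun s => rel_coord 0 (x s) i) (V (x s) 0 i)).
  apply: evtW hd => s h i.
  have := is_deriveB (h i) (is_derive_cst ((0 : 'rV[R]_n) 0 i) s 1).
  by rewrite subr0.
pose F l s := \sum_i gW l i (rel_coord 0 (x s)) * V (x s) 0 i.
have dX l : ddt (X^~ l) (F l).
  have [_ hg] := hG l; have [r0 K0 _] := hg.
  have [T hT] := evtI dx (cb _ r0).
  exists T => s Ts; have [h1 _] := hT s Ts.
  apply: (has_grad_chain hg h1).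
  apply/nbhs_ballP; exists (s - T); rewrite /= ?subr_gt0 // => u; rewrite /ball /= => us.
  apply: (hT u _).2; have := ler_norm (s - u); lra.
have FE l : evt (fun s => F l s = - lv 0 l * X s l + Nf l (X s) + err l s).
  apply: evtW xX => s xs; rewrite /F /err /Nf xs.
  under [in X in _ = _ + X]eq_bigr do rewrite mulrBr.
  rewrite sumrB; set a := \sum_i _; set a' := \sum_i _; ring.
have hsl ab : ab \in badhs hs x -> exists f, [/\ germ f, f (fun=> 0) = 0 &
     evt (fun s => f (X s) = slack x ab s)].
  move=> abb; exists (fun w => \sum_l ab.1 0 l * Psi l w); split.
  - by apply: germ_sum => l; apply: germZ; case: (hPsi l).
  - by rewrite big1 // => l _; rewrite (hPsi l).2 mulr0.
  apply: evtW xX => s xs; rewrite /slack -(badhs_p hy abb) -dotB; apply: eq_bigr => l _.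
  by rewrite -[Psi l _]/(Psi^~ (X s) l) -xs /rel_coord !mxE.
have X00 q : 0 < q -> evt (fun s => inball (fun=> q) (X s)).
  by move=> q0; apply: evt_all => l; exact: X0.
have herr : exists C1, 0 <= C1 /\ forall l,
    evt (fun s => `|err l s| <= C1 * \sum_(ab <- badhs hs x) slack x ab s ^+ 2).
  have /boolp.choice [B hB] : forall li : 'I_r * 'I_n, exists B,
      evt (fun s => `|gW li.1 li.2 (rel_coord 0 (x s))| <= B).
    move=> [l i]; have [c hc h1] := germ_cvps ((hG l).1 i); have [B h2] := near0_ev_bnd hc.
    have [q q0 h] := near0I h1 h2; exists B; apply: evtW (cb q q0) => s /h [e1 e2].
    by rewrite /gW e1.
  exists (\sum_l \sum_i `|B (l, i)| * `|C|); split.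
    by apply: sumr_ge0 => l _; apply: sumr_ge0 => i _; rewrite mulr_ge0.
  move=> l; apply: evtW (evtI hC (evt_all hB)) => s [h1 h2].
  set S := \sum_(ab <- badhs hs x) _ in h1 *.
  have S0 : 0 <= S by apply: sumr_ge0 => k _; exact: sqr_ge0.
  apply: le_trans (ler_norm_sum _ _ _) _.
  rewrite mulr_suml (bigD1 l) //= mulr_suml.
  rewrite -[leLHS]addr0; apply: lerD; last first.
    by apply: sumr_ge0 => l' _; rewrite mulr_ge0 // sumr_ge0 // => i _; rewrite mulr_ge0.
  apply: ler_sum => i _; rewrite normrM -mulrA; apply: ler_pM => //.
    by apply: le_trans (h2 (l, i)) _; exact: ler_norm.
  by apply: le_trans (h1 i) _; rewrite ler_wpM2r // ler_norm.
have [C1 [C10 hC1]] := herr.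
have [C2 hC2] : exists C2, evt (fun s => \sum_(ab <- badhs hs x) slack x ab s ^+ 2 <=
    C2 * \sum_l X s l ^+ 2).
  have : {subset badhs hs x <= badhs hs x} by [].
  move: {1 3}(badhs hs x) => q; elim: q => [|ab q IH] hq.
    by exists 0, 0 => s _; rewrite big_nil mul0r.
  have [|C2 h2] := IH; first by move=> ab' h; apply: hq; rewrite in_cons h orbT.
  have [|f [gf f0 hf]] := hsl ab; first by apply: hq; rewrite in_cons eqxx.
  have [C3 [r0 r0p h3]] := germ_sqr_bnd gf f0.
  exists (C3 + C2); apply: evtW (evtI h2 (evtI hf (X00 _ r0p))) => s [e2 [e3 e4]].
  by rewrite big_cons -e3 mulrDl lerD // h3.
have [C3 hC3] : exists C3, forall l, evt (fun s => `|Nf l (X s)| <= C3 * \sum_l X s l ^+ 2).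
  have /boolp.choice [B hB] : forall l, exists B, evt (fun s => `|Nf l (X s)| <= B * \sum_l X s l ^+ 2).
    move=> l; have [gN N0 dN] := flat l; have [g [r' [K [_ h]]]] := has_gradP gN.
    have [B [q q0 hB]] := germ_flat_bnd h N0 (dN _ _ _ h).
    by exists B; apply: evtW (X00 _ q0) => s; exact: hB.
  exists (\sum_l `|B l|) => l; apply: evtW (hB l) => s h; apply: le_trans h _.
  rewrite ler_wpM2r ?sum_sqr_ge0 // (bigD1 l) //=; apply: le_trans (ler_norm _) _.
  by rewrite lerDl sumr_ge0.
have [rate rate0 hX] : exists2 rate, 0 < rate & forall l, small rate (X^~ l).
  apply: (exp_decay (C := C3 + C1 * C2) lv0 X0 dX) => l.
  apply: evtW (evtI (FE l) (evtI (hC1 l) (evtI hC2 (hC3 l)))) => s [-> [e1 [e2 e3]]].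
  have -> : - lv 0 l * X s l + Nf l (X s) + err l s + lv 0 l * X s l = Nf l (X s) + err l s by ring.
  apply: le_trans (ler_normD _ _) _; rewrite mulrDl; apply: lerD => //.
  by apply: le_trans e1 _; rewrite -mulrA ler_wpM2l.
apply: (@one_piece_of_system R 'I_r X (lv 0) (fun=> 1%N) N err rate n I hs x C1) => //.
- by move=> l; case: (hN l).
- move=> l; have [_ [q q0 h] _ _] := hN l.
  have [T hT] := evtI (dX l) (evtI (FE l) (X00 _ q0)); exists T => s /hT [d1 [d2 d3]].
  by rewrite -h // -d2.
- by move=> l; have [_ _ c0 c1] := hN l; exact: order2_of_coef.
- exact: finite_sums.
- by apply: evtW (evtx _ (open_nbhs_nbhs (conj hU U0))) => s; exact: hcov.
Qed.

(** * From local pieces to a finite subdivision *)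

Section assembly.
Variable R : realType.

Lemma convex_polytope_polyh n (I : finType) (D : I -> set 'rV[R]_n) :
  (forall i, convex_polytope (D i)) ->
  exists hs : I -> seq ('rV[R]_n * R), forall i, D i = polyh hs i.
Proof.
move=> hD; suff /boolp.choice [hs h] : forall i, exists s : seq ('rV[R]_n * R),
    D i = [set x | forall ab, ab \in s -> ab.2 <= dot ab.1 x] by exists hs.
move=> i; have [_ [k [H [hH ->]]]] := hD i.
have /boolp.choice [ab hab] : forall l, exists ab : 'rV[R]_n * R,
    H l = [set x | ab.2 <= dot ab.1 x].
  by move=> l; have [a [b [_ ->]]] := hH l; exists (a, b).
exists [seq ab l | l <- enum 'I_k]; apply/seteqP; split=> x /= hx.
  by move=> _ /mapP [l _ ->]; have := hx l Logic.I; rewrite hab.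
by move=> l _; rewrite hab; apply: hx; apply: map_f; rewrite mem_enum.
Qed.

Lemma analytic_pieces n (U : set 'rV[R]_n) (I : finType) (D : I -> set 'rV[R]_n)
  (V : 'rV[R]_n -> 'rV[R]_n) p : open U -> U p -> (forall i, analytic_on V (D i `&` U)) ->
  exists v : I -> 'I_n -> ('I_n -> R) -> R,
   (forall i j, D i p -> germ (v i j)) /\
   (forall i j, D i p -> \forall x \near p, D i x -> V x 0 j = v i j (rel_coord p x)).
Proof.
move=> hU Up hV.
have /boolp.choice [f hf] : forall i, exists f, D i p -> analytic_at f p /\
    \forall x \near p, D i x -> V x = f x.
  move=> i; have [W [f [oW DW an fV]]] := hV i; exists f => Dp.
  have Wp : W p by exact: DW.
  split; first exact: an.
  apply: filterS (open_nbhs_nbhs (conj hU Up)) => x Ux Dx.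
  by rewrite fV.
exists (fun i j z => f i (p + \row_l z l) 0 j); split => i j Dp.
  by apply: analytic_at_germ; case: (hf i Dp).
have [_ h] := hf i Dp; apply: filterS h => x h /h ->; congr (f i _ 0 j).
by apply/rowP => l; rewrite !mxE addrC subrK.
Qed.

Lemma is_derive_within n (T t : R) (x : R -> 'rV[R]_n) v j : T < t ->
  has_derivative_within `[T, +oo[ x t v -> is_derive t (1 : R) (fun s => x s 0 j) (v 0 j).
Proof.
move=> Tt hx; apply: is_derive_eps => e e0.
have fF : Filter (within `[T, +oo[ t^') by exact: within_filter.
have h1 := continuous_cvg _ (@coord_continuous R 1 n 0 j v) hx.
move/cvgrPdist_le: (h1 fF) => /(_ e e0); rewrite /within /= => {}h1.
have h2 : \forall s \near t, s \in `[T, +oo[.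
  apply: filterS (lt_nbhsr Tt) => s Ts; by rewrite in_itv /= andbT ltW.
have h3 : \forall s \near t, s != t -> s \in `[T, +oo[ ->
    `|v 0 j - ((s - t)^-1 *: (x s - x t)) 0 j| <= e.
  by [].
apply: filterS (filterI h2 h3) => s [Ts]; have [->|st] := eqVneq s t.
  by rewrite !subrr mulr0 subr0 normr0 mulr_ge0 // ltW.
move=> /(_ isT Ts); have st0 : s - t != 0 by rewrite subr_eq0.
rewrite !mxE => h4.
have -> : x s 0 j - x t 0 j - v 0 j * (s - t) =
   - ((v 0 j - (s - t)^-1 * (x s 0 j - x t 0 j)) * (s - t)) by field.
by rewrite normrN normrM ler_wpM2r.
Qed.

(** At [t = T] the flow is continuous from the right only. *)
Lemma within_close n (T t : R) (x : R -> 'rV[R]_n) r : {within `[T, +oo[, continuous x} ->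
  T <= t -> 0 < r -> exists2 d, 0 < d &
  forall s, T <= s -> `|s - t| < d -> eclose r (x s) (x t).
Proof.
move=> hc Tt r0; have h : nbhs (x t) [set y | eclose r y (x t)] by exact: (close_nbhs r0).
have Tt' : [set` `[T, +oo[] t by rewrite /= in_itv /= Tt.
have /nbhs_ballP [d d0 hd] : within `[T, +oo[ (nbhs t) (x @^-1` [set y | eclose r y (x t)]).
  rewrite nbhs_subspace_in //; exact: (hc t _ h).
exists d => // s Ts sd; apply: hd; first by rewrite /ball /= distrC.
by rewrite /= in_itv /= Ts.
Qed.

Lemma evt_right (P : R -> Prop) t : evt (fun s => P (t + 1 * expR (- s))) ->
  exists2 e, 0 < e & forall u, t < u < t + e -> P u.
Proof.
move=> [S hS]; exists (expR (- S)); first exact: expR_gt0.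
move=> u /andP[tu ue]; have ut : 0 < u - t by rewrite subr_gt0.
have -> : u = t + 1 * expR (- - ln (u - t)) by rewrite mul1r opprK lnK ?posrE // addrC subrK.
by apply: hS; rewrite ltrNr -ltr_expR lnK ?posrE // ltrBlDl.
Qed.

Lemma evt_left (P : R -> Prop) t : evt (fun s => P (t + -1 * expR (- s))) ->
  exists2 e, 0 < e & forall u, t - e < u < t -> P u.
Proof.
move=> [S hS]; exists (expR (- S)); first exact: expR_gt0.
move=> u /andP[eu ut]; have tu : 0 < t - u by rewrite subr_gt0.
have -> : u = t + -1 * expR (- - ln (t - u)).
  by rewrite mulN1r opprK lnK ?posrE // opprB addrC subrK.
by apply: hS; rewrite ltrNr -ltr_expR lnK ?posrE //; rewrite ltrBlDr in eu; rewrite ltrBlDr addrC.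
Qed.

Lemma evt_side (t T d sg : R) : `|sg| = 1 -> T <= t -> (sg = 1 \/ T < t) -> 0 < d ->
  evt (fun s => [/\ T < t + sg * expR (- s) & `|t + sg * expR (- s) - t| < d]).
Proof.
move=> sg1 Tt hs d0.
have hd : evt (fun s => `|t + sg * expR (- s) - t| < d).
  apply: evtW (evt_expRN ltr01 d0) => s; rewrite mul1r addrAC subrr add0r normrM sg1 mul1r.
  by rewrite ger0_norm ?expR_ge0.
case: hs => [s1|lt].
  by apply: evtW hd => s h; split => //; rewrite s1 mul1r (le_lt_trans Tt) // ltrDl expR_gt0.
have d1 : 0 < t - T by rewrite subr_gt0.
apply: evtW (evtI hd (evt_expRN ltr01 d1)) => s [h1]; rewrite mul1r => h2; split => //.
have : `|sg * expR (- s)| = expR (- s) by rewrite normrM sg1 mul1r ger0_norm ?expR_ge0.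
have := ler_norm (- (sg * expR (- s))); rewrite normrN; lra.
Qed.

Section chain.
Variables (I : finType) (n : nat) (D : I -> set 'rV[R]_n) (x : R -> 'rV[R]_n).

(** The end point [a] is an extended real so that the last step, to infinity, is an extension
    like the others. *)
Definition chain (a : \bar R) : Prop := exists (N : nat) (t : nat -> \bar R),
  [/\ t 0%N = 0%:E, t N = a, forall i, (i < N)%N -> (t i < t i.+1)%E &
    forall i, (i < N)%N -> exists j, x @` [set s | (t i <= s%:E < t i.+1)%E] `<=` D j].

Lemma chain0 : chain 0%:E.
Proof. by exists 0%N, (fun=> 0%:E). Qed.

Lemma chain_ext a a' j : chain a -> (a < a')%E ->
  (forall s, (a <= s%:E < a')%E -> D j (x s)) -> chain a'.
Proof.
move=> [N [t [t0 tN tlt tD]]] aa' hj.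
exists N.+1, (fun i => if (i <= N)%N then t i else a'); split.
- by rewrite leq0n.
- by rewrite /= ltnn.
- move=> i; rewrite ltnS [X in is_true X -> _]leq_eqVlt => /predU1P[->|iN].
    by rewrite /= leqnn ltnn tN.
  by rewrite /= (ltnW iN) iN; exact: tlt.
- move=> i; rewrite ltnS [X in is_true X -> _]leq_eqVlt => /predU1P[->|iN].
    by exists j => _ [s + <-]; rewrite /= leqnn ltnn tN; exact: hj.
  by rewrite /= (ltnW iN) iN; exact: tD.
Qed.

Hypotheses (hr : forall t, 0 <= t -> exists j, exists2 e, 0 < e & forall u, t <= u < t + e -> D j (x u))
  (hl : forall t, 0 < t -> exists j, exists2 e, 0 < e & forall u, t - e < u < t -> D j (x u)).

(** The supremum of the end points that can be reached is itself reached, using one piece on its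
    left, and only [b] cannot be passed, using one piece on the right. *)
Lemma chain_finite b : 0 <= b -> chain b%:E.
Proof.
move=> b0; pose S := [set a : R | 0 <= a <= b /\ chain a%:E].
have S0 : S 0 by split; [rewrite lexx|exact: chain0].
have hS : has_sup S by split; [exists 0|exists b => s [/andP[]]].
pose c := sup S.
have c0 : 0 <= c by apply: ub_le_sup => //; case: hS.
have cb : c <= b by apply: ge_sup; [exists 0|move=> s [/andP[]]].
have cc : chain c%:E.
  have [z|cp] := eqVneq c 0; first by rewrite z; exact: chain0.
  have {}cp : 0 < c by rewrite lt_neqAle eq_sym cp.
  have [j [e e0 hj]] := hl cp.
  have [a Sa ae] := sup_adherent e0 hS; rewrite -/c in ae; have [_ ca] := Sa.
  have [->//|ac] := eqVneq c a.
  have {}ac : a < c.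
    by rewrite lt_neqAle eq_sym ac; apply: ub_le_sup => //; case: hS.
  apply: (chain_ext (j := j) ca); rewrite ?lte_fin // => s; rewrite lee_fin lte_fin => /andP[h1 h2].
  by apply: hj; rewrite h2 (lt_le_trans ae).
have [cltb|bc] := ltrP c b; last by have -> : b = c by apply/eqP; rewrite eq_le bc cb.
have [j [e e0 hj]] := hr c0.
pose a := Num.min b (c + e).
have ca : c < a by rewrite /a lt_min cltb ltrDl.
have : S a.
  split; first by rewrite (le_trans c0 (ltW ca)) /a ge_min lexx.
  apply: (chain_ext (j := j) cc); rewrite ?lte_fin // => s; rewrite lee_fin lte_fin => /andP[h1 h2].
  by apply: hj; rewrite h1 (lt_le_trans h2) // /a ge_min lexx orbT.
by move=> Sa; have : a <= c by [apply: ub_le_sup => //; case: hS]; rewrite leNgt ca.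
Qed.

Lemma chain_infinite T j : (forall s, T < s -> D j (x s)) -> chain +oo%E.
Proof.
move=> hT; have b0 : 0 <= Num.max T 0 + 1 by rewrite addr_ge0 // le_max lexx orbT.
apply: (chain_ext (j := j) (chain_finite b0)); first exact: ltry.
move=> s /andP[+ _]; rewrite lee_fin => h; apply: hT; apply: lt_le_trans h.
by apply: (@le_lt_trans _ _ (Num.max T 0)); rewrite ?le_max ?lexx // ltrDl.
Qed.

End chain.

End assembly.

Theorem theorem1p1 (R : realType) (n : nat)
    (U : set 'rV[R]_n) (hU : open U)
    (I : finType) (D : I -> set 'rV[R]_n)
    (hD : forall i, convex_polytope (D i))
    (hDcl : forall i, closed (D i))
    (hcov : U `<=` \bigcup_(i in [set: I]) D i)
    (M : set 'rV[R]_n) (hM : analytic_submanifold U M) (hM0 : M 0)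
    (V : 'rV[R]_n -> 'rV[R]_n) (hV : C1_on V U)
    (hVan : forall i, analytic_on V (D i `&` U))
    (hVtan : forall x, M x ->
       'd V x @` tangent_space M x `<=` tangent_space M x)
    (hV0 : V 0 = 0)
    (hVdiag : diagonalizable_neg_on (jacobian V 0) (tangent_space M 0))
    (T : R) (hT : T <= 0) (x : R -> 'rV[R]_n) (hx : flow_on M T x)
    (hode : forall t, 0 <= t ->
       has_derivative_within `[T, +oo[ x t (V (x t)))
    (hlim : x t @[t --> +oo] --> (0 : 'rV[R]_n)) :
  exists (N : nat) (t : nat -> \bar R),
    [/\ t 0%N = 0%:E,
        t N = +oo%E,
        forall i, (i < N)%N -> (t i < t i.+1)%E
      & forall i, (i < N)%N ->
          exists j, x @` [set s | (t i <= s%:E < t i.+1)%E] `<=` D j].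
Proof.
have [hs /funext DE] := convex_polytope_polyh hD; subst D.
have [MU _] := hM.
have [xc xM] := hx.
have cov z : U z -> exists i, polyh hs i z by move=> /hcov [i _ h]; exists i.
have Ux (t : R) : 0 <= t -> U (x t) by move=> t0; apply: MU; apply: xM; exact: le_trans t0.
have dx (t : R) : 0 < t -> forall j, is_derive t (1 : R) (fun s => x s 0 j) (V (x t) 0 j).
  by move=> t0 j; exact: (is_derive_within j (le_lt_trans hT t0) (hode t (ltW t0))).
have side (t sg : R) : `|sg| = 1 -> 0 <= t -> sg = 1 \/ 0 < t ->
    exists j, evt (fun s => polyh hs j (x (t + sg * expR (- s)))).
  move=> sg1 t0 st; have Uxt := Ux t t0.
  have [v [gv hvV]] := analytic_pieces hU Uxt hVan.
  apply: (piece_finite_time hU hV Uxt cov gv hvV sg1).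
    move=> r r0; have [d d0 hd] := within_close xc (le_trans hT t0) r0.
    apply: evtW (evt_side sg1 t0 st d0) => s [h1 h2]; apply: hd => //.
    exact: le_trans (ltW h1).
  by apply: evtW (evt_side sg1 t0 st ltr01) => s [h1 _]; exact: dx.
have left (t : R) : 0 < t -> exists j, exists2 e, 0 < e & forall u, t - e < u < t -> polyh hs j (x u).
  move=> t0; have [|||j hj] := side t (-1); [by rewrite normrN1|exact: ltW|by right|].
  by exists j; exact: (@evt_left R (fun u => polyh hs j (x u)) t hj).
have right (t : R) : 0 <= t -> exists j, exists2 e, 0 < e & forall u, t <= u < t + e -> polyh hs j (x u).
  move=> t0; have [|||j hj] := side t 1; [by rewrite normr1|by []|by left|].
  have [e e0 he] := @evt_right R (fun u => polyh hs j (x u)) t hj.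
  exists j, e => // u /andP[]; rewrite le_eqVlt => /predU1P[<- _|tu ue]; last by apply: he; rewrite tu.
  apply: contrapT => nD.
  have [r r0 hr] : exists2 r, 0 < r & forall z, eclose r z (x t) -> ~ polyh hs j z.
    apply: (@nbhs_close R n (x t) (~` polyh hs j)).
    by apply: open_nbhs_nbhs; split => //; exact: closed_openC.
  have [d d0 hd] := within_close xc (le_trans hT t0) r0.
  pose k := Num.min d e / 2.
  have m0 : 0 < Num.min d e by rewrite lt_min d0.
  have k0 : 0 < k by rewrite divr_gt0.
  have [kd ke] : k < d /\ k < e.
    have : k < Num.min d e by rewrite /k ltr_pdivrMr // ltr_pMr // ltr1n.
    by rewrite lt_min => /andP[].
  apply: (hr (x (t + k))).
    apply: hd; first by rewrite (le_trans (le_trans hT t0)) // lerDl ltW.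
    by rewrite addrAC subrr add0r gtr0_norm.
  by apply: he; rewrite ltrDl k0 ltrD2l.
have [j [S hS]] : exists j, evt (fun s => polyh hs j (x s)).
  have U0 : U 0 by exact: MU.
  have [v [gv hvV]] := analytic_pieces hU U0 hVan.
  apply: (piece_infinity hU hV U0 hV0 cov gv hvV _ hM hM0 hVdiag).
  - by move=> i _; case: (hD i).
  - move=> r r0; have : nbhs (0 : 'rV[R]_n) [set y | eclose r y 0] by exact: (close_nbhs r0).
    by move=> /hlim [S [_ hS]]; exists S.
  - by exists 0 => s s0; apply: xM; exact: le_trans (ltW s0).
  - by exists 0 => s s0; exact: dx.
have [N [t h]] := chain_infinite right left hS.
by exists N, t.
Qed.
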